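(* Let $u$ be the solution of the delay subdiffusion problem and suppose that, with $u_{k\tau}$ denoting the restriction of $u$ to $t\in((k-1)\tau,k\tau]$ and $u_\tau=u_{1\tau}$, $$|\partial_t u_{k\tau}|\le C(1+t^{\alpha-1}),\ k=1,\dots,K;\qquad |\partial_t^2u_\tau|\le C(1+t^{\alpha-2});\qquad |\partial_t^2u_{k\tau}|\le C(1+(t-\tau)^{\alpha-1}),\ k=2,\dots,K.$$ Assume further that $u\in L^\infty(-\tau,K\tau;H^2(\Omega))$, $\partial_tu\in L^1(-\tau,K\tau;H^2(\Omega))$, and that $u_h^n$, $-2N\le n\le0$, is a suitable approximation of $\varphi(x,t_n)$ such that $\|u_h^n-\varphi(\cdot,t_n)\|\lesssim h^2$. Let $u_h^n\in X_h$, $1\le n\le 2KN$, be the numerical solution on the uniform time mesh with step $\rho=\tau/(2N)$ of $$(D^\alpha u_h^n,v_h)+B(u_h^n,v_h)=(bJ^{1-\alpha}u_h^{n-2N},v_h)+(G^n,v_h)\quad\forall v_h\in X_h.$$ Then $$\|u^n-u_h^n\|\lesssim\begin{cases}h^2+\rho\,t_n^{\alpha-1},&1\le n\le2N,\\ h^2+\rho,&2N+1\le n\le2KN.\end{cases}$$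
   Context: Problem: $0<\alpha<1$, $\tau>0$, $K\in\mathbb N^+$, $p>0$, $a\le 0$, $b\ne 0$ constants, $\Omega=(0,L)$, $\Omega_T=(0,L)\times(0,K\tau]$, and $$\partial_t u(x,t)=\partial_t^{1-\alpha}\big(p\Delta u+au(x,t)\big)+bu(x,t-\tau)+f(x,t),\quad (x,t)\in\Omega_T,$$ with $u=\varphi$ on $\Omega\times[-\tau,0]$ and $u=0$ on $\partial\Omega$ for $t\in[-\tau,K\tau]$; $f$, $\varphi$ continuous. It is used in the transformed form ${}_0^C\mathrm D_t^\alpha u=p\Delta u+au+{}_0I_t^{1-\alpha}[bu(x,t-\tau)]+G$ with $G={}_0I_t^{1-\alpha}f$. Here $\omega_\beta(t)=t^{\beta-1}/\Gamma(\beta)$, ${}_0I_t^{\beta}v(t)=\int_0^t\omega_\beta(t-s)v(s)\,ds$, $\partial_t^{1-\alpha}v=\partial_t\,{}_0I_t^\alpha v$, ${}_0^C\mathrm D_t^\alpha u(x,t)=\int_0^t\omega_{1-\alpha}(t-s)\partial_su(x,s)\,ds$. The solution is understood to be continuous in time, with the time derivatives appearing in the bounds existing on each delay interval; the bounds are uniform in $x$. Uniform mesh: $N\ge2$ an integer, $\rho=\tau/(2N)$, $t_n=n\rho$ for $-2N\le n\le2KN$. Put $u^n=u(\cdot,t_n)$, $\nabla_tv^n=v^n-v^{n-1}$, $G^n=G(\cdot,t_n)$, $$a_{n-k}=\frac{\omega_{2-\alpha}(t_n-t_{k-1})-\omega_{2-\alpha}(t_n-t_k)}{\rho},\qquad D^\alpha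 v^n=\sum_{k=1}^na_{n-k}\nabla_tv^k,\qquad J^{1-\alpha}v^{n-2N}=\sum_{k=1}^n\rho\,a_{n-k}v^{k-2N}.$$ $X_h\subset H_0^1(\Omega)$ is the continuous piecewise linear finite element space on a quasi-uniform mesh of $\Omega$ with maximal diameter $h$; $u_h^n\in X_h$ for $-2N\le n\le 0$ as well; $(u,v)=\int_\Omega uv\,dx$, $\|u\|=(u,u)^{1/2}$, $B(u,v)=p\left(\frac{du}{dx},\frac{dv}{dx}\right)-(au,v)$. $A\lesssim B$ means $A\le CB$ with a constant $C>0$ independent of $N$, $h$ and $n$. *)

(* Defs.v *)
From HB Require Import structures.
From mathcomp Require Import all_boot all_order all_algebra.
From mathcomp Require Import all_classical all_reals all_analysis.

Set Implicit Arguments.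
Unset Strict Implicit.
Unset Printing Implicit Defensive.

Import Order.TTheory GRing.Theory Num.Theory.
Import numFieldNormedType.Exports.

Local Open Scope ring_scope.
Local Open Scope classical_set_scope.

(* Functions on a space-time region are written [u x t], space variable first. *)

Section FractionalCalculus.
Context {R : realType}.
Local Notation mu := (@lebesgue_measure R).

Definition Gamma (z : R) : R :=
  \int[mu]_(t in `]0, +oo[) (t `^ (z - 1) * expR (- t)).

Definition omega (beta t : R) : R := t `^ (beta - 1) / Gamma beta.

Definition frac_int (beta : R) (v : R -> R) (t : R) : R :=
  \int[mu]_(s in `]0, t[) (omega beta (t - s) * v s).

Definition caputo (alpha : R) (v : R -> R) (t : R) : R :=
  \int[mu]_(s in `]0, t[) (omega (1 - alpha) (t - s) * derive1 v s).

End FractionalCalculus.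

Section SobolevSpaces.
Context {R : realType}.
Local Notation mu := (@lebesgue_measure R).

Definition test_function (c d : R) (psi : R -> R) : Prop :=
  [/\ forall x, derivable psi x 1,
      continuous (derive1 psi) &
      exists c' d', [/\ c < c', d' < d &
                        forall x, x \notin `[c', d'] -> psi x = 0]].

(* [dg] is the weak derivative of [g] on the bounded interval (c, d), with C^1
   compactly supported test functions. *)
Definition weak_derivative (c d : R) (g dg : R -> R) : Prop :=
  [/\ mu.-integrable `]c, d[ (EFin \o g),
      mu.-integrable `]c, d[ (EFin \o dg) &
      forall psi, test_function c d psi ->
        \int[mu]_(x in `]c, d[) (g x * derive1 psi x) =
        - \int[mu]_(x in `]c, d[) (dg x * psi x)].

Definition L2 (L : R) (g : R -> R) : Prop :=
  measurable_fun (`]0, L[ : set R) g /\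
  mu.-integrable `]0, L[ (fun x => ((g x) ^+ 2)%:E).

Definition ip (L : R) (v w : R -> R) : R := \int[mu]_(x in `]0, L[) (v x * w x).

Definition L2norm (L : R) (v : R -> R) : R := Num.sqrt (ip L v v).

(* [g] is in H^2(0, L), with first and second weak derivatives [g1], [g2]. *)
Definition H2_with (L : R) (g g1 g2 : R -> R) : Prop :=
  [/\ L2 L g, L2 L g1, L2 L g2,
      weak_derivative 0 L g g1 & weak_derivative 0 L g1 g2].

Definition H2norm (L : R) (g g1 g2 : R -> R) : R :=
  Num.sqrt (L2norm L g ^+ 2 + L2norm L g1 ^+ 2 + L2norm L g2 ^+ 2).

(* A (strongly) measurable map (T0, T1) -> H^2(0, L).  As H^2(0, L) is
   separable, such a map is the same thing as a function of (x, t) which,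
   together with its first two weak x-derivatives, has a jointly measurable
   representative. *)
Definition H2_valued (L T0 T1 : R) (w w1 w2 : R -> R -> R) : Prop :=
  let Q : set (measurableTypeR R * measurableTypeR R) :=
    (`]0, L[ : set R) `*` (`]T0, T1[ : set R) in
  [/\ measurable_fun Q (fun z => w z.1 z.2 : R),
      measurable_fun Q (fun z => w1 z.1 z.2 : R),
      measurable_fun Q (fun z => w2 z.1 z.2 : R) &
      {ae mu, forall t, t \in `]T0, T1[ ->
         H2_with L (w^~ t) (w1^~ t) (w2^~ t)}].

Definition Linfty_H2 (L T0 T1 : R) (w : R -> R -> R) : Prop :=
  exists w1 w2, H2_valued L T0 T1 w w1 w2 /\
    exists M, {ae mu, forall t, t \in `]T0, T1[ ->
                 H2norm L (w^~ t) (w1^~ t) (w2^~ t) <= M}.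

Definition L1_H2 (L T0 T1 : R) (w : R -> R -> R) : Prop :=
  exists w1 w2, H2_valued L T0 T1 w w1 w2 /\
    mu.-integrable `]T0, T1[
      (fun t => (H2norm L (w^~ t) (w1^~ t) (w2^~ t))%:E).

(* The weak time derivative of [u] is in L^1(T0, T1; H^2(0, L)). *)
Definition dt_L1_H2 (L T0 T1 : R) (u : R -> R -> R) : Prop :=
  exists dtu, {ae mu, forall x, x \in `]0, L[ ->
                 weak_derivative T0 T1 (u x) (dtu x)} /\
              L1_H2 L T0 T1 dtu.

End SobolevSpaces.

Section DelayProblem.
Context {R : realType}.

Definition continuous_on_rectangle (I J : set R) (v : R -> R -> R) : Prop :=
  {within I `*` J, continuous (fun z : R * R => v z.1 z.2)}.

(* Classical solution of the delay subdiffusion problem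
     D_t^1 u = D_t^(1 - alpha) (p u_xx + a u) + b u(x, t - tau) + f
   in the Caputo form obtained by applying the fractional integral of order
   1 - alpha to both sides. *)
Definition delay_solution (alpha tau : R) (K : nat) (p a b L : R)
    (f phi u : R -> R -> R) : Prop :=
  [/\ continuous_on_rectangle `[0, L] `[- tau, K%:R * tau] u,
      forall x t, x \in `]0, L[ -> t \in `[- tau, 0] -> u x t = phi x t,
      forall t, t \in `[- tau, K%:R * tau] -> u 0 t = 0 /\ u L t = 0,
      forall x t, x \in `]0, L[ -> t \in `]0, K%:R * tau] ->
        derivable (u^~ t) x 1 /\ derivable (derive1 (u^~ t)) x 1 &
      forall x t, x \in `]0, L[ -> t \in `]0, K%:R * tau] ->
        caputo alpha (u x) t =
          p * derive1n 2 (u^~ t) x + a * u x t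
          + frac_int (1 - alpha) (fun s => b * u x (s - tau)) t
          + frac_int (1 - alpha) (f x) t].

(* Only the open delay intervals are constrained: at t = k tau the derivative
   of the restriction u_(k tau) is one-sided. *)
Definition time_regular (alpha tau : R) (K : nat) (L C : R)
    (u : R -> R -> R) : Prop :=
  forall x (k : nat) t, x \in `]0, L[ -> (1 <= k <= K)%N ->
    t \in `](k%:R - 1) * tau, k%:R * tau[ ->
    [/\ derivable (u x) t 1, derivable (derive1 (u x)) t 1,
        `|derive1 (u x) t| <= C * (1 + t `^ (alpha - 1)),
        k = 1%N -> `|derive1n 2 (u x) t| <= C * (1 + t `^ (alpha - 2)) &
        (2 <= k)%N -> `|derive1n 2 (u x) t| <= C * (1 + (t - tau) `^ (alpha - 1))].

End DelayProblem.

Section Discretization.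
Context {R : realType}.

Definition mesh (L : R) (M : nat) (xs : nat -> R) : Prop :=
  [/\ (0 < M)%N, xs 0%N = 0, xs M = L &
      forall i, (i < M)%N -> xs i < xs i.+1].

Definition mesh_size (M : nat) (xs : nat -> R) : R :=
  \big[Num.max/0]_(i < M) (xs i.+1 - xs i).

Definition quasi_uniform (kappa : R) (M : nat) (xs : nat -> R) : Prop :=
  forall i, (i < M)%N -> mesh_size M xs <= kappa * (xs i.+1 - xs i).

(* Continuity at the nodes is built in, the cells being closed. *)
Definition fem_space (L : R) (M : nat) (xs : nat -> R) (v : R -> R) : Prop :=
  [/\ v 0 = 0, v L = 0 &
      forall i, (i < M)%N -> exists c d,
        forall x, x \in `[xs i, xs i.+1] -> v x = c * x + d].

(* The classical derivatives exist off the nodes for functions of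
   [fem_space]. *)
Definition bilin (L p a : R) (v w : R -> R) : R :=
  p * ip L (derive1 v) (derive1 w) - ip L (fun x => a * v x) w.

Definition step (tau : R) (N : nat) : R := tau / (2 * N)%:R.

Definition tm (tau : R) (N : nat) (n : int) : R := n%:~R * step tau N.

(* The coefficient a_(n - k). *)
Definition L1coef (alpha tau : R) (N n k : nat) : R :=
  (omega (2 - alpha) (tm tau N n%:Z - tm tau N (k%:Z - 1))
   - omega (2 - alpha) (tm tau N n%:Z - tm tau N k%:Z)) / step tau N.

Definition L1_D (alpha tau : R) (N : nat) (v : int -> R -> R) (n : nat)
    (x : R) : R :=
  \sum_(1 <= k < n.+1) L1coef alpha tau N n k * (v k%:Z x - v (k%:Z - 1) x).

(* J^(1 - alpha) v^(n - 2N) *)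
Definition L1_J (alpha tau : R) (N : nat) (v : int -> R -> R) (n : nat)
    (x : R) : R :=
  \sum_(1 <= k < n.+1)
     step tau N * L1coef alpha tau N n k * v (k%:Z - (2 * N)%:Z) x.

Definition fem_solution (alpha tau : R) (K : nat) (p a b L : R)
    (f : R -> R -> R) (N M : nat) (xs : nat -> R) (uh : int -> R -> R) : Prop :=
  (forall n : int, - (2 * N)%:Z <= n <= (2 * K * N)%:Z ->
     fem_space L M xs (uh n)) /\
  forall n : nat, (1 <= n <= 2 * K * N)%N ->
  forall vh, fem_space L M xs vh ->
    ip L (L1_D alpha tau N uh n) vh + bilin L p a (uh n%:Z) vh =
    ip L (fun x => b * L1_J alpha tau N uh n x) vh
    + ip L (fun x => frac_int (1 - alpha) (f x) (tm tau N n%:Z)) vh.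

End Discretization.

(* Main.v *)
(**
The error [u - uh] is split into [u - Iu] and [Iu - uh], where [Iu] is the nodal
interpolant in space.  In one space dimension [Iu] is also the Ritz projection,
so the stiffness form does not see [u - Iu]; its time increments are of order
[h^2] times the integral of the H^2 norm of the time derivative over the step.

Testing the error equation with the nodal error, the monotonicity of the L1
weights turns it into a scalar inequality for norms.  The L1 weights are
log-convex, so by Kaluza's argument they have a nonnegative complementary
kernel [q], with [q_m] of order [(m + 1)^(alpha - 1)], which inverts the
discrete fractional derivative.  At time level [n] the truncation error of the
L1 formula is of order [n^(-1 - sigma) + rho] with
[sigma = min alpha (1 - alpha)]; its convolution with [q] is of order
[n^(alpha - 1) + rho], which after scaling by [rho^alpha] gives
[rho * t_n^(alpha - 1) + rho].  The delay term only involves earlier values of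
the error, so the recursion closes by a Gronwall argument, in which the weak
singularity is harmless as [rho * t_k^(alpha - 1)] is summable in time with a
factor [rho].
*)

Require Import Defs.
From mathcomp Require Import all_boot all_order all_algebra.
From mathcomp Require Import all_classical all_reals all_analysis.
From mathcomp Require Import measurable_realfun ring lra zify.

Set Implicit Arguments.
Unset Strict Implicit.
Unset Printing Implicit Defensive.

Import Order.TTheory GRing.Theory Num.Theory.
Import numFieldNormedType.Exports.

Local Open Scope ring_scope.
Local Open Scope classical_set_scope.

(** * Real powers and discrete kernels *)

(** Two decays fix the exponent [sigma]. The error of the difference quotient has mean zero on each
    cell, so away from the evaluation time only the oscillation of the kernel counts, and it decays
    like the power -1-alpha of the distance in cells; the oscillation of the time derivative decays
    like the power -1-(1-alpha) of the distance to time 0. Both powers are summable, so their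
    convolution keeps the slower one.

    Terms that carry an L1 coefficient, such as the increments of [u - Iu] and the delay term with
    its quadrature error, are collapsed exactly by the complementary kernel into plain sums, and
    sums of increments are bounded by one integral over the whole time span, whatever the mesh.

    The obstacle is the regularity in space, given in weak form: the H^2 bound holds at almost every
    time only, while the scheme uses fixed times, and the second derivative in the equation is
    classical. Time increments are therefore written as integrals of an H^2-valued map, which
    carries the bound from one good time to all of them, and the two second derivatives are
    identified at Lebesgue points. *)

Section PowR.
Context {R : realType}.
Implicit Types a b s x y r : R.

Lemma powR_continuous_pos s x : 0 < x -> {for x, continuous (fun y => y `^ s)}.
Proof.
move=> x0; apply: differentiable_continuous; apply/derivable1_diffP.
exact: (@ex_derive _ _ _ _ _ _ _ (is_derive1_powR s x0)).
Qed.

Lemma powR_MVT s a b : 0 < a -> a < b ->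
  exists2 c, a < c < b & b `^ s - a `^ s = s * c `^ (s - 1) * (b - a).
Proof.
move=> a0 ab.
have [||c cab ->] := @MVT R (fun y => y `^ s) (fun c => s * c `^ (s - 1)) a b ab.
- by move=> x; rewrite in_itv/= => /andP[ax _]; exact/is_derive1_powR/(lt_trans a0).
- apply: continuous_in_subspaceT => x; rewrite inE/= in_itv/= => /andP[ax _].
  exact/powR_continuous_pos/(lt_le_trans a0).
by exists c => //; move: cab; rewrite in_itv.
Qed.

Lemma ler_powRN s x y : s <= 0 -> 0 < x -> x <= y -> y `^ s <= x `^ s.
Proof.
move=> s0 x0 xy; have y0 := lt_le_trans x0 xy.
have h : x `^ (- s) <= y `^ (- s).
  by apply: (ge0_ler_powR _ _ _ xy); rewrite ?oppr_ge0// ?nnegrE ltW.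
by rewrite -[s in y `^ s]opprK -[s in x `^ s]opprK !(powRN _ (- s)) lef_pV2// posrE powR_gt0.
Qed.

Lemma ler_powRP s x y : 0 <= s -> 0 <= x -> x <= y -> x `^ s <= y `^ s.
Proof.
by move=> s0 x0 xy; apply: (ge0_ler_powR s0); rewrite ?nnegrE ?(le_trans x0).
Qed.

Lemma powR_nat_diff_le s n : 0 < s <= 1 -> (0 < n)%N ->
  n%:R `^ (s - 1) <= (n%:R `^ s - n.-1%:R `^ s) / s :> R.
Proof.
case: n => // n /andP[s0 s1] _ /=; rewrite ler_pdivlMr// mulrC.
case: n => [|n]; first by rewrite !powR1 mulr1 powR0 ?gt_eqF// subr0.
have [||c /andP[c1 c2] ->] := @powR_MVT s n.+1%:R n.+2%:R.
- by rewrite ltr0n.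
- by rewrite ltr_nat.
rewrite -[X in _ <= X](_ : s * c `^ (s - 1) = _); last first.
  by rewrite -natrB// subSnn mulr1.
rewrite ler_pM2l//; apply: ler_powRN; [lra| |exact: ltW].
by rewrite (lt_trans _ c1)// ltr0n.
Qed.

Lemma powR_nat_sum_le s n : 0 < s <= 1 ->
  \sum_(1 <= k < n.+1) k%:R `^ (s - 1) <= n%:R `^ s / s :> R.
Proof.
move=> s01; elim: n => [|n IH].
  by rewrite big_geq// divr_ge0 ?powR_ge0//; case/andP: s01 => /ltW.
rewrite big_nat_recr//=; have := @powR_nat_diff_le s n.+1 s01 erefl.
by move: IH; rewrite /=; lra.
Qed.

Lemma powR_nat_diffN_ge s n : 0 < s -> (0 < n)%N ->
  s * n.+1%:R `^ (- s - 1) <= n%:R `^ (- s) - n.+1%:R `^ (- s) :> R.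
Proof.
move=> s0 n0.
have [||c /andP[c1 c2] /eqP] := @powR_MVT (- s) n%:R n.+1%:R.
- by rewrite ltr0n.
- by rewrite ltr_nat.
rewrite -natrB// subSnn mulr1 -eqr_opp opprB => /eqP ->.
rewrite mulNr opprK ler_pM2l//; apply: ler_powRN; [lra| |exact: ltW].
by rewrite (lt_trans _ c1)// ltr0n.
Qed.

Lemma powR_nat_diffN_le s n : 0 < s -> (0 < n)%N ->
  n%:R `^ (- s) - n.+1%:R `^ (- s) <= s * n%:R `^ (- s - 1) :> R.
Proof.
move=> s0 n0.
have [||c /andP[c1 c2] /eqP] := @powR_MVT (- s) n%:R n.+1%:R.
- by rewrite ltr0n.
- by rewrite ltr_nat.
rewrite -natrB// subSnn mulr1 -eqr_opp opprB => /eqP ->.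
rewrite mulNr opprK ler_pM2l//; apply: ler_powRN; [lra| |exact: ltW].
by rewrite ltr0n.
Qed.

Lemma powR_nat_sumN_le s n : 0 < s ->
  \sum_(1 <= k < n.+1) k%:R `^ (- s - 1) <= 1 + s^-1 :> R.
Proof.
(* The sum is compared with the integral of [x^(-s-1)], so the induction has to carry the tail
   [n^(-s)/s]. The case [n = 0] is set apart because the mean value comparison starts at 1. *)
move=> s0; suff H : \sum_(1 <= k < n.+1) k%:R `^ (- s - 1) <= 1 + s^-1 - n%:R `^ (- s) / s :> R
    \/ n = 0%N.
  have v0 : 0 <= s^-1 by rewrite invr_ge0 ltW.
  case: H => [|->]; last by rewrite big_geq//; lra.
  have : 0 <= n%:R `^ (- s) / s by rewrite mulr_ge0 ?powR_ge0.
  lra.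
elim: n => [|n [IH|->]]; [by right| |left]; last first.
  by rewrite big_nat1 !powR1; lra.
case: n IH => [|n] IH; first by left; rewrite big_nat1 !powR1; lra.
left; rewrite big_nat_recr//=.
have := @powR_nat_diffN_ge s n.+1 s0 erefl.
rewrite -ler_pdivlMl// mulrC mulrBl; lra.
Qed.

(** One of [k] and [n - k] is at least [n / 2], and this factor yields [2^q n^(-q)]; what remains is
    summable because [p > 1]. The factor 2 counts two sums, each bounded by [1 + 1/(p - 1)]. *)
Lemma powR_conv_le (p q : R) n : 1 < p -> 0 <= q <= p ->
  \sum_(1 <= k < n) ((n - k)%:R `^ (- p) * k%:R `^ (- q)) <=
    2 * 2 `^ q * (1 + (p - 1)^-1) * n%:R `^ (- q) :> R.
Proof.
move=> p1 /andP[q0 qp].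
have term k : (1 <= k < n)%N -> (n - k)%:R `^ (- p) * k%:R `^ (- q) <=
    2 `^ q * n%:R `^ (- q) * ((n - k)%:R `^ (- p) + k%:R `^ (- p)) :> R.
  move=> /andP[k1 kn].
  have half m : (0 < m)%N -> (n <= 2 * m)%N ->
      m%:R `^ (- q) <= 2 `^ q * n%:R `^ (- q) :> R.
    move=> m0 nm; rewrite !powRN ler_pdivlMr ?powR_gt0 ?ltr0n//; last lia.
    rewrite mulrC ler_pdivrMr ?powR_gt0 ?ltr0n// -powRM// -natrM.
    by apply: ler_powRP => //; rewrite ler_nat.
  have Q0 m : 0 <= m%:R `^ (- q) :> R by exact: powR_ge0.
  have P0 m : 0 <= m%:R `^ (- p) :> R by exact: powR_ge0.
  have D0 : 0 <= 2 `^ q * n%:R `^ (- q) :> R by rewrite mulr_ge0 ?powR_ge0.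
  have [h|h] := leqP n (2 * k).
    rewrite mulrDr mulrC.
    rewrite (le_trans (ler_wpM2r (P0 _) (half _ k1 h)))// lerDl mulr_ge0//.
  (* Here [n - k] is the large index. Its power [-p] is split into [-q], which gives the decay in
     [n], and [q - p <= 0], which may be moved to the smaller index [k]. *)
  have h2 : (n <= 2 * (n - k))%N by lia.
  rewrite mulrDr addrC.
  have -> : - p = - q + (q - p) by lra.
  have nk0 : (0 < n - k)%N by lia.
  rewrite powRD; last by rewrite pnatr_eq0 -lt0n nk0 implybT.
  rewrite [X in _ <= _ * X + _]powRD; last by rewrite pnatr_eq0 -lt0n k1 implybT.
  have e1 : (n - k)%:R `^ (q - p) <= k%:R `^ (q - p) :> R.
    by apply: ler_powRN; [lra|rewrite ltr0n|rewrite ler_nat; lia].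
  have e2 := half _ nk0 h2.
  rewrite (@le_trans _ _ (2 `^ q * n%:R `^ (- q) * (k%:R `^ (- q) * k%:R `^ (q - p))))//.
    rewrite -mulrA ler_pM ?mulr_ge0 ?powR_ge0//.
    by rewrite mulrC ler_wpM2l.
  by rewrite lerDl mulr_ge0 ?powR_ge0.
rewrite (@le_trans _ _ (\sum_(1 <= k < n)
   2 `^ q * n%:R `^ (- q) * ((n - k)%:R `^ (- p) + k%:R `^ (- p))))//.
  rewrite big_nat_cond [leRHS]big_nat_cond; apply: ler_sum => k.
  by rewrite andbT; exact: term.
rewrite -mulr_sumr big_split/=.
have S : \sum_(1 <= k < n) k%:R `^ (- p) <= 1 + (p - 1)^-1 :> R.
  have := @powR_nat_sumN_le (p - 1) n.-1; rewrite subr_gt0 => /(_ p1).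
  case: n term => [|n] _ /=; first by move=> ?; rewrite big_geq// addr_ge0// invr_ge0; lra.
  by have -> : - (p - 1) - 1 = - p by lra.
have -> : \sum_(1 <= k < n) (n - k)%:R `^ (- p) = \sum_(1 <= k < n) k%:R `^ (- p) :> R.
  rewrite big_nat_rev/=; apply: eq_big_nat => k /andP[k1 kn].
  by congr (_%:R `^ _); lia.
have -> : 2 * 2 `^ q * (1 + (p - 1)^-1) * n%:R `^ (- q) =
   2 `^ q * n%:R `^ (- q) * ((1 + (p - 1)^-1) + (1 + (p - 1)^-1)) :> R by ring.
by apply: ler_wpM2l; [rewrite mulr_ge0 ?powR_ge0|exact: lerD].
Qed.

End PowR.

(** * Complementary kernels and the discrete Gronwall inequality *)

Section StrongRecursion.
Context {T : Type} (x0 : T) (F : nat -> (nat -> T) -> T).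
Hypothesis F_ext : forall n q q', (forall k, (k < n)%N -> q k = q' k) -> F n q = F n q'.

(** Iterating the update [n] times fixes the values at indices below [n], whatever the starting
    function; the diagonal of the iterates solves the recursion. *)
Lemma strong_recursion : exists q : nat -> T, forall n, q n = F n q.
Proof.
pose Q n := iter n (fun q k => F k q) (fun=> x0).
have QS n k : Q n.+1 k = F k (Q n) by [].
have stable k : forall m n, (k < m)%N -> (k < n)%N -> Q m k = Q n k.
  elim/ltn_ind: k => k IH [//|m] [//|n]; rewrite !ltnS !QS => km kn.
  by apply: F_ext => j jk; apply: IH => //; exact: leq_trans jk _.
exists (fun k => Q k.+1 k) => n; rewrite QS; apply: F_ext => k kn.
exact: stable.
Qed.

End StrongRecursion.

Section ComplementaryKernel.
Context {R : realFieldType} (A : nat -> R).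
Hypothesis A0 : A 0 = 1.
Hypothesis A_gt0 : forall n, 0 < A n.
Hypothesis A_noninc : forall n, A n.+1 <= A n.
Hypothesis A_logconvex : forall n, A n.+1 ^+ 2 <= A n * A n.+2.

(** Log-convexity says that the ratios [A n.+1 / A n] do not decrease; this is the cross-multiplied
    form. *)
Let A_ratio m n : (m <= n)%N -> A m.+1 * A n <= A n.+1 * A m.
Proof.
elim: n => [|n IH]; first by rewrite leqn0 => /eqP ->.
rewrite leq_eqVlt => /predU1P[<-//|]; rewrite ltnS => /IH h.
rewrite -(ler_pM2r (A_gt0 n)).
have h1 := A_logconvex n.
have e1 := ler_wpM2r (ltW (A_gt0 n.+1)) h.
have e2 := ler_wpM2r (ltW (A_gt0 m)) h1.
by lra.
Qed.

(** Kaluza's argument: subtracting two consecutive convolution equations writes [q m.+1] with the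
    nonnegative coefficients [A j - A j.+1]. The same device applied to the differences of [q] uses
    log-convexity instead of monotonicity. *)
Lemma complementary_kernel : exists q : nat -> R,
  [/\ forall m, \sum_(0 <= j < m.+1) q j * A (m - j)%N = 1,
      forall m, 0 <= q m & forall m, q m.+1 <= q m].
Proof.
have [|q qE] := @strong_recursion R 0
    (fun n q => 1 - \sum_(0 <= j < n) q j * A (n - j)%N).
  by move=> n q q' qq'; congr (_ - _); apply: eq_big_nat => j /andP[_ /qq' ->].
exists q.
have sum1 m : \sum_(0 <= j < m.+1) q j * A (m - j)%N = 1.
  by rewrite big_nat_recr//= subnn A0 mulr1 [X in _ + X]qE subrKC.
have q0 : q 0%N = 1 by rewrite qE big_geq// subr0.
have q_ge0 m : 0 <= q m.
  elim/ltn_ind: m => -[|m] IH; first by rewrite q0.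
  have := sum1 m.+1; rewrite -(sum1 m) big_nat_recr//= subnn A0 mulr1.
  move/(canRL (addKr _)) ->; rewrite addrC -sumrB big_nat_cond.
  apply: sumr_ge0 => j; rewrite andbT => /andP[_ jm].
  by rewrite -mulrBr mulr_ge0 ?IH// subr_ge0 subSn.
split=> //.
(* The differences solve the same triangular system, with right-hand side [A m.+1] in place of 1. *)
pose d j := q j - q j.+1.
have dE m : \sum_(0 <= j < m.+1) d j * A (m - j)%N = A m.+1.
  rewrite (eq_bigr (fun j => q j * A (m - j)%N - q j.+1 * A (m - j)%N)); last first.
    by move=> j _; rewrite mulrBl.
  rewrite sumrB sum1 -(sum1 m.+1) [X in X - _]big_nat_recl//= q0 mul1r subn0.
  by rewrite addrK.
suff dge0 m : 0 <= d m by move=> m; rewrite -subr_ge0; exact: dge0.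
elim/ltn_ind: m => -[|m] IH.
  by have := dE 0%N; rewrite big_nat1 subnn A0 mulr1 => ->; rewrite ltW.
have -> : d m.+1 = A m.+2 - \sum_(0 <= j < m.+1) d j * A (m.+1 - j)%N.
  by rewrite -(dE m.+1) [in RHS]big_nat_recr//= subnn A0 mulr1 [X in X - _]addrC addrK.
(* Equation [m] rescaled by [A m.+2 / A m.+1] has the right-hand side of equation [m.+1]; after
   subtraction the coefficient of each [d j] is nonnegative by [A_ratio]. *)
have -> : A m.+2 = \sum_(0 <= j < m.+1) d j * (A (m - j)%N * A m.+2 / A m.+1).
  under eq_bigr do rewrite !mulrA -mulrA.
  by rewrite -mulr_suml dE mulrCA mulfV ?mulr1// gt_eqF.
rewrite -sumrB big_nat_cond; apply: sumr_ge0 => j; rewrite andbT => /andP[_ jm].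
rewrite -mulrBr mulr_ge0 ?IH// subr_ge0 ler_pdivlMr// subSn// mulrC [leRHS]mulrC.
by rewrite [leLHS]mulrC; apply: A_ratio; rewrite leqW// leq_subr.
Qed.

End ComplementaryKernel.

Section DiscreteComparison.
Context {R : realFieldType} (A q : nat -> R).
Hypothesis qA1 : forall m, \sum_(0 <= j < m.+1) q j * A (m - j)%N = 1.

(** Exchanging the sums turns the convolution of [q] and [A] into the constant 1. Thus [q] undoes
    the discrete fractional derivative: the weighted sum of the increments of a sequence becomes its
    total increment. *)
Lemma complementary_sum (z : nat -> R) n :
  \sum_(1 <= j < n.+1) q (n - j)%N * (\sum_(1 <= k < j.+1) A (j - k)%N * z k) =
  \sum_(1 <= k < n.+1) z k.
Proof.
under eq_bigr do rewrite mulr_sumr.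
under eq_big_nat => j /andP[_ jn].
  rewrite (@big_nat_widen _ _ _ _ j.+1 n.+1)//=; over.
rewrite (exchange_big_dep_nat xpredT)//=.
apply: eq_big_nat => k /andP[k1 kn].
under eq_bigr do rewrite mulrA.
rewrite -mulr_suml -[RHS]mul1r; congr (_ * _).
rewrite (@big_cat_nat _ _ _ k)//=; last by rewrite ltnW.
rewrite big_nat_cond big1 ?add0r; last by move=> i; lia.
rewrite -(qA1 (n - k)) -{1}[k]add0n big_addn -subSn// [in RHS]big_nat_rev/=.
rewrite big_nat_cond [RHS]big_nat_cond; apply: eq_big => i; first by lia.
by move=> ik; congr (q _ * A _); lia.
Qed.

Hypothesis q_ge0 : forall m, 0 <= q m.

(** Convolution with the nonnegative [q] preserves inequalities and makes the left-hand side
    telescope. *)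
Lemma discrete_comparison (y r : nat -> R) n :
  (forall j, (1 <= j <= n)%N ->
    \sum_(1 <= k < j.+1) A (j - k)%N * (y k - y k.-1) <= r j) ->
  y n <= y 0%N + \sum_(1 <= j < n.+1) q (n - j)%N * r j.
Proof.
move=> yr; rewrite addrC -lerBlDr.
rewrite (_ : _ - _ = \sum_(1 <= k < n.+1) (y k - y k.-1)); last first.
  by rewrite big_add1/= telescope_sumr.
rewrite -complementary_sum big_nat_cond [leRHS]big_nat_cond.
by apply: ler_sum => j /[!andbT] j1n; rewrite ler_wpM2l// yr.
Qed.

End DiscreteComparison.

(** The partial sums are bounded rather than the terms, since [g] will contain a part that is
    singular at early times but summable. A pointwise bound follows by inserting the result back
    into the recursion. *)
Lemma discrete_gronwall {R : realType} (e g : nat -> R) (c : R) n :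
  0 <= c -> (forall m, 0 <= g m) ->
  (forall m, (1 <= m <= n)%N -> e m <= g m + c * \sum_(1 <= k < m) e k) ->
  \sum_(1 <= k < n.+1) e k <= expR (c * n%:R) * \sum_(1 <= k < n.+1) g k.
Proof.
move=> c0 g0 eg.
have : \sum_(1 <= k < n.+1) e k <= (1 + c) ^+ n * \sum_(1 <= k < n.+1) g k.
  elim: n eg => [|n IH] eg; first by rewrite !big_geq// mulr0.
  have c1 : 1 <= 1 + c by rewrite lerDl.
  have /IH{}IH : forall m, (1 <= m <= n)%N -> e m <= g m + c * \sum_(1 <= k < m) e k.
    by move=> m /andP[m1 mn]; apply: eg; rewrite m1 leqW.
  rewrite big_nat_recr//= [in leRHS]big_nat_recr//= mulrDr.
  have := eg n.+1; rewrite ltn0Sn leqnn => /(_ isT) en.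
  have c1n : 1 <= (1 + c) ^+ n.+1 by rewrite exprn_ege1.
  have := ler_wpM2l (le_trans ler01 c1) IH; rewrite mulrA -exprS.
  by have := ler_wpM2r (g0 n.+1) c1n; lra.
move/le_trans; apply; apply: ler_wpM2r; first exact: sumr_ge0.
case: n {eg} => [|n]; first by rewrite mulr0 expR0 expr0.
rewrite mulrC expRM_natl ler_pXn2r ?nnegrE ?expR_ge0// ?addr_ge0//.
exact: expR_ge1Dx.
Qed.

(** * The weights of the L1 formula *)

Section L1Kernel.
Context {R : realType} (alpha : R).
Hypothesis alpha01 : 0 < alpha < 1.

(** The coefficient [L1coef] without its factor [step^(-alpha) / Gamma (2 - alpha)], see
    [L1coefE]. *)
Definition L1weight (n : nat) : R := n.+1%:R `^ (1 - alpha) - n%:R `^ (1 - alpha).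

Let a_gt0 : 0 < alpha. Proof. by case/andP: alpha01. Qed.

Let b_gt0 : 0 < 1 - alpha. Proof. by case/andP: alpha01; lra. Qed.

Lemma L1weight0 : L1weight 0 = 1.
Proof. by rewrite /L1weight powR1 powR0 ?subr0// gt_eqF. Qed.

Lemma L1weight_gt0 n : 0 < L1weight n.
Proof.
by rewrite subr_gt0; apply: gt0_ltr_powR; rewrite ?nnegrE ?ltr_nat.
Qed.

(** At [x = n] and [y = n + 1] the left-hand side is [L1weight n.+1 - c * L1weight n], so comparing
    two weights reduces to the sign of one derivative. *)
Let shifted_power c (x y : R) : 0 < x -> x < y ->
  exists2 z, x < z < y &
  ((y + 1) `^ (1 - alpha) - c * y `^ (1 - alpha)) -
  ((x + 1) `^ (1 - alpha) - c * x `^ (1 - alpha)) =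
  (1 - alpha) * ((z + 1) `^ (- alpha) - c * z `^ (- alpha)) * (y - x).
Proof.
move=> x0 xy.
pose g (z : R) := (z + 1) `^ (1 - alpha) - c * z `^ (1 - alpha).
pose dg (z : R) := (1 - alpha) * ((z + 1) `^ (- alpha) - c * z `^ (- alpha)).
have gd (z : R) : 0 < z -> is_derive z 1 g (dg z).
  move=> z0.
  have z10 : 0 < z + 1 by lra.
  have h1 := is_derive1_powR (1 - alpha) z10.
  have h2 := is_derive1_powR (1 - alpha) z0.
  have h3 : is_derive z 1 (fun z : R => z + 1) 1 by apply: (is_derive_eq (is_deriveD (is_derive_id z 1) (is_derive_cst (1 : R) z 1))); rewrite addr0.
  have h4 := @is_derive1_comp R (fun y => y `^ (1 - alpha)) (fun y => y + 1) z _ _ h1 h3.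
  have := is_deriveB h4 (is_deriveZ c h2).
  rewrite /g => h; apply: (is_derive_eq h).
  rewrite /dg mulr1 -[_ *: _]/(_ * _) (_ : 1 - alpha - 1 = - alpha); last by lra.
  by ring.
have [||z zxy e] := @MVT R g dg x y xy.
- by move=> z; rewrite in_itv/= => /andP[xz _]; apply/gd/(lt_trans x0).
- apply: continuous_in_subspaceT => z; rewrite inE/= in_itv/= => /andP[xz _].
  apply: differentiable_continuous; apply/derivable1_diffP.
  exact: (@ex_derive _ _ _ _ _ _ _ (gd _ (lt_le_trans x0 xz))).
by exists z; [move: zxy; rewrite in_itv|].
Qed.

Let powRV (x : R) : 0 < x -> x `^ (- alpha) = x^-1 `^ alpha.
Proof.
move=> x0; have xa : x `^ alpha != 0 by rewrite gt_eqF// powR_gt0.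
apply: (mulfI xa); rewrite powRN divff// -powRM ?invr_ge0 ?ltW//.
by rewrite divff ?gt_eqF// powR1.
Qed.

(** As [z / (z + 1)] increases with [z], the sign of the derivative in [shifted_power] depends only
    on the side of [w] on which the mean value point lies. *)
Let ratio_le (w z : R) : 0 < w -> 0 < z -> z <= w ->
  (z + 1) `^ (- alpha) <= (w / (w + 1)) `^ alpha * z `^ (- alpha).
Proof.
move=> w0 z0 zw; have z10 : 0 < z + 1 by lra. have w10 : 0 < w + 1 by lra.
rewrite !powRV// -powRM ?divr_ge0 ?invr_ge0 ?(ltW w0) ?(ltW w10) ?(ltW z0)//.
apply: ler_powRP; rewrite ?invr_ge0 ?(ltW a_gt0) ?(ltW z10)//.
rewrite -div1r ler_pdivrMr// mulrAC ler_pdivlMr// mul1r mulrAC ler_pdivlMr//; lra.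
Qed.

Let ratio_ge (w z : R) : 0 < w -> w <= z ->
  (w / (w + 1)) `^ alpha * z `^ (- alpha) <= (z + 1) `^ (- alpha).
Proof.
move=> w0 wz; have z0 := lt_le_trans w0 wz.
have z10 : 0 < z + 1 by lra. have w10 : 0 < w + 1 by lra.
rewrite !powRV// -powRM ?divr_ge0 ?invr_ge0 ?(ltW w0) ?(ltW w10) ?(ltW z0)//.
apply: ler_powRP; rewrite ?mulr_ge0 ?invr_ge0 ?(ltW a_gt0) ?(ltW w0) ?(ltW w10) ?(ltW z0)//.
rewrite -[leRHS]div1r ler_pdivlMr// mulrAC ler_pdivrMr// mul1r mulrAC ler_pdivrMr//; lra.
Qed.

(** The value [(n / (n + 1))^alpha] separates two consecutive ratios of weights: it is the ratio of
    [z^(-alpha)] at [n + 1] and at [n], and the two mean value points lie on either side of [n].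
    Chaining the two inequalities gives log-convexity. *)
Lemma L1weight_ratio (n : nat) : (0 < n)%N ->
  L1weight n <= (n%:R / n.+1%:R) `^ alpha * L1weight n.-1 /\
  (n%:R / n.+1%:R) `^ alpha * L1weight n <= L1weight n.+1.
Proof.
move=> n0; set c := _ `^ alpha; have n0R : 0 < n%:R :> R by rewrite ltr0n.
have cE : c = (n%:R / (n%:R + 1)) `^ alpha by rewrite /c -natr1.
split; last first.
  have [|z /andP[z1 z2]] := @shifted_power c n%:R n.+1%:R n0R; first by rewrite ltr_nat.
  have := @ratio_ge n%:R z n0R (ltW z1); rewrite -cE => h.
  have : 0 <= (1 - alpha) * ((z + 1) `^ (- alpha) - c * z `^ (- alpha)) * (n.+1%:R - n%:R).
    by rewrite !mulr_ge0 ?(ltW b_gt0) ?subr_ge0 ?ler_nat.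
  by move=> + eq; rewrite -eq /L1weight !natr1; lra.
case: n n0 @c n0R cE => // -[|n] _ c n0R cE /=.
  (* For [n = 1] the interval would start at 0, which [shifted_power] excludes; the inequality then
     amounts to [2^(1 - alpha) <= 2]. *)
  have -> : c = 2 `^ (1 - alpha) / 2.
    have h2 : 2 != 0 :> R by rewrite pnatr_eq0.
    apply: (mulIf h2); rewrite mulfVK// /c mul1r -powRV// -{2}[2]powRr1//.
    by rewrite -powRD ?h2 ?implybT//; congr (_ `^ _); rewrite addrC.
  rewrite /L1weight powR1 powR0 ?subr0 ?gt_eqF// mulr1.
  have : 2 `^ (1 - alpha) <= 2 :> R.
    rewrite -[leRHS]powRr1//; apply: ler_powR; first by rewrite ler1n.
    by move: a_gt0; lra.
  lra.
have n1R : 0 < n.+1%:R :> R by rewrite ltr0n.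
have [|z /andP[z1 z2]] := @shifted_power c n.+1%:R n.+2%:R n1R; first by rewrite ltr_nat.
have := @ratio_le n.+2%:R z n0R (lt_trans n1R z1) (ltW z2); rewrite -cE => h.
have : 0 <= (1 - alpha) * (c * z `^ (- alpha) - (z + 1) `^ (- alpha)) * (n.+2%:R - n.+1%:R).
  by rewrite !mulr_ge0 ?(ltW b_gt0) ?subr_ge0 ?ler_nat.
by move=> + eq; move: eq; rewrite /L1weight !natr1; lra.
Qed.

Lemma L1weight_noninc n : L1weight n.+1 <= L1weight n.
Proof.
have [+ _] := @L1weight_ratio n.+1 erefl; move=> /le_trans; apply.
rewrite /= ler_piMl ?(ltW (L1weight_gt0 _))// [leRHS](_ : 1 = 1 `^ alpha); last by rewrite powR1.
apply: ler_powRP; rewrite ?divr_ge0 ?(ltW a_gt0)//.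
by rewrite ler_pdivrMr ?ltr0n// mul1r ler_nat.
Qed.

Lemma L1weight_logconvex n : L1weight n.+1 ^+ 2 <= L1weight n * L1weight n.+2.
Proof.
have [h1 h2] := @L1weight_ratio n.+1 erefl.
have := ler_wpM2l (ltW (L1weight_gt0 n)) h2.
have := ler_wpM2r (ltW (L1weight_gt0 n.+1)) h1.
rewrite /= expr2; lra.
Qed.

Lemma L1weight_sum n : \sum_(0 <= j < n) L1weight j = n%:R `^ (1 - alpha).
Proof. by rewrite telescope_sumr// powR0 ?subr0// gt_eqF. Qed.

(** Since [q] is nonincreasing, the convolution equation bounds [q m] times the sum of the first
    [m + 1] weights by 1, and these weights telescope to [(m + 1)^(1 - alpha)]. *)
Lemma L1_complementary_kernel : exists q : nat -> R,
  [/\ forall m, \sum_(0 <= j < m.+1) q j * L1weight (m - j)%N = 1,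
      forall m, 0 <= q m & forall m, q m <= m.+1%:R `^ (alpha - 1)].
Proof.
have [q [q1 q0 qn]] := complementary_kernel L1weight0 L1weight_gt0
  L1weight_noninc L1weight_logconvex.
exists q; split=> // m.
have qnm j : (j <= m)%N -> q m <= q j.
  by elim: m => [|m IH]; [rewrite leqn0 => /eqP->|
    rewrite leq_eqVlt => /predU1P[->//|]; rewrite ltnS => /IH; exact: le_trans].
have -> : alpha - 1 = - (1 - alpha) by lra.
rewrite powRN -div1r ler_pdivlMr ?powR_gt0 ?ltr0n//.
rewrite -[leRHS](q1 m) -(L1weight_sum m.+1) mulr_sumr big_nat_rev/= add0n.
rewrite big_nat_cond [leRHS]big_nat_cond; apply: ler_sum => j.
rewrite andbT => /andP[_ jm]; rewrite subSS ler_wpM2r ?(ltW (L1weight_gt0 _))//.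
exact: qnm.
Qed.

End L1Kernel.

(** * Integrals of weakly singular functions *)

Section OpenIntervalFTC.
Context {R : realType}.
Local Notation mu := (@lebesgue_measure R).
Implicit Types (f g F G : R -> R) (a b : R).

(** The integrands of interest are singular at an endpoint, so the fundamental theorem is applied on
    compact subintervals that exhaust []a, b[]. Nonnegativity of [f] lets the integrals pass to the
    limit, continuity of [F] the increments. *)
Lemma FTC_oo_ge0 f F a b : a < b ->
  {within `[a, b], continuous F} ->
  (forall x, a < x < b -> is_derive x 1 F (f x)) ->
  (forall x, a < x < b -> {for x, continuous f}) ->
  (forall x, a < x < b -> 0 <= f x) ->
  (\int[mu]_(x in `]a, b[) (f x)%:E = (F b - F a)%:E)%E.
Proof.
move=> ab cF dF cf f0.
(* The division by 3 keeps the two cut points in order for every [n], including [n = 0]. *)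
pose e n : R := (b - a) / 3 / n.+1%:R.
have e_gt0 n : 0 < e n by rewrite !divr_gt0 ?subr_gt0.
have e_cvg : e n @[n --> \oo] --> 0.
  rewrite -(mulr0 ((b - a) / 3)); apply: cvgM; first exact: cvg_cst.
  exact: cvg_harmonic.
have e_le n : e n <= (b - a) / 3.
  rewrite /e ler_pdivrMr ?ltr0n// ler_peMr ?ler1n//.
  by rewrite ltW// divr_gt0 ?subr_gt0.
have e_noninc m n : (m <= n)%N -> e n <= e m.
  move=> mn; rewrite /e ler_wpM2l//; first by rewrite ltW// divr_gt0 ?subr_gt0.
  by rewrite lef_pV2 ?posrE ?ltr0n// ler_nat ltnS.
clearbody e.
pose A n : set R := `[a + e n, b - e n]%classic.
have Aab n (x : R) : A n x -> a < x < b.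
  rewrite /A/= !in_itv/= => /andP[h1 h2].
  by have := e_gt0 n; move=> h; apply/andP; split; lra.
have cupA : \bigcup_n A n = `]a, b[%classic.
  apply/seteqP; split=> [x [n _ /Aab]//|x /=].
  rewrite in_itv/= => /andP[ax xb].
  have d0 : 0 < Num.min (x - a) (b - x) by rewrite lt_min !subr_gt0 ax.
  have [N _ /(_ N (leqnn N))] : \forall n \near \oo, e n < Num.min (x - a) (b - x).
    exact: (cvgr_lt _ e_cvg).
  rewrite lt_min => /andP[h1 h2]; exists N => //.
  by rewrite /A/= in_itv/=; apply/andP; split; lra.
have cvg1 : (\int[mu]_(x in A n) (f x)%:E)%E @[n --> \oo]
    --> (\int[mu]_(x in `]a, b[) (f x)%:E)%E.
  rewrite -cupA; apply: ge0_nondecreasing_set_cvg_integral.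
  - apply/nondecreasing_seqP => n; apply/subsetPset => x.
    rewrite /A/= !in_itv/= => /andP[h1 h2].
    by have := e_noninc _ _ (leqnSn n) => h; apply/andP; split; lra.
  - by move=> n; exact: measurable_itv.
  - move=> n; apply/measurable_EFinP.
    apply: (@measurable_funS _ _ _ _ `]a, b[%classic) => //.
      by move=> x /Aab.
    apply: open_continuous_measurable_fun => //.
    by move=> x; rewrite inE/= in_itv; exact: cf.
  - by move=> n x /Aab xab; rewrite lee_fin f0.
have Aoo n (x : R) : x \in `]a + e n, b - e n[%R -> a < x < b.
  by move=> xe; apply: (Aab n); exact: subset_itv_oo_cc xe.
have [cF' cFa cFb] := (continuous_within_itvP _ ab).1 cF.
have AE n : (\int[mu]_(x in A n) (f x)%:E = (F (b - e n) - F (a + e n))%:E)%E.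
  have lt_e : a + e n < b - e n by have := e_le n; move: ab; lra.
  rewrite EFinB; apply: continuous_FTC2 => //.
  - apply: continuous_in_subspaceT => x; rewrite inE => xA; apply: cf.
    exact: Aab xA.
  - split=> [x xe||].
    + by apply: ex_derive; exact: dF (Aoo n x xe).
    + by apply: cvg_at_right_filter; apply: cF'; rewrite in_itv/=; apply: (Aab n); rewrite /A/= in_itv/= lexx (ltW lt_e).
    + by apply: cvg_at_left_filter; apply: cF'; rewrite in_itv/=; apply: (Aab n); rewrite /A/= in_itv/= lexx (ltW lt_e).
  - move=> x xe; rewrite derive1E; apply: derive_val; apply: dF.
    exact: Aoo xe.
have cvg2 : (F (b - e n) - F (a + e n))%:E @[n --> \oo] --> (F b - F a)%:E.
  apply: cvg_EFin; first exact: nearW.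
  apply: cvgB.
    apply: ((cvg_at_leftP F b (F b)).1 cFb (fun n => b - e n)); split=> [n|]; first by rewrite ltrBlDr ltrDl.
    by rewrite -[X in _ --> X]subr0; apply: cvgB => //; exact: cvg_cst.
  apply: ((cvg_at_rightP F a (F a)).1 cFa (fun n => a + e n)); split=> [n|]; first by rewrite ltrDl.
  by rewrite -[X in _ --> X]addr0; apply: cvgD => //; exact: cvg_cst.
apply: (cvg_unique _ cvg1); first exact: ereal_hausdorff.
by rewrite /= (_ : (fun n => _) = (fun n => (F (b - e n) - F (a + e n))%:E)); last exact/funext.
Qed.

(** As [f] may change sign, the previous lemma is applied to the nonnegative functions [g] and
    [f + g], and the results are subtracted. *)
Lemma FTC_oo_dominated f g F G a b : a < b ->
  {within `[a, b], continuous F} -> {within `[a, b], continuous G} ->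
  (forall x, a < x < b -> is_derive x 1 F (f x)) ->
  (forall x, a < x < b -> is_derive x 1 G (g x)) ->
  (forall x, a < x < b -> {for x, continuous f}) -> (forall x, a < x < b -> {for x, continuous g}) ->
  (forall x, a < x < b -> `|f x| <= g x) ->
  mu.-integrable `]a, b[ (EFin \o f) /\ \int[mu]_(x in `]a, b[) f x = F b - F a.
Proof.
move=> ab cF cG dF dG cf cg fg.
have mf : measurable_fun `]a, b[ f.
  by apply: open_continuous_measurable_fun => // x; rewrite inE/= in_itv; exact: cf.
have mg : measurable_fun `]a, b[ g.
  by apply: open_continuous_measurable_fun => // x; rewrite inE/= in_itv; exact: cg.
have g0 x : a < x < b -> 0 <= g x by move/fg; exact/le_trans.
have Ig := FTC_oo_ge0 ab cG dG cg g0.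
have ig : mu.-integrable `]a, b[ (EFin \o g).
  apply/integrableP; split; first exact/measurable_EFinP.
  rewrite (_ : (\int[mu]_(x in `]a, b[) `|(EFin \o g) x|)%E =
    (G b - G a)%:E) ?ltry//.
  by rewrite -Ig; apply: eq_integral => x; rewrite inE/= in_itv/= => /g0 gx0; rewrite ger0_norm.
have if_ : mu.-integrable `]a, b[ (EFin \o f).
  apply: (le_integrable _ _ _ ig) => //; first exact/measurable_EFinP.
  by move=> x /=; rewrite in_itv/= => xab; rewrite lee_fin (ger0_norm (g0 _ xab)) fg.
split=> //.
have Ifg : (\int[mu]_(x in `]a, b[) (f x + g x)%:E = (F b + G b - (F a + G a))%:E)%E.
  apply: (@FTC_oo_ge0 _ (F \+ G)) => //.
  - by move=> x; apply: cvgD; [exact: cF|exact: cG].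
  - by move=> x xab; apply: is_deriveD; [exact: dF|exact: dG].
  - by move=> x xab; apply: cvgD; [exact: cf|exact: cg].
  - by move=> x /fg; rewrite ler_norml => /andP[]; lra.
have := @RintegralD _ _ _ mu _ f g (measurable_itv _) if_ ig.
rewrite {1}/Rintegral Ifg /= {2}/Rintegral Ig /=; lra.
Qed.

End OpenIntervalFTC.

(** * The Gamma integral on (0, 1] and its functional equation *)

Section GammaFunction.
Context {R : realType}.
Local Notation mu := (@lebesgue_measure R).

Local Notation Rpos := (`]0%R, +oo[%classic : set R).

Let integrand_cts (c x : R) : 0 < x -> {for x, continuous (fun t : R => t `^ c * expR (- t))}.
Proof.
move=> x0; apply: cvgM; first exact: powR_continuous_pos.
by apply: continuous_comp; [exact: continuousN|exact: continuous_expR].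
Qed.

Let integrand_measurable (c : R) (A : set (measurableTypeR R)) :
  measurable A -> A `<=` Rpos ->
  measurable_fun A (fun t => (t `^ c * expR (- t))%:E).
Proof.
move=> mA A0; apply/measurable_EFinP.
apply: (@measurable_funS _ _ _ _ Rpos) => //.
apply: open_continuous_measurable_fun => //.
by move=> x; rewrite inE/= in_itv/= andbT; exact: integrand_cts.
Qed.

(** The integral is split at 1: below, an integrable power dominates; above, [z <= 1] makes
    [t^(z - 1)] at most 1 and the exponential remains. *)
Lemma Gamma_integral_lty (z : R) : 0 < z <= 1 ->
  (\int[mu]_(t in `]0%R, +oo[) (t `^ (z - 1) * expR (- t))%:E < +oo)%E.
Proof.
move=> /andP[z0 z1].
have U : `]0, +oo[%classic = `]0, 1[%classic `|` `[1, +oo[%classic :> set R.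
  by apply: itv_bndbnd_setU; rewrite bnd_simp.
rewrite U ge0_integral_setU//=; last 3 first.
- by rewrite -U; exact: integrand_measurable.
- by move=> x _; rewrite lee_fin mulr_ge0 ?powR_ge0 ?expR_ge0.
- by apply/disj_setPS => x/= []; rewrite !in_itv/= andbT => /andP[_ x1]; rewrite leNgt x1.
rewrite lte_add_pinfty//.
- rewrite (@le_lt_trans _ _ (\int[mu]_(t in `]0%R, 1%R[) (t `^ (z - 1))%:E)%E)//.
    apply: ge0_le_integral => //.
    + by move=> x _; rewrite lee_fin mulr_ge0 ?powR_ge0 ?expR_ge0.
    + by apply: integrand_measurable => // x/=; rewrite !in_itv/= andbT => /andP[].
    + apply/measurable_EFinP; apply: open_continuous_measurable_fun => // x.
      by rewrite inE/= in_itv/= => /andP[x0 _]; exact: powR_continuous_pos.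
    + move=> x /=; rewrite in_itv/= => /andP[x0 _]; rewrite lee_fin.
      by rewrite ler_piMr ?powR_ge0// expR_le1 oppr_le0 ltW.
  suff -> : (\int[mu]_(t in `]0%R, 1%R[) (t `^ (z - 1))%:E = (1 `^ z / z - 0 `^ z / z)%:E)%E.
    by rewrite ltry.
  apply: (@FTC_oo_ge0 _ _ (fun t => t `^ z / z)) => //.
  + apply/(continuous_within_itvP _ ltr01); split.
    * move=> x; rewrite in_itv/= => /andP[x0 _]; apply: cvgM; last exact: cvg_cst.
      exact: powR_continuous_pos.
    * rewrite powR0 ?gt_eqF// mul0r -[X in _ --> X](mul0r z^-1).
      by apply: cvgM; [exact: powR_cvg0|exact: cvg_cst].
    * apply: cvg_at_left_filter; apply: cvgM; last exact: cvg_cst.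
      exact: powR_continuous_pos.
  + move=> x /andP[x0 _]; rewrite [X in is_derive _ _ X _](_ : _ = z^-1 \*: (fun t => t `^ z)).
      apply: is_derive_eq; first exact: (is_deriveZ _ (is_derive1_powR z x0)).
      by rewrite -[_ *: _]/(_ * _) mulrA mulVf ?mul1r// gt_eqF.
    by apply/funext => t /=; rewrite mulrC.
  + by move=> x /andP[x0 _]; exact: powR_continuous_pos.
  + by move=> x _; exact: powR_ge0.
- rewrite (@le_lt_trans _ _ (\int[mu]_(t in `[1%R, +oo[) (expR (- t))%:E)%E)//.
    apply: ge0_le_integral => //.
    + by move=> x _; rewrite lee_fin mulr_ge0 ?powR_ge0 ?expR_ge0.
    + apply: integrand_measurable => // x/=; rewrite !in_itv/= !andbT.
      exact: lt_le_trans.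
    + apply/measurable_EFinP; apply: measurable_funTS; apply: continuous_measurable_fun => x.
      by apply: continuous_comp; [exact: continuousN|exact: continuous_expR].
    + move=> x /=; rewrite in_itv/= andbT => x1; rewrite lee_fin.
      rewrite ler_piMl ?expR_ge0// -[leRHS](powRr0 x).
      by apply: ler_powR => //; rewrite subr_le0.
  rewrite (@ge0_continuous_FTC2y _ _ (fun t => - expR (- t)) _ 0)//.
  + by rewrite -EFinB ltry.
  + apply: continuous_subspaceT => x.
    by apply: continuous_comp; [exact: continuousN|exact: continuous_expR].
  + by rewrite -oppr0; apply: cvgN; exact: cvgr_expR.
  + apply: cvg_at_right_filter; apply: cvgN.
    by apply: continuous_comp; [exact: continuousN|exact: continuous_expR].
  + move=> x _; rewrite derive1E.
    have h := is_deriveN (is_derive1_comp (is_derive_expR (- x)) (is_deriveN (is_derive_id x 1))).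
    by rewrite (@derive_val _ _ _ _ _ _ _ h) mulrN1 opprK.
Qed.

Lemma Gamma_gt0 (z : R) : 0 < z <= 1 -> 0 < Gamma z.
Proof.
move=> z01; apply: fine_gt0; apply/andP; split; last exact: Gamma_integral_lty.
have e1 : 0 < expR (-1) :> R by exact: expR_gt0.
apply: (@lt_le_trans _ _ (\int[mu]_(t in `]0%R, 1%R[) (expR (-1))%:E)%E).
  by rewrite integral_cst//= lebesgue_measure_itv/= lte_fin ltr01 oppr0 adde0 mule1 lte_fin.
apply: (@le_trans _ _ (\int[mu]_(t in `]0%R, 1%R[) (t `^ (z - 1) * expR (- t))%:E)%E).
  apply: ge0_le_integral => //.
  - by apply: integrand_measurable => // x/=; rewrite !in_itv/= andbT => /andP[].
  - move=> t /=; rewrite in_itv/= => /andP[t0 t1]; rewrite lee_fin.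
    apply: (@le_trans _ _ (expR (- t))); first by rewrite ler_expR lerN2 ltW.
    rewrite ler_peMl ?expR_ge0// -[leLHS](powRr0 t).
    by apply: ger_powR; rewrite ?t0 ?(ltW t1)// subr_le0; case/andP: z01.
apply: ge0_subset_integral => //.
- by apply: integrand_measurable => // x/=; rewrite !in_itv/= andbT => /andP[].
- by move=> t _; rewrite lee_fin mulr_ge0 ?powR_ge0 ?expR_ge0.
- by move=> x/=; rewrite !in_itv/= andbT => /andP[].
Qed.

(** Integration by parts on a bounded interval, with the boundary term placed so that all terms are
    nonnegative and both integrals converge monotonically as [b] grows. *)
Let Gamma_by_parts (z b : R) : 0 < z -> 0 < b ->
(\int[mu]_(t in `]0%R, b[) (z * (t `^ (z - 1) * expR (- t)))%:E =
 \int[mu]_(t in `]0%R, b[) (t `^ z * expR (- t))%:E + (b `^ z * expR (- b))%:E)%E.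
Proof.
move=> z0 n0; pose h (t : R) := t `^ (z - 1) * expR (- t).
pose F (t : R) := t `^ z * expR (- t).
pose k := F.
have cpow : {within `[0, b], continuous (fun t : R => t `^ z)}.
  apply/(continuous_within_itvP _ n0); split.
  - move=> x; rewrite in_itv/= => /andP[x0 _]; exact: powR_continuous_pos.
  - by rewrite powR0 ?gt_eqF//; exact: powR_cvg0.
  - by apply: cvg_at_left_filter; exact: powR_continuous_pos.
have cexp : continuous (fun t : R => expR (- t)).
  by move=> x; apply: continuous_comp; [exact: continuousN|exact: continuous_expR].
have [intf If] : mu.-integrable `]0, b[ (EFin \o (fun t => z * h t - k t)) /\
    \int[mu]_(t in `]0, b[) (z * h t - k t) = F b - F 0.
  apply: (@FTC_oo_dominated R (fun t => z * h t - k t) (fun t => z * t `^ (z - 1) + b `^ z) F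
    (fun t => t `^ z + b `^ z * t)) => //.
  - move=> x; apply: cvgM; first exact: cpow.
    exact: (continuous_subspaceT cexp).
  - move=> x; apply: cvgD; first exact: cpow.
    by apply: (continuous_subspaceT _) => y; apply: cvgM; [exact: cvg_cst|exact: cvg_id].
  - move=> x /andP[x0 _]; rewrite /F.
    apply: is_derive_eq; first exact: (is_deriveM (is_derive1_powR z x0)
      (is_derive1_comp (is_derive_expR (- x)) (is_deriveN (is_derive_id x 1)))).
    rewrite /k /h /F /GRing.scale/=; ring.
  - move=> x /andP[x0 _].
    apply: is_derive_eq; first exact: (is_deriveD (is_derive1_powR z x0)
      (is_deriveZ (b `^ z) (is_derive_id x 1))).
    by rewrite /GRing.scale/= mulr1.
  - move=> x /andP[x0 _]; apply: cvgB; last exact: integrand_cts.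
    by apply: cvgM; [exact: cvg_cst|exact: integrand_cts].
  - move=> x /andP[x0 _]; apply: cvgD; last exact: cvg_cst.
    by apply: cvgM; [exact: cvg_cst|exact: powR_continuous_pos].
  - move=> x /andP[x0 xn].
    have px : 0 <= x `^ (z - 1) by exact: powR_ge0.
    have pz : 0 <= x `^ z by exact: powR_ge0.
    have ex : 0 <= expR (- x) by exact: expR_ge0.
    apply: (le_trans (ler_normB _ _)); rewrite /k /h /F !ger0_norm ?mulr_ge0 ?(ltW z0)//.
    have e1 : expR (- x) <= 1 by rewrite expR_le1 oppr_le0 ltW.
    apply: lerD; first by rewrite ler_wpM2l ?(ltW z0)// ler_piMr ?powR_ge0.
    by rewrite (le_trans _ (ler_powRP (ltW z0) (ltW x0) (ltW xn)))// ler_piMr.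
have intk : mu.-integrable `]0, b[ (EFin \o k).
  have : mu.-integrable `[0, b] (EFin \o k).
    apply: continuous_compact_integrable; first exact: segment_compact.
    move=> x; apply: cvgM; first exact: cpow.
    exact: (continuous_subspaceT cexp).
  by apply: integrableS => //; exact: subset_itv_oo_cc.
transitivity (\int[mu]_(t in `]0%R, b[) ((z * h t - k t)%:E + (k t)%:E))%E.
  by apply: eq_integral => t _; rewrite -EFinD subrK.
rewrite integralD_EFin//= addeC; congr (_ + _)%E.
rewrite -[LHS]fineK; last exact: integrable_fin_num.
by rewrite -/(Rintegral _ _ _) If /F powR0 ?gt_eqF// mul0r subr0.
Qed.

Lemma GammaD1 (z : R) : 0 < z <= 1 -> Gamma (z + 1) = z * Gamma z.
Proof.
move=> /[dup] z01 /andP[z0 z1].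
have U : `]0, +oo[%classic = \bigcup_n `]0, n.+1%:R[%classic :> set R.
  apply/seteqP; split=> [x /=|x [n _]]; rewrite /= !in_itv/=; last by case/andP => ->.
  rewrite andbT => x0; exists (Num.truncn x) => //=; rewrite in_itv/= x0/=.
  exact: truncnS_gt.
pose h (t : R) := t `^ (z - 1) * expR (- t).
pose k (t : R) := t `^ (z + 1 - 1) * expR (- t).
have cvgI (g : R -> R) : measurable_fun Rpos g -> (forall t, 0 <= g t) ->
    (\int[mu]_(t in `]0%R, n.+1%:R[) (g t)%:E)%E @[n --> \oo]
      --> (\int[mu]_(t in `]0%R, +oo[) (g t)%:E)%E.
  move=> mg g0; rewrite U; apply: ge0_nondecreasing_set_cvg_integral.
  - apply/nondecreasing_seqP => n; apply/subsetPset => x/=.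
    by rewrite !in_itv/= => /andP[-> /lt_le_trans]; apply; rewrite ler_nat.
  - by move=> n; exact: measurable_itv.
  - move=> n; apply/measurable_EFinP; apply: measurable_funS mg => // x/=.
    by rewrite !in_itv/= andbT => /andP[].
  - by move=> n t _; rewrite lee_fin.
have h0 t : 0 <= h t by rewrite mulr_ge0 ?powR_ge0 ?expR_ge0.
have k0 t : 0 <= k t by rewrite mulr_ge0 ?powR_ge0 ?expR_ge0.
have mh : measurable_fun Rpos h by apply/measurable_EFinP; exact: integrand_measurable.
have mk : measurable_fun Rpos k by apply/measurable_EFinP; exact: integrand_measurable.
have mzh : measurable_fun Rpos (fun t => z * h t) by exact: measurable_funM.
pose F (t : R) := t `^ z * expR (- t).
pose c n : R := F n.+1%:R.
have kF : k = F by apply/funext => t; rewrite /k /F addrK.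
have step n : (\int[mu]_(t in `]0%R, n.+1%:R[) (z * h t)%:E =
    \int[mu]_(t in `]0%R, n.+1%:R[) (k t)%:E + (c n)%:E)%E.
  by rewrite kF; apply: Gamma_by_parts.
have c_cvg : c n @[n --> \oo] --> 0.
  (* With [x = n + 1], the boundary term is at most [x expR (- x)] as [z <= 1], and
     [expR (x / 2) >= 1 + x / 2] bounds this by [4 / x]. *)
  have c_le n : c n <= 4 * n.+1%:R^-1.
    have n0 : 0 < n.+1%:R :> R by rewrite ltr0n.
    rewrite /c /F; apply: (@le_trans _ _ (n.+1%:R * expR (- n.+1%:R))).
      rewrite ler_wpM2r ?expR_ge0// -[leRHS]powRr1 ?ler0n//.
      by apply: ler_powR => //; rewrite ler1n.
    rewrite expRN ler_pdivrMr ?expR_gt0// mulrAC ler_pdivlMr// -expr2.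
    have -> : n.+1%:R = n.+1%:R / 2 + n.+1%:R / 2 :> R by lra.
    rewrite expRD; have := expR_ge1Dx (n.+1%:R / 2 : R).
    by move: n0; nra.
  apply: (@squeeze_cvgr _ _ _ _ (fun=> 0) (fun n => 4 * n.+1%:R^-1)).
  - by apply: nearW => n; rewrite c_le mulr_ge0 ?powR_ge0 ?expR_ge0.
  - exact: cvg_cst.
  - by rewrite -(mulr0 4); apply: cvgM; [exact: cvg_cst|exact: cvg_harmonic].
have E : (\int[mu]_(t in `]0%R, +oo[) (z * h t)%:E = \int[mu]_(t in `]0%R, +oo[) (k t)%:E)%E.
  apply: (cvg_unique _ (cvgI _ mzh _)); [exact: ereal_hausdorff|by move=> t; rewrite mulr_ge0// ltW|].
  rewrite /= -[X in _ --> X]adde0.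
  rewrite (_ : (fun n => _) = (fun n => \int[mu]_(t in `]0%R, n.+1%:R[) (k t)%:E + (c n)%:E)%E); last exact/funext.
  apply: cvgeD; [by rewrite fin_num_adde_defl|exact: cvgI|].
  by apply: cvg_EFin; [exact: nearW|].
rewrite /Gamma -/(h _) /Rintegral -/k -E.
have -> : (\int[mu]_(t in `]0%R, +oo[) (z * h t)%:E = z%:E * \int[mu]_(t in `]0%R, +oo[) (h t)%:E)%E.
  rewrite -ge0_integralZl//; last by rewrite lee_fin ltW.
    by apply/measurable_EFinP.
  by move=> t _; rewrite lee_fin.
rewrite fineM// ge0_fin_numE; last by apply: integral_ge0 => t _; rewrite lee_fin.
exact: Gamma_integral_lty.
Qed.

End GammaFunction.

(** * Integration over bounded open intervals *)

Section RintegralOpen.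
Context {R : realType}.
Local Notation mu := (@lebesgue_measure R).
Implicit Types (f g w e : R -> R) (a b c : R).

Lemma itvoo_intD f g a b : mu.-integrable `]a, b[ (EFin \o f) ->
  mu.-integrable `]a, b[ (EFin \o g) ->
  mu.-integrable `]a, b[ (EFin \o (fun x => f x + g x)).
Proof. by move=> intf intg; exact: (integrableD _ intf intg). Qed.

Lemma itvoo_intB f g a b : mu.-integrable `]a, b[ (EFin \o f) ->
  mu.-integrable `]a, b[ (EFin \o g) ->
  mu.-integrable `]a, b[ (EFin \o (fun x => f x - g x)).
Proof. by move=> intf intg; exact: (integrableB _ intf intg). Qed.

Lemma itvoo_intZ c f a b : mu.-integrable `]a, b[ (EFin \o f) ->
  mu.-integrable `]a, b[ (EFin \o (fun x => c * f x)).
Proof. by move=> intf; exact: (integrableZl _ c intf). Qed.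

Lemma itvoo_int_sum (I : Type) (s : seq I) (P : pred I) (F : I -> R -> R) a b :
  (forall i, P i -> mu.-integrable `]a, b[ (EFin \o F i)) ->
  mu.-integrable `]a, b[ (EFin \o (fun x => \sum_(i <- s | P i) F i x)).
Proof.
move=> intF; have := @integrable_sum _ _ _ mu `]a, b[%classic (measurable_itv _)
  I s P (fun i => EFin \o F i) intF.
by apply: eq_integrable => // x _; rewrite /= sumEFin.
Qed.

Lemma itvoo_int_cst c a b : mu.-integrable `]a, b[ (EFin \o (fun=> c)).
Proof.
apply: (@measurable_bounded_integrable _ _ _ mu (fun=> c)) => //.
  by rewrite /= lebesgue_measure_itv/=; case: ifP => // _; rewrite -EFinB ltry.
by exists `|c|; split; [exact: num_real|move=> x /ltW + y _; exact].
Qed.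

Lemma itvoo_int_measurable f a b : mu.-integrable `]a, b[ (EFin \o f) ->
  measurable_fun (`]a, b[ : set R) f.
Proof. by move=> intf; apply/measurable_EFinP; exact: (measurable_int mu). Qed.

Lemma itvoo_int_norm f a b : mu.-integrable `]a, b[ (EFin \o f) ->
  mu.-integrable `]a, b[ (EFin \o (fun x => `|f x|)).
Proof. by move=> intf; exact: integrable_norm. Qed.

Lemma itvoo_int_le f g a b : measurable_fun (`]a, b[ : set R) f ->
  (forall x, a < x < b -> `|f x| <= g x) ->
  mu.-integrable `]a, b[ (EFin \o g) -> mu.-integrable `]a, b[ (EFin \o f).
Proof.
move=> mf fg intg; apply: (le_integrable _ _ _ intg) => //; first exact/measurable_EFinP.
by move=> x /=; rewrite in_itv/= => /fg h; rewrite lee_fin (le_trans h)// ler_norm.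
Qed.

Lemma itvoo_intM f g c a b : measurable_fun (`]a, b[ : set R) f ->
  (forall x, a < x < b -> `|f x| <= c) ->
  mu.-integrable `]a, b[ (EFin \o g) ->
  mu.-integrable `]a, b[ (EFin \o (fun x => f x * g x)).
Proof.
move=> mf fc intg; apply: (itvoo_int_le _ _ (itvoo_intZ c (itvoo_int_norm intg))).
  by apply: measurable_funM => //; exact: itvoo_int_measurable.
by move=> x /fc fx; rewrite normrM ler_wpM2r.
Qed.

Lemma itvoo_RintD f g a b : mu.-integrable `]a, b[ (EFin \o f) ->
  mu.-integrable `]a, b[ (EFin \o g) ->
  \int[mu]_(x in `]a, b[) (f x + g x) =
  \int[mu]_(x in `]a, b[) f x + \int[mu]_(x in `]a, b[) g x.
Proof. by move=> intf intg; rewrite RintegralD. Qed.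

Lemma itvoo_RintB f g a b : mu.-integrable `]a, b[ (EFin \o f) ->
  mu.-integrable `]a, b[ (EFin \o g) ->
  \int[mu]_(x in `]a, b[) (f x - g x) =
  \int[mu]_(x in `]a, b[) f x - \int[mu]_(x in `]a, b[) g x.
Proof. by move=> intf intg; rewrite RintegralB. Qed.

Lemma itvoo_RintZ c f a b : mu.-integrable `]a, b[ (EFin \o f) ->
  \int[mu]_(x in `]a, b[) (c * f x) = c * \int[mu]_(x in `]a, b[) f x.
Proof. by move=> intf; rewrite RintegralZl. Qed.

Lemma itvoo_Rint_sum (I : Type) (s : seq I) (P : pred I) (F : I -> R -> R) a b :
  (forall i, P i -> mu.-integrable `]a, b[ (EFin \o F i)) ->
  \int[mu]_(x in `]a, b[) (\sum_(i <- s | P i) F i x) =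
  \sum_(i <- s | P i) \int[mu]_(x in `]a, b[) F i x.
Proof.
move=> intF; elim: s => [|i s IH].
  under eq_Rintegral do rewrite big_nil.
  by rewrite big_nil Rintegral_cst// mul0r.
under eq_Rintegral do rewrite big_cons.
rewrite big_cons; case: ifP => Pi //.
by rewrite itvoo_RintD ?IH//; [exact: intF|exact: itvoo_int_sum].
Qed.

Lemma itvoo_Rint_cst c a b : a <= b -> \int[mu]_(x in `]a, b[) c = c * (b - a).
Proof.
move=> ab; rewrite Rintegral_cst//= lebesgue_measure_itv/= lte_fin.
case: ifP => [_ //|/negbT].
rewrite -leNgt => ba; have /eqP -> : b == a by rewrite eq_le ba ab.
by rewrite subrr.
Qed.

Lemma itvoo_Rint_le f g a b : mu.-integrable `]a, b[ (EFin \o f) ->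
  mu.-integrable `]a, b[ (EFin \o g) -> (forall x, a < x < b -> f x <= g x) ->
  \int[mu]_(x in `]a, b[) f x <= \int[mu]_(x in `]a, b[) g x.
Proof.
by move=> intf intg fg; apply: le_Rintegral.
Qed.

Lemma itvoo_Rint_ge0 f a b : (forall x, a < x < b -> 0 <= f x) ->
  0 <= \int[mu]_(x in `]a, b[) f x.
Proof. by move=> f0; apply: Rintegral_ge0 => x /=; rewrite in_itv/=; exact: f0. Qed.

Lemma itvoo_Rint_norm f a b : mu.-integrable `]a, b[ (EFin \o f) ->
  `|\int[mu]_(x in `]a, b[) f x| <= \int[mu]_(x in `]a, b[) `|f x|.
Proof. by move=> intf; exact: le_normr_Rintegral. Qed.

Lemma itvoo_Rint_eq f g a b : (forall x, a < x < b -> f x = g x) ->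
  \int[mu]_(x in `]a, b[) f x = \int[mu]_(x in `]a, b[) g x.
Proof. by move=> fg; apply: eq_Rintegral => x; rewrite inE/= in_itv/=; exact: fg. Qed.

Lemma itvoo_int_eq f g a b : (forall x, a < x < b -> f x = g x) ->
  mu.-integrable `]a, b[ (EFin \o f) -> mu.-integrable `]a, b[ (EFin \o g).
Proof.
move=> fg; apply: eq_integrable => // x; rewrite inE/= in_itv/= => /fg /=.
by move=> ->.
Qed.

Lemma itvoo_intS f a b c d : a <= c -> d <= b -> mu.-integrable `]a, b[ (EFin \o f) ->
  mu.-integrable `]c, d[ (EFin \o f).
Proof.
move=> ac db; apply: integrableS => //.
by apply: subset_itv; rewrite bnd_simp.
Qed.

Lemma itvoo_int_within f a b : {within `[a, b], continuous f} ->
  mu.-integrable `]a, b[ (EFin \o f).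
Proof.
move=> cf; have : mu.-integrable `[a, b] (EFin \o f).
  by apply: continuous_compact_integrable => //; exact: segment_compact.
by apply: integrableS => //; exact: subset_itv_oo_cc.
Qed.

Lemma Rintegral_oo_split f a b c : a <= b -> b < c ->
  mu.-integrable `]a, c[ (EFin \o f) ->
  \int[mu]_(x in `]a, c[) f x =
  \int[mu]_(x in `]a, b[) f x + \int[mu]_(x in `]b, c[) f x.
Proof.
move=> ab bc intf.
have := @Rintegral_itvB R f (BRight a) (BLeft c) b intf.
rewrite !bnd_simp => /(_ ab bc) <-.
rewrite -Rintegral_itv_bndo_bndc; first by rewrite addrC subrK.
by apply: integrableS intf => //; apply: subset_itvl; rewrite bnd_simp ltW.
Qed.

Lemma Rintegral_cells f (x : nat -> R) n :
  (forall k, (k < n)%N -> x k < x k.+1) ->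
  mu.-integrable `]x 0%N, x n[ (EFin \o f) ->
  \int[mu]_(s in `]x 0%N, x n[) f s =
  \sum_(0 <= k < n) \int[mu]_(s in `]x k, x k.+1[) f s.
Proof.
elim: n => [|n IH] xS intf; first by rewrite big_geq// set_itvoo0 Rintegral_set0.
have x0n m : (m <= n)%N -> x 0%N <= x m.
  elim: m => // m IHm mn; rewrite (le_trans (IHm (ltnW mn)))// ltW// xS//.
  exact: leqW.
rewrite big_nat_recr//= (@Rintegral_oo_split _ _ (x n))// ?x0n ?xS//.
rewrite IH//; first by move=> k kn; apply: xS; exact: leqW.
by apply: integrableS intf => //; apply: subset_itvl; rewrite bnd_simp ltW// xS.
Qed.

Lemma measurable_cells f (x : nat -> R) n :
  (forall k, (k < n)%N -> x k < x k.+1) ->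
  (forall k, (k < n)%N -> measurable_fun `]x k, x k.+1[ f) ->
  measurable_fun (`]x 0%N, x n[ : set R) f.
Proof.
elim: n => [|n IH] xS mf; first by rewrite set_itvoo0; exact: measurable_fun_set0.
have x0n m : (m <= n)%N -> x 0%N <= x m.
  elim: m => // m IHm mn; rewrite (le_trans (IHm (ltnW mn)))// ltW// xS//.
  exact: leqW.
have sub : (`]x 0%N, x n.+1[ : set R) `<=`
   (`]x 0%N, x n[ : set R) `|` ([set x n] `|` (`]x n, x n.+1[ : set R)).
  move=> y/=; rewrite !in_itv/= => /andP[y0 yn].
  by case: (ltgtP y (x n)) => h; [left|right; right|right; left];
    rewrite ?y0 ?yn ?h.
apply: (measurable_funS _ sub); first by do 2 apply: measurableU => //.
apply/measurable_funU => //; first by apply: measurableU.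
split; first by apply: IH => k kn; [apply: xS|apply: mf]; exact: leqW.
apply/measurable_funU => //; split; last exact: mf.
exact: measurable_fun_set1.
Qed.

Lemma integrable_cells f (x : nat -> R) n :
  (forall k, (k < n)%N -> x k < x k.+1) ->
  (forall k, (k < n)%N -> mu.-integrable `]x k, x k.+1[ (EFin \o f)) ->
  mu.-integrable `]x 0%N, x n[ (EFin \o f).
Proof.
move=> xS intf.
have mf : measurable_fun (`]x 0%N, x n[ : set R) f.
  apply: measurable_cells => // k kn.
  by apply/measurable_EFinP; apply: (measurable_int mu); exact: intf.
elim: n xS intf mf => [|n IH] xS intf mf; first by rewrite set_itvoo0; exact: integrable_set0.
have x0n m : (m <= n)%N -> x 0%N <= x m.
  elim: m => // m IHm mn; rewrite (le_trans (IHm (ltnW mn)))// ltW// xS//.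
  exact: leqW.
have xn := xS n (leqnn _).
have U : `]x 0%N, x n.+1[%classic = `]x 0%N, x n]%classic `|` `]x n, x n.+1[%classic :> set R.
  by apply: itv_bndbnd_setU; rewrite bnd_simp ?x0n.
apply/integrableP; split; first exact/measurable_EFinP.
have mfn : measurable_fun (`]x 0%N, x n[ : set R) f.
  apply: measurable_funS mf => //.
  by apply: subset_itvl; rewrite bnd_simp ltW.
have mabs : measurable_fun (`]x 0%N, x n.+1[ : set R) (fun s => `|(EFin \o f) s|%E).
  by apply: measurableT_comp => //; exact/measurable_EFinP.
rewrite U ge0_integral_setU//=; last 2 first.
- by rewrite -U; exact: mabs.
- by apply/disj_setPS => y/= []; rewrite !in_itv/= => /andP[_ yx] /andP[]; rewrite ltNge yx.
rewrite lte_add_pinfty//.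
  rewrite -integral_itv_bndo_bndc; last by apply/measurable_EFinP; exact: measurableT_comp.
  have /integrableP[_] : mu.-integrable `]x 0%N, x n[ (EFin \o f).
    by apply: IH => // k kn; [apply: xS|apply: intf]; exact: leqW.
  by [].
by have /integrableP[] := intf n (leqnn _).
Qed.

(** As [e] has mean zero, [w] may be replaced by [w - lo]: only the oscillation of the kernel
    counts, not its size. *)
Lemma kernel_mean_zero w e a b lo hi :
  (forall s, a < s < b -> lo <= w s <= hi) ->
  measurable_fun (`]a, b[ : set R) w ->
  mu.-integrable `]a, b[ (EFin \o e) ->
  \int[mu]_(s in `]a, b[) e s = 0 ->
  `|\int[mu]_(s in `]a, b[) (w s * e s)| <= (hi - lo) * \int[mu]_(s in `]a, b[) `|e s|.
Proof.
move=> wb mw inte e0.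
have intn : mu.-integrable `]a, b[ (EFin \o (fun s => `|e s|)) by exact: integrable_norm.
have me : measurable_fun (`]a, b[ : set R) e.
  by apply/measurable_EFinP; exact: (measurable_int mu).
have intwe : mu.-integrable `]a, b[ (EFin \o (fun s => (w s - lo) * e s)).
  apply: (le_integrable _ _ _ (integrableZl _ (hi - lo) intn)) => //.
    by apply/measurable_EFinP; apply: measurable_funM => //; exact: measurable_funB.
  move=> s /=; rewrite in_itv/= => /wb /andP[h1 h2].
  rewrite lee_fin !normrM normr_id ler_wpM2r// !ger0_norm; lra.
have -> : \int[mu]_(s in `]a, b[) (w s * e s) = \int[mu]_(s in `]a, b[) ((w s - lo) * e s).
  transitivity (\int[mu]_(s in `]a, b[) ((w s - lo) * e s + lo * e s)).
    by apply: eq_Rintegral => s _; rewrite -mulrDl subrK.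
  rewrite RintegralD//; last exact: (integrableZl _ lo inte).
  by rewrite RintegralZl// e0 mulr0 addr0.
apply: (le_trans (le_normr_Rintegral _ intwe)) => //.
rewrite -RintegralZl//; apply: le_Rintegral => //.
- exact: integrable_norm.
- exact: (integrableZl _ (hi - lo) intn).
- move=> s /=; rewrite in_itv/= => /wb /andP[h1 h2].
  by rewrite normrM ler_wpM2r// ger0_norm; lra.
Qed.

End RintegralOpen.

(** * The kernel [omega] and the L1 coefficients *)

Section OmegaKernel.
Context {R : realType} (alpha : R).
Local Notation mu := (@lebesgue_measure R).
Hypothesis alpha01 : 0 < alpha < 1.

Let a0 : 0 < alpha. Proof. by case/andP: alpha01. Qed.
Let a1 : 0 < 1 - alpha. Proof. by case/andP: alpha01; lra. Qed.

(** The absolute value makes the power continuous across 0; this yields continuity up to the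
    singular endpoint in [within_powR] and [within_powR_rev]. *)
Lemma continuous_norm_powR (s : R) : 0 < s -> continuous (fun x : R => `|x| `^ s).
Proof.
move=> s0 x; have [->|x0] := eqVneq x 0; last first.
  apply: (@continuous_comp _ _ _ (fun y : R => `|y|) (fun y => y `^ s)); first exact: norm_continuous.
  by apply: powR_continuous_pos; rewrite normr_gt0.
apply/cvgrPdist_lt => e e0; rewrite normr0 powR0 ?gt_eqF//.
have e1 : 0 < e `^ s^-1 by rewrite powR_gt0.
exists (e `^ s^-1) => //= y; rewrite /ball_/= sub0r normrN => ye.
rewrite sub0r normrN ger0_norm ?powR_ge0//.
have -> : e = (e `^ s^-1) `^ s by rewrite -powRrM mulVf ?gt_eqF// powRr1// ltW.
by apply: gt0_ltr_powR; rewrite // ?nnegrE ?normr_ge0 ?(ltW e1).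
Qed.

Lemma within_powR (s : R) (a b : R) : 0 < s -> 0 <= a ->
  {within `[a, b], continuous (fun x : R => x `^ s)}.
Proof.
move=> s0 a_ge0; apply: (@subspace_eq_continuous _ _ _ (fun x : R => `|x| `^ s)).
  by move=> x; rewrite inE/= in_itv/= => /andP[ax _]; rewrite ger0_norm// (le_trans a_ge0).
by apply: continuous_subspaceT; exact: continuous_norm_powR.
Qed.

Lemma within_powR_rev (s t : R) (a b : R) : 0 < s -> b <= t ->
  {within `[a, b], continuous (fun x : R => (t - x) `^ s)}.
Proof.
move=> s0 bt; apply: (@subspace_eq_continuous _ _ _ (fun x : R => `|t - x| `^ s)).
  by move=> x; rewrite inE/= in_itv/= => /andP[_ xb]; rewrite ger0_norm// subr_ge0 (le_trans xb).
apply: continuous_subspaceT => x.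
apply: (@continuous_comp _ _ _ (fun y => t - y) (fun y => `|y| `^ s)).
  by apply: cvgB; [exact: cvg_cst|exact: cvg_id].
exact: continuous_norm_powR.
Qed.

Lemma is_derive_powR_rev (s t x : R) : x < t ->
  is_derive x 1 (fun y : R => (t - y) `^ s) (- (s * (t - x) `^ (s - 1))).
Proof.
move=> xt; have tx : 0 < t - x by rewrite subr_gt0.
apply: is_derive_eq; first exact: (@is_derive1_comp R (fun y => y `^ s) (fun y => t - y) x
  _ _ (is_derive1_powR s tx) (is_deriveB (is_derive_cst t x 1) (is_derive_id x 1))).
by rewrite sub0r mulrN1.
Qed.

Lemma powR_rev_continuous (s t x : R) : x < t ->
  {for x, continuous (fun y : R => (t - y) `^ s)}.
Proof.
move=> xt; apply: (@continuous_comp _ _ _ (fun y => t - y) (fun y => y `^ s)).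
  by apply: cvgB; [exact: cvg_cst|exact: cvg_id].
by apply: powR_continuous_pos; rewrite subr_gt0.
Qed.

Lemma Gamma2B : Gamma (2 - alpha) = (1 - alpha) * Gamma (1 - alpha) :> R.
Proof.
have -> : 2 - alpha = (1 - alpha) + 1 by lra.
by apply: GammaD1; case/andP: alpha01; lra.
Qed.

Lemma Gamma1B_gt0 : 0 < Gamma (1 - alpha) :> R.
Proof. by apply: Gamma_gt0; case/andP: alpha01; lra. Qed.

Lemma Gamma2B_gt0 : 0 < Gamma (2 - alpha) :> R.
Proof. by rewrite Gamma2B mulr_gt0 ?Gamma1B_gt0. Qed.

Lemma omega_ge0 (s t : R) : 0 < s <= 1 -> 0 <= omega s t.
Proof. by move=> s1; rewrite divr_ge0 ?powR_ge0// ltW// Gamma_gt0. Qed.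

(** The primitive in [s] is [- omega (2 - alpha) (t - s)], by [Gamma2B]. It is continuous at
    [s = t], so [b = t] is allowed. *)
Lemma omega_integral (t a b : R) : a < b -> b <= t ->
  mu.-integrable `]a, b[ (EFin \o (fun s => omega (1 - alpha) (t - s))) /\
  \int[mu]_(s in `]a, b[) omega (1 - alpha) (t - s) =
    omega (2 - alpha) (t - a) - omega (2 - alpha) (t - b).
Proof.
move=> ab bt.
pose F (s : R) := - omega (2 - alpha) (t - s).
have cF : {within `[a, b], continuous F}.
  move=> x; apply: cvgN; apply: cvgM; last exact: cvg_cst.
  by apply: within_powR_rev => //; move: a1; lra.
have dF x : a < x < b -> is_derive x 1 F (omega (1 - alpha) (t - x)).
  move=> /andP[_ xb]; have xt := lt_le_trans xb bt.
  have h := is_deriveZ (- (Gamma (2 - alpha))^-1) (is_derive_powR_rev (2 - alpha - 1) xt).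
  have -> : F = (- (Gamma (2 - alpha))^-1) \*: (fun s => (t - s) `^ (2 - alpha - 1)).
    by apply/funext => s; rewrite /F /omega -[RHS]/(_ * _) mulNr mulrC.
  apply: (is_derive_eq h).
  rewrite /GRing.scale/= mulrNN /omega Gamma2B mulrC.
  have -> : 2 - alpha - 1 = 1 - alpha by lra.
  by rewrite invfM mulrAC mulrA mulfV ?mul1r 1?mulrC// gt_eqF.
have cf x : a < x < b -> {for x, continuous (fun s => omega (1 - alpha) (t - s))}.
  move=> /andP[_ xb]; apply: cvgM; last exact: cvg_cst.
  exact/powR_rev_continuous/(lt_le_trans xb).
have om0 x : a < x < b -> `|omega (1 - alpha) (t - x)| <= omega (1 - alpha) (t - x).
  by move=> _; rewrite ger0_norm// omega_ge0//; case/andP: alpha01; lra.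
have [int eq] := FTC_oo_dominated ab cF cF dF dF cf cf om0.
by split=> //; rewrite eq /F opprK addrC.
Qed.

(** The step times the coefficient is the exact integral of the kernel over a cell. Both the L1
    formula and the quadrature of the delay term therefore freeze only the other factor of the
    integrand. *)
Lemma L1coef_integral (tau : R) (N n k : nat) : 0 < tau -> (0 < N)%N ->
  (0 < k <= n)%N ->
  step tau N * L1coef alpha tau N n k =
  \int[mu]_(s in `]tm tau N (k%:Z - 1), tm tau N k[) omega (1 - alpha) (tm tau N n - s).
Proof.
move=> tau0 N0 /andP[k0 kn].
have r0 : 0 < step tau N by rewrite divr_gt0// ltr0n muln_gt0.
have [||_ ->] := @omega_integral (tm tau N n) (tm tau N (k%:Z - 1)) (tm tau N k).
- by rewrite /tm ltr_pM2r// ltr_int ltrBlDr ltrDl.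
- by rewrite /tm ler_pM2r// ler_int lez_nat.
by rewrite /L1coef mulrC divfK// gt_eqF.
Qed.

Lemma L1coefE (tau : R) (N n k : nat) : 0 < tau -> (0 < N)%N ->
  (0 < k <= n)%N ->
  L1coef alpha tau N n k =
  step tau N `^ (- alpha) / Gamma (2 - alpha) * L1weight alpha (n - k).
Proof.
move=> tau0 N0 /andP[k0 kn].
have r0 : 0 < step tau N by rewrite divr_gt0// ltr0n muln_gt0.
rewrite /L1coef /omega /L1weight /tm; set r := step tau N in r0 *; clearbody r.
have -> : n%:~R * r - (k%:Z - 1)%:~R * r = (n - k).+1%:R * r.
  by rewrite -mulrBl -natr1 natrB// intrD; congr (_ * _); ring.
have -> : n%:~R * r - k%:~R * r = (n - k)%:R * r.
  by rewrite -mulrBl natrB.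
have -> : 2 - alpha - 1 = 1 - alpha by lra.
rewrite !powRM ?ler0n ?(ltW r0)//.
have -> : r `^ (1 - alpha) = r * r `^ (- alpha).
  by rewrite powRD ?gt_eqF ?implybT// powRr1// ltW.
by field; rewrite !gt_eqF//= ?Gamma2B_gt0.
Qed.

End OmegaKernel.

(* Otherwise unification may unfold [Gamma] and compare integrals. *)
Opaque Gamma.

Ltac nonneg := lazymatch goal with
  | |- is_true (0 <= _ + _) => apply: addr_ge0; nonneg
  | |- is_true (0 <= _ * _) => apply: mulr_ge0; nonneg
  | |- is_true (0 <= _ `^ _) => exact: powR_ge0
  | |- is_true (0 <= _%:R) => exact: ler0n
  | |- is_true (0 <= 1) => exact: ler01
  | H : is_true (0 <= ?x) |- is_true (0 <= ?x) => exact: H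
  | _ => idtac
  end.

Section MoreRealAnalysis.
Context {R : realType}.

(** Write [x^s] as [x] times [x^(s - 1)], where the second factor is nonincreasing. *)
Lemma powR_subadditive (s x y : R) : 0 < s <= 1 -> 0 <= x -> 0 <= y ->
  (x + y) `^ s <= x `^ s + y `^ s.
Proof.
move=> /andP[s0 s1] x_ge0 y_ge0.
have [->|x_neq0] := eqVneq x 0; first by rewrite powR0 ?gt_eqF// !add0r.
have [->|y_neq0] := eqVneq y 0; first by rewrite powR0 ?gt_eqF// !addr0.
have x0 : 0 < x by rewrite lt0r x_neq0.
have y0 : 0 < y by rewrite lt0r y_neq0.
have xy0 : 0 < x + y by rewrite addr_gt0.
rewrite -(mulr_powRB1 (ltW xy0) s0) -(mulr_powRB1 (ltW x0) s0) -(mulr_powRB1 (ltW y0) s0).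
rewrite mulrDl; apply: lerD; apply: ler_wpM2l => //.
all: by apply: ler_powRN => //; rewrite ?subr_le0 ?lerDl ?lerDr.
Qed.

Lemma derivable_continuous (f : R -> R) x : derivable f x 1 -> {for x, continuous f}.
Proof. by move=> df; apply: differentiable_continuous; exact/derivable1_diffP. Qed.

(** Both [g + f] and [g - f] have nonnegative derivatives. *)
Lemma MVT_dominated (f g df dg : R -> R) (a b : R) :
  (forall x, a < x < b -> is_derive x 1 f (df x)) ->
  (forall x, a < x < b -> is_derive x 1 g (dg x)) ->
  (forall x, a < x < b -> `|df x| <= dg x) ->
  forall x y, a < x -> x <= y -> y < b -> `|f y - f x| <= g y - g x.
Proof.
move=> Df Dg dfg x y ax; rewrite le_eqVlt => /predU1P[->|xy] yb.
  by rewrite !subrr normr0.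
have sub z : x <= z <= y -> a < z < b.
  by move=> /andP[xz zy]; rewrite (lt_le_trans ax xz) (le_lt_trans zy yb).
have cts (h dh : R -> R) : (forall x, a < x < b -> is_derive x 1 h (dh x)) ->
    {within `[x, y], continuous h}.
  move=> Dh; apply: continuous_in_subspaceT => z; rewrite inE/= in_itv/= => /sub zab.
  by apply: derivable_continuous; have Dz := Dh _ zab; exact: ex_derive.
have step (h dh : R -> R) : (forall x, a < x < b -> is_derive x 1 h (dh x)) ->
    (forall x, a < x < b -> 0 <= dh x) -> h x <= h y.
  move=> Dh dh0; have [||c cxy] := @MVT R h dh x y xy.
  - move=> z; rewrite in_itv/= => /andP[xz zy].
    by apply: Dh; apply: sub; rewrite !ltW.
  - exact: (cts h dh).
  rewrite -subr_ge0 => ->; apply: mulr_ge0; last by rewrite subr_ge0 ltW.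
  apply: dh0; apply: sub; move: cxy; rewrite in_itv/= => /andP[? ?].
  by rewrite !ltW.
rewrite ler_norml; apply/andP; split.
  have := step (g \+ f) (fun z => dg z + df z); rewrite /=.
  have h1 : forall z, a < z < b -> is_derive z 1 (g \+ f) (dg z + df z).
    by move=> z zab; apply: is_deriveD; [exact: Dg|exact: Df].
  move=> /(_ h1) h2; suff : g x + f x <= g y + f y by lra.
  by apply: h2 => z /dfg; rewrite ler_norml => /andP[]; lra.
have := step (g \- f) (fun z => dg z - df z); rewrite /=.
have h1 : forall z, a < z < b -> is_derive z 1 (g \- f) (dg z - df z).
  by move=> z zab; apply: is_deriveB; [exact: Dg|exact: Df].
move=> /(_ h1) h2; suff : g x - f x <= g y - f y by lra.
by apply: h2 => z /dfg; rewrite ler_norml => /andP[]; lra.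
Qed.

Lemma powR_FTC (c s a b : R) : 0 < s -> 0 <= a -> a < b -> 0 <= c ->
  (@lebesgue_measure R).-integrable `]a, b[ (EFin \o (fun x => c * x `^ (s - 1))) /\
  \int[lebesgue_measure]_(x in `]a, b[) (c * x `^ (s - 1)) =
    c / s * b `^ s - c / s * a `^ s.
Proof.
move=> s0 a_ge0 ab c0.
have cF : {within `[a, b], continuous (fun x : R => c / s * x `^ s)}.
  by move=> x; apply: cvgM; [exact: cvg_cst|exact: within_powR].
have x0 x : a < x < b -> 0 < x by move=> /andP[/(le_lt_trans a_ge0)].
have dF x : a < x < b -> is_derive x 1 (fun x : R => c / s * x `^ s) (c * x `^ (s - 1)).
  move=> /x0 xgt0; apply: (is_derive_eq (is_deriveZ (c / s) (is_derive1_powR s xgt0))).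
  by rewrite /GRing.scale/= mulrA divfK// gt_eqF.
have cf x : a < x < b -> {for x, continuous (fun x : R => c * x `^ (s - 1))}.
  by move=> /x0 xgt0; apply: cvgM; [exact: cvg_cst|exact: powR_continuous_pos].
have dom x : a < x < b -> `|c * x `^ (s - 1)| <= c * x `^ (s - 1).
  by move=> _; rewrite ger0_norm// mulr_ge0 ?powR_ge0.
exact: (FTC_oo_dominated ab cF cF dF dF cf cf dom).
Qed.

Lemma is_derive_continuous (f : R -> R) (x d : R) : is_derive x 1 f d -> {for x, continuous f}.
Proof. by move=> Df; apply: derivable_continuous; exact: ex_derive. Qed.

End MoreRealAnalysis.

(** * Truncation error of the L1 formula *)

Section Step.
Context {R : realType} (tau : R) (N : nat).
Hypotheses (tau0 : 0 < tau) (N0 : (0 < N)%N).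

Lemma step_gt0 : 0 < step tau N.
Proof. by rewrite divr_gt0// ltr0n muln_gt0. Qed.

Lemma mul_step : (2 * N)%:R * step tau N = tau.
Proof. by rewrite /step mulrCA divff ?mulr1// pnatr_eq0 muln_eq0/= -lt0n. Qed.

Lemma step_le : step tau N <= tau.
Proof. by rewrite -[leRHS]mul_step ler_peMl ?(ltW step_gt0)// ler1n muln_gt0. Qed.

End Step.

Section Truncation.
Context {R : realType} (alpha tau : R) (K : nat) (C : R).
Local Notation mu := (@lebesgue_measure R).
Hypothesis alpha01 : 0 < alpha < 1.
Hypothesis tau0 : 0 < tau.
Hypothesis K0 : (0 < K)%N.

Let a0 : 0 < alpha. Proof. by case/andP: alpha01. Qed.
Let a1 : 0 < 1 - alpha. Proof. by case/andP: alpha01; lra. Qed.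

Local Notation T := (K%:R * tau).
Local Notation sigma := (Num.min alpha (1 - alpha)).

Let T0 : 0 < T. Proof. by rewrite mulr_gt0// ltr0n. Qed.

Let sigma_gt0 : 0 < sigma. Proof. by rewrite lt_min a0 a1. Qed.

(** [time_regular] read at one fixed point of space. The constant [C] is common to all paths, which
    makes the truncation estimate uniform in [x]. *)
Definition regular_path (v : R -> R) : Prop :=
  {within `[0, T], continuous v} /\
  forall (k : nat) (t : R), (1 <= k <= K)%N -> (k%:R - 1) * tau < t < k%:R * tau ->
    [/\ derivable v t 1, derivable (derive1 v) t 1,
        `|derive1 v t| <= C * (1 + t `^ (alpha - 1)),
        k = 1%N -> `|derive1n 2 v t| <= C * (1 + t `^ (alpha - 2)) &
        (2 <= k)%N -> `|derive1n 2 v t| <= C * (1 + (t - tau) `^ (alpha - 1))].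

Section FixedPath.
Variable v : R -> R.
Hypothesis vreg : regular_path v.

Lemma regular_const_ge0 : 0 <= C.
Proof.
have [_ /(_ 1%N (tau / 2))] := vreg; rewrite leqnn K0 => /(_ isT).
have h : (1 - 1) * tau < tau / 2 < 1 * tau by rewrite subrr mul0r mul1r divr_gt0//= ltr_pdivrMr// ltr_pMr// ltr1n.
move=> /(_ h)[_ _ + _ _]; have := powR_ge0 (tau / 2) (alpha - 1).
move=> p0 /(le_trans (normr_ge0 _)); rewrite pmulr_lge0//; lra.
Qed.

(** The step divides [tau], so no cell straddles a multiple of [tau], where time derivatives may
    jump; [j] numbers the delay interval that contains cell [m]. *)
Let cell N m (s : R) : (0 < N)%N -> (m < 2 * K * N)%N ->
  m%:R * step tau N < s < m.+1%:R * step tau N ->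
  exists j : nat, [/\ (1 <= j <= K)%N, (j%:R - 1) * tau < s < j%:R * tau,
    (m < 2 * N)%N -> j = 1%N & ((2 * N <= m)%N -> (2 <= j)%N)].
Proof.
move=> N0 mKN /andP[s1 s2]; pose j := (m %/ (2 * N)).+1.
have r0 := step_gt0 tau0 N0; have tauE := mul_step tau N0.
have N2 : (0 < 2 * N)%N by rewrite muln_gt0.
set r := step tau N in s1 s2 r0 tauE; clearbody r.
exists j; split.
- by rewrite /= ltn_divLR// mulnCA mulnA.
- rewrite -tauE !mulrA; apply/andP; split.
    apply: le_lt_trans s1; rewrite ler_pM2r// /j -natr1 addrK -natrM ler_nat.
    exact: leq_divM.
  apply: (lt_le_trans s2); rewrite ler_pM2r// -natrM ler_nat /j.
  exact: ltn_ceil.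
- by move=> mN; rewrite /j divn_small.
- by move=> mN; rewrite /j ltnS divn_gt0.
Qed.

(** As [s <= T], the constant 1 is at most [T^(1 - alpha) s^(alpha - 1)], so a single singular power
    remains. *)
Lemma derive_bound s : (exists j : nat, (1 <= j <= K)%N /\ (j%:R - 1) * tau < s < j%:R * tau) ->
  `|derive1 v s| <= C * (1 + T `^ (1 - alpha)) * s `^ (alpha - 1).
Proof.
move=> [j [j1 js]]; have [_ /(_ j s j1 js)[_ _ + _ _]] := vreg.
move=> /le_trans; apply; rewrite -mulrA ler_wpM2l ?regular_const_ge0//.
case/andP: j1 => j1 jK; case/andP: js => s1 s2.
have s0 : 0 < s.
  by apply: le_lt_trans s1; rewrite mulr_ge0 ?(ltW tau0)// subr_ge0 ler1n.
have sT : s <= T by rewrite ltW// (lt_le_trans s2)// ler_pM2r// ler_nat.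
rewrite mulrDl mul1r addrC lerD2l.
have -> : alpha - 1 = - (1 - alpha) by lra.
rewrite powRN ler_pdivlMr ?powR_gt0// mul1r.
by apply: ler_powRP; rewrite ?(ltW a1) ?(ltW s0).
Qed.

(** On such a cell the second derivative is of order [y^(alpha - 2)] with [y >= (m + 1) step / 2],
    whence the factor [2^(2 - alpha)]. Multiplying by the length of the cell leaves
    [step^(alpha - 1) (m + 1)^(alpha - 2)], and the exponent of [m + 1] is weakened to
    [- sigma - 1]. *)
Lemma oscillation1 N m s s' : (0 < N)%N -> (0 < m < 2 * N)%N ->
  m%:R * step tau N < s < m.+1%:R * step tau N ->
  m%:R * step tau N < s' < m.+1%:R * step tau N ->
  `|derive1 v s - derive1 v s'| <=
    C * (1 + tau `^ (2 - alpha)) * 2 `^ (2 - alpha) *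
    (step tau N `^ (alpha - 1) * m.+1%:R `^ (- sigma - 1)).
Proof.
move=> N0 /andP[m0 mN]; wlog ss : s s' / s' <= s.
  move=> h sk sk'; have [ss|/ltW ss] := leP s' s; first exact: h.
  by rewrite distrC; exact: h.
have mKN : (m < 2 * K * N)%N.
  by apply: (leq_trans mN); rewrite mulnAC leq_pmulr.
have m1R : m.+1%:R = m%:R + 1 :> R by rewrite natr1.
have mR : 1 <= m%:R :> R by rewrite ler1n.
have r0 := step_gt0 tau0 N0; have tauE := mul_step tau N0.
have cellN := @cell N m ^~ N0; move: cellN.
set r := step tau N in r0 tauE *; clearbody r => cellN sk sk'.
pose B := C * (1 + tau `^ (2 - alpha)) * 2 `^ (2 - alpha) * (r `^ (alpha - 2) * m.+1%:R `^ (alpha - 2)).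
have C0 := regular_const_ge0.
have D y : m%:R * r < y < m.+1%:R * r ->
    is_derive y 1 (derive1 v) (derive1n 2 v y) /\ `|derive1n 2 v y| <= B.
  move=> yk; have [j [j1 jy jN _]] := cellN _ mKN yk.
  have [_ /(_ j y j1 jy)[_ dd _ /(_ _)b _]] := vreg.
  split.
    by rewrite derive1nS derive1n1 derive1E; exact: derivableP.
  have {}b := b (jN mN).
  apply: (le_trans b); rewrite /B -!mulrA ler_wpM2l//.
  have yk2 : m.+1%:R * r / 2 <= y.
    case/andP: yk => /ltW yk _; apply: le_trans yk.
    by rewrite m1R; nra.
  have y0 : 0 < y by apply: lt_le_trans yk2; rewrite divr_gt0// mulr_gt0// ltr0n.
  have ytau : y <= tau.
    case/andP: yk => _ /ltW /le_trans; apply.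
    by rewrite -tauE ler_pM2r// ler_nat.
  apply: (@le_trans _ _ ((1 + tau `^ (2 - alpha)) * y `^ (alpha - 2))).
    rewrite mulrDl mul1r addrC lerD2l.
    have -> : alpha - 2 = - (2 - alpha) by lra.
    rewrite powRN ler_pdivlMr ?powR_gt0// mul1r.
    by apply: ler_powRP; rewrite ?(ltW y0)//; move: a1; lra.
  rewrite ler_wpM2l ?addr_ge0 ?powR_ge0//.
  have -> : 2 `^ (2 - alpha) * (r `^ (alpha - 2) * m.+1%:R `^ (alpha - 2)) = (m.+1%:R * r / 2) `^ (alpha - 2).
    rewrite !powRM ?invr_ge0 ?mulr_ge0 ?(ltW r0) ?ler0n//.
    have -> : 2^-1 `^ (alpha - 2) = 2 `^ (2 - alpha) :> R.
      have -> : alpha - 2 = - (2 - alpha) by lra.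
      by rewrite -(@powR_inv1 _ 2)// -powRrM mulN1r opprK.
    ring.
  apply: ler_powRN => //; first by move: a1; lra.
  by rewrite divr_gt0// mulr_gt0// ltr0n.
have B0 : 0 <= B by rewrite !mulr_ge0 ?powR_ge0 ?addr_ge0 ?powR_ge0.
have {}D1 y := fun h => (D y h).1; have {}D2 y := fun h => (D y h).2.
case/andP: sk => s1 s2; case/andP: sk' => s1' s2'.
have DB y : m%:R * r < y < m.+1%:R * r -> is_derive y 1 (fun y : R => B * y) B.
  move=> _; apply: (is_derive_eq (is_deriveZ B (is_derive_id y 1))).
  by rewrite /GRing.scale/= mulr1.
have := MVT_dominated D1 DB D2 s1' ss s2.
move=> /le_trans; apply; rewrite -mulrBr.
apply: (@le_trans _ _ (B * r)).
  by rewrite ler_wpM2l//; move: s1' s2; rewrite m1R mulrDl mul1r; lra.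
rewrite /B -!mulrA; do 3 (apply: ler_wpM2l; rewrite ?powR_ge0 ?addr_ge0 ?powR_ge0//).
rewrite [_ * r]mulrC mulrA.
have -> : r `^ (alpha - 2) * r = r `^ (alpha - 1).
  rewrite -{2}[r]powRr1 ?(ltW r0)// -powRD; last by rewrite (gt_eqF r0) implybT.
  by have -> : alpha - 2 + 1 = alpha - 1 by lra.
apply: ler_wpM2l; first exact: powR_ge0.
apply: ler_powR; first by rewrite ler1n.
have : sigma <= 1 - alpha by rewrite ge_min lexx orbT.
lra.
Qed.

(** The singularity of the second derivative at [tau] is integrable: the primitive [Phi] of its
    bound has increments of order [step^alpha] over a cell, even the one that starts at [tau]. *)
Lemma oscillation2 N m s s' : (0 < N)%N -> (2 * N <= m < 2 * K * N)%N ->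
  m%:R * step tau N < s < m.+1%:R * step tau N ->
  m%:R * step tau N < s' < m.+1%:R * step tau N ->
  `|derive1 v s - derive1 v s'| <=
    C * (T `^ (1 - alpha) + alpha^-1) * step tau N `^ alpha.
Proof.
move=> N0 /andP[Nm mKN]; wlog ss : s s' / s' <= s.
  move=> h sk sk'; have [ss|/ltW ss] := leP s' s; first exact: h.
  by rewrite distrC; exact: h.
have m1R : m.+1%:R = m%:R + 1 :> R by rewrite natr1.
have rT : step tau N <= T.
  by apply: (le_trans (step_le tau0 N0)); rewrite ler_peMl ?ler1n ?(ltW tau0).
have r0 := step_gt0 tau0 N0.
have cellN := @cell N m ^~ N0; move: cellN.
set r := step tau N in rT r0 *; clearbody r => cellN sk sk'.
have C0 := regular_const_ge0.
have D y : m%:R * r < y < m.+1%:R * r -> [/\ is_derive y 1 (derive1 v) (derive1n 2 v y),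
    `|derive1n 2 v y| <= C * (1 + (y - tau) `^ (alpha - 1)) & tau < y].
  move=> yk; have [j [j1 jy _ jN]] := cellN _ mKN yk.
  have [_ /(_ j y j1 jy)[_ dd _ _ /(_ (jN Nm)) b]] := vreg.
  split; [by rewrite derive1nS derive1n1 derive1E; exact: derivableP|exact: b|].
  case/andP: jy => jy _; apply: le_lt_trans jy.
  rewrite -[leLHS]mul1r ler_pM2r//.
  by have := jN Nm; rewrite -(ler_nat R); lra.
have D1 y yk := let: And3 h _ _ := D y yk in h.
have D2 y yk := let: And3 _ h _ := D y yk in h.
have D3 y yk := let: And3 _ _ h := D y yk in h.
pose Phi y := C * (y + (y - tau) `^ alpha / alpha).
have DPhi y : m%:R * r < y < m.+1%:R * r ->
    is_derive y 1 Phi (C * (1 + (y - tau) `^ (alpha - 1))).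
  move=> /D3 ytau; have ty : 0 < y - tau by rewrite subr_gt0.
  have h1 := @is_derive1_comp R (fun z => z `^ alpha) (fun z => z - tau) y _ _
    (is_derive1_powR alpha ty) (is_deriveB (is_derive_id y 1) (is_derive_cst tau y 1)).
  have h2 := is_deriveZ C (is_deriveD (is_derive_id y 1) (is_deriveZ alpha^-1 h1)).
  have -> : Phi = C \*: (id \+ alpha^-1 \*: ((fun z => z `^ alpha) \o (fun z => z - tau))).
    by apply/funext => z; rewrite /Phi /= /GRing.scale/= [_ / alpha]mulrC.
  apply: (is_derive_eq h2); rewrite /GRing.scale/= subr0 mulr1 mulrA mulVf ?mul1r//.
  by rewrite gt_eqF.
have [/andP[s1 s2] /andP[s1' s2']] := (sk, sk').
have := MVT_dominated D1 DPhi D2 s1' ss s2.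
move=> /le_trans; apply; rewrite /Phi -mulrBr -mulrA ler_wpM2l//.
have ssr : s - s' <= r by move: s1' s2; rewrite m1R mulrDl mul1r; lra.
have rE : r <= T `^ (1 - alpha) * r `^ alpha.
  rewrite -{1}[r]powRr1 ?(ltW r0)//.
  have -> : r `^ 1 = r `^ (1 - alpha) * r `^ alpha.
    by rewrite -powRD ?subrK// gt_eqF ?implybT.
  rewrite ler_wpM2r ?powR_ge0//.
  by apply: ler_powRP; rewrite ?(ltW a1) ?(ltW r0).
have sub : (s - tau) `^ alpha <= (s' - tau) `^ alpha + r `^ alpha.
  have st' := D3 _ sk'; have st := D3 _ sk.
  apply: (@le_trans _ _ (((s' - tau) + (s - s')) `^ alpha)).
    by rewrite (_ : s' - tau + (s - s') = s - tau)//; ring.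
  apply: (le_trans (@powR_subadditive _ _ _ _ _ _ _)).
  - by case/andP: alpha01 => -> /ltW ->.
  - by rewrite subr_ge0 ltW.
  - by rewrite subr_ge0.
  by rewrite lerD2l; apply: ler_powRP; rewrite ?(ltW a0) ?subr_ge0.
have av : 0 <= alpha^-1 by rewrite invr_ge0 ltW.
have := ler_wpM2r av sub; rewrite !mulrDl; lra.
Qed.

Lemma path_within (a b : R) : 0 <= a -> b <= T -> {within `[a, b], continuous v}.
Proof.
move=> a_ge0 bT; case: vreg => + _; apply: continuous_subspaceW => x/=.
by rewrite !in_itv/= => /andP[ax xb]; rewrite (le_trans a_ge0)//= (le_trans xb).
Qed.

Definition const1 := C * (1 + T `^ (1 - alpha)).
Definition const2 := C * (1 + tau `^ (2 - alpha)) * 2 `^ (2 - alpha).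
Definition const3 := C * (T `^ (1 - alpha) + alpha^-1).
(** The three terms serve the first cell, the rest of the first delay interval, and the later delay
    intervals. *)
Definition cell_const := 2 * const1 / alpha + const2 + const3.

Let consts_ge0 : [/\ 0 <= const1, 0 <= const2 & 0 <= const3].
Proof.
have C0 := regular_const_ge0.
by split; rewrite ?mulr_ge0// ?addr_ge0// ?powR_ge0// invr_ge0 ltW.
Qed.

Section Cell.
Variables (N m : nat) (r lo hi D : R).
Hypotheses (N0 : (0 < N)%N) (mKN : (m < 2 * K * N)%N).
Hypotheses (rE : r = step tau N) (loE : lo = m%:R * r) (hiE : hi = m.+1%:R * r).
Hypothesis DE : D = (v hi - v lo) / r.

Let r0 : 0 < r. Proof. by rewrite rE; exact: step_gt0. Qed.
Let lohi : lo < hi. Proof. by rewrite loE hiE ltr_pM2r// ltr_nat. Qed.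
Let lo0 : 0 <= lo. Proof. by rewrite loE mulr_ge0// ltW. Qed.
Let hiT : hi <= T.
Proof.
rewrite hiE -(mul_step tau N0) mulrA -natrM -rE ler_pM2r// ler_nat.
by rewrite mulnA [(K * 2)%N]mulnC.
Qed.
Let width : hi - lo = r. Proof. by rewrite loE hiE -mulrBl -natrB// subSnn mul1r. Qed.

Lemma cell_derivable s : lo < s < hi ->
  is_derive s 1 v (derive1 v s) /\ {for s, continuous (derive1 v)}.
Proof.
rewrite loE hiE rE => /(cell N0 mKN)[j [j1 js _ _]]; have [_ /(_ j s j1 js)[d1 d2 _ _ _]] := vreg.
split; last exact: derivable_continuous.
by rewrite derive1E; exact: derivableP.
Qed.

Lemma cell_derive_bound s : lo < s < hi -> `|derive1 v s| <= const1 * s `^ (alpha - 1).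
Proof.
by rewrite loE hiE rE => /(cell N0 mKN)[j [j1 js _ _]]; apply: derive_bound; exists j.
Qed.

Lemma cell_FTC : mu.-integrable `]lo, hi[ (EFin \o derive1 v) /\
  \int[mu]_(s in `]lo, hi[) derive1 v s = v hi - v lo.
Proof.
have [c1 _ _] := consts_ge0.
have cF : {within `[lo, hi], continuous (fun s : R => const1 / alpha * s `^ alpha)}.
  by move=> x; apply: cvgM; [exact: cvg_cst|exact: within_powR].
have x0 x : lo < x < hi -> 0 < x by move=> /andP[/(le_lt_trans lo0)].
have dF x : lo < x < hi ->
    is_derive x 1 (fun s : R => const1 / alpha * s `^ alpha) (const1 * x `^ (alpha - 1)).
  move=> /x0 xgt0; apply: (is_derive_eq (is_deriveZ (const1 / alpha) (is_derive1_powR alpha xgt0))).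
  by rewrite /GRing.scale/= mulrA divfK// gt_eqF.
have cf x : lo < x < hi -> {for x, continuous (fun s : R => const1 * s `^ (alpha - 1))}.
  by move=> /x0 xgt0; apply: cvgM; [exact: cvg_cst|exact: powR_continuous_pos].
exact: (FTC_oo_dominated lohi (path_within lo0 hiT) cF (fun s h => (cell_derivable h).1) dF
  (fun s h => (cell_derivable h).2) cf cell_derive_bound).
Qed.

(** [D] is the mean of the derivative over the cell; this is the mean zero property that
    [kernel_mean_zero] asks for. *)
Lemma cell_error_integrable : mu.-integrable `]lo, hi[ (EFin \o (fun s => D - derive1 v s)) /\
  \int[mu]_(s in `]lo, hi[) (D - derive1 v s) = 0.
Proof.
have [int1 I1] := cell_FTC.
have int2 : mu.-integrable `]lo, hi[ (EFin \o (fun=> D)).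
  apply: (@measurable_bounded_integrable _ _ _ mu (fun=> D)) => //.
    by rewrite /= lebesgue_measure_itv/= lte_fin lohi -EFinB ltry.
  by exists `|D|; split; [exact: num_real|move=> x /ltW + y _; exact].
split; first exact: (integrableB _ int2 int1).
rewrite RintegralB// I1 Rintegral_cst//= lebesgue_measure_itv/= lte_fin lohi -EFinB /=.
by rewrite width DE divfK ?subrr// gt_eqF.
Qed.

(** [D] is a value of the derivative inside the cell, so the error is at most the oscillation
    there. *)
Lemma cell_error_sup s : (0 < m)%N -> lo < s < hi ->
  `|D - derive1 v s| <= cell_const * (r `^ (alpha - 1) * (m.+1%:R `^ (- sigma - 1) + r)).
Proof.
move=> m0 sc; have [c1 c2 c3] := consts_ge0.
have [||c cc E] := @MVT R v (derive1 v) lo hi lohi.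
- by move=> x; rewrite in_itv/= => /cell_derivable[].
- exact: path_within.
have -> : D = derive1 v c by rewrite DE E width mulfK// gt_eqF.
have {}cc : lo < c < hi by move: cc; rewrite in_itv.
have av : 0 <= alpha^-1 by rewrite invr_ge0 ltW.
have c1a : 0 <= 2 * const1 / alpha by rewrite mulr_ge0// mulr_ge0.
have p1 := powR_ge0 r (alpha - 1); have p2 := powR_ge0 (m.+1%:R : R) (- sigma - 1).
have r0' := ltW r0.
rewrite loE hiE rE in cc sc.
have [mN|mN] := ltnP m (2 * N).
  apply: (le_trans (oscillation1 N0 _ cc sc)); first by rewrite m0.
  rewrite -/const2 -rE; apply: ler_pM => //; first by rewrite mulr_ge0.
    by rewrite /cell_const; lra.
  by rewrite ler_wpM2l// lerDl.
apply: (le_trans (oscillation2 N0 _ cc sc)); first by rewrite mN.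
rewrite -/const3 -rE; apply: ler_pM => //; first exact: powR_ge0.
  by rewrite /cell_const; lra.
have -> : r `^ alpha = r `^ (alpha - 1) * r by rewrite mulrC mulr_powRB1.
by rewrite ler_wpM2l// lerDr.
Qed.

(** On the first cell no uniform bound is available, so [D] and the derivative are bounded
    separately in L1, each by [const1 / alpha] times [step^alpha]. On the other cells the uniform
    bound is multiplied by the length. *)
Lemma cell_error_L1 : \int[mu]_(s in `]lo, hi[) `|D - derive1 v s| <=
  cell_const * (r `^ alpha * (m.+1%:R `^ (- sigma - 1) + r)).
Proof.
have [c1 c2 c3] := consts_ge0; have [inte _] := cell_error_integrable.
have [intv Iv] := cell_FTC.
have r0' := ltW r0.
case: (posnP m) => [m0|m0].
  have lo_0 : lo = 0 by rewrite loE m0 mul0r.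
  have hi_r : hi = r by rewrite hiE m0 mul1r.
  have Iabs : \int[mu]_(s in `]lo, hi[) `|derive1 v s| <= const1 / alpha * r `^ alpha.
    have [ig Ig] := powR_FTC a0 lo0 lohi c1.
    apply: (@le_trans _ _ (\int[mu]_(s in `]lo, hi[) (const1 * s `^ (alpha - 1)))).
      apply: le_Rintegral => //; first exact: integrable_norm.
      by move=> s /=; rewrite in_itv/=; exact: cell_derive_bound.
    by rewrite Ig lo_0 hi_r powR0 ?gt_eqF// mulr0 subr0.
  have Dr : `|D| * r <= const1 / alpha * r `^ alpha.
    rewrite DE normrM normfV (gtr0_norm r0) divfK ?gt_eqF//.
    by apply: le_trans Iabs; rewrite -Iv; exact: le_normr_Rintegral.
  have intD : mu.-integrable `]lo, hi[ (EFin \o (fun=> `|D|)).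
    apply: (@measurable_bounded_integrable _ _ _ mu (fun=> `|D|)) => //.
      by rewrite /= lebesgue_measure_itv/= lte_fin lohi -EFinB ltry.
    by exists `|D|; split; [exact: num_real|move=> x /ltW + y _; rewrite normr_id; exact].
  have intn := integrable_norm intv.
  apply: (@le_trans _ _ (\int[mu]_(s in `]lo, hi[) (`|D| + `|derive1 v s|))).
    apply: le_Rintegral => //; first exact: integrable_norm.
      exact: (integrableD _ intD intn).
    by move=> s _; exact: ler_normB.
  rewrite RintegralD// Rintegral_cst//= lebesgue_measure_itv/= lte_fin lohi -EFinB /= width.
  rewrite m0 powR1 /cell_const.
  have p1 := powR_ge0 r alpha.
  have : 0 <= (const2 + const3) * (r `^ alpha * (1 + r)).
    by rewrite !mulr_ge0 ?addr_ge0.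
  have av : 0 <= alpha^-1 by rewrite invr_ge0 ltW.
  have c1a : 0 <= 2 * const1 / alpha by rewrite mulr_ge0// mulr_ge0.
  have : 0 <= 2 * const1 / alpha * (r `^ alpha * r) by rewrite mulr_ge0// mulr_ge0.
  lra.
apply: (@le_trans _ _ (\int[mu]_(s in `]lo, hi[)
    (cell_const * (r `^ (alpha - 1) * (m.+1%:R `^ (- sigma - 1) + r))))).
  apply: le_Rintegral => //; first exact: integrable_norm.
    apply: (@measurable_bounded_integrable _ _ _ mu (fun=> _)) => //.
      by rewrite /= lebesgue_measure_itv/= lte_fin lohi -EFinB ltry.
    by eexists; split; last (by move=> x /ltW + y _; exact); exact: num_real.
  by move=> s /=; rewrite in_itv/=; exact: cell_error_sup.
rewrite Rintegral_cst//= lebesgue_measure_itv/= lte_fin lohi -EFinB /= width.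
rewrite -(mulr_powRB1 r0' a0) le_eqVlt; apply/orP; left; apply/eqP; ring.
Qed.

End Cell.

(** The kernel is singular at [t], the derivative at 0. On either side of [t / 2] one of the two
    factors is bounded by its value at [t / 2], which gives the dominating sum [g]. The powers of
    [t] cancel in the integral of [g], so the bound for [n = 1] does not depend on the step. *)
Lemma caputo_integrable (t : R) (N n : nat) : (0 < N)%N -> (0 < n <= 2 * K * N)%N ->
  t = n%:R * step tau N ->
  mu.-integrable `]0, t[ (EFin \o (fun s => omega (1 - alpha) (t - s) * derive1 v s)) /\
  (n = 1%N -> \int[mu]_(s in `]0, t[) `|omega (1 - alpha) (t - s) * derive1 v s| <=
    const1 / Gamma (1 - alpha) * (2 `^ alpha / alpha + 2 `^ (1 - alpha) / (1 - alpha))).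
Proof.
move=> N0 /andP[n0 nKN] tE; have [c1 _ _] := consts_ge0.
have r0 := step_gt0 tau0 N0.
have t0 : 0 < t by rewrite tE mulr_gt0// ltr0n.
have G1 := Gamma1B_gt0 alpha01.
have h0 : 0 < t / 2 by rewrite divr_gt0.
pose c := const1 / Gamma (1 - alpha).
have c0 : 0 <= c by rewrite divr_ge0// ltW.
pose g (s : R) := c * (t / 2) `^ (- alpha) * s `^ (alpha - 1) +
  c * (t / 2) `^ (alpha - 1) * Gamma (1 - alpha) * omega (1 - alpha) (t - s).
have xS k : (k < n)%N -> k%:R * step tau N < k.+1%:R * step tau N :> R.
  by move=> _; rewrite ltr_pM2r// ltr_nat.
have gdom (k : nat) (s : R) : (k < n)%N -> k%:R * step tau N < s < k.+1%:R * step tau N ->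
    `|omega (1 - alpha) (t - s) * derive1 v s| <= g s.
  move=> kn sk.
  have vs := cell_derive_bound N0 (leq_trans kn nKN) erefl erefl erefl sk.
  case/andP: sk => s1 s2.
  have s0 : 0 < s by apply: le_lt_trans s1; rewrite mulr_ge0// ltW.
  have st : s < t by rewrite tE (lt_le_trans s2)// ler_pM2r// ler_nat.
  rewrite normrM ger0_norm ?omega_ge0//; last by case/andP: alpha01; lra.
  have ts : 0 < t - s by rewrite subr_gt0.
  have pw : omega (1 - alpha) (t - s) = (t - s) `^ (- alpha) / Gamma (1 - alpha).
    by rewrite /omega; have -> : 1 - alpha - 1 = - alpha by lra.
  apply: (@le_trans _ _ (c * ((t - s) `^ (- alpha) * s `^ (alpha - 1)))).
    apply: (le_trans (ler_wpM2l _ vs)); first by rewrite pw divr_ge0 ?powR_ge0// ltW.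
    by rewrite pw /c le_eqVlt; apply/orP; left; apply/eqP; ring.
  have -> : g s = c * ((t / 2) `^ (- alpha) * s `^ (alpha - 1) +
      (t / 2) `^ (alpha - 1) * (t - s) `^ (- alpha)).
    by rewrite /g pw; field; rewrite gt_eqF.
  rewrite ler_wpM2l//.
  have [ht|ht] := leP s (t / 2).
    rewrite -[leLHS]addr0; apply: lerD; last by rewrite mulr_ge0 ?powR_ge0.
    rewrite ler_wpM2r ?powR_ge0//; apply: ler_powRN => //; first by rewrite oppr_le0 ltW.
    by lra.
  rewrite -[leLHS]add0r; apply: lerD; first by rewrite mulr_ge0 ?powR_ge0.
  rewrite mulrC ler_wpM2r ?powR_ge0//; apply: ler_powRN => //; last exact: ltW.
  by move: a1; lra.
have [i1 I1] := powR_FTC a0 (lexx 0) t0 (mulr_ge0 c0 (powR_ge0 (t / 2) (- alpha))).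
have [i2 I2] := omega_integral alpha01 t0 (lexx t).
have ig : mu.-integrable `]0, t[ (EFin \o g).
  exact: (itvoo_intD i1 (itvoo_intZ _ i2)).
have tcell k : (k < n)%N -> (`]k%:R * step tau N, k.+1%:R * step tau N[ : set R) `<=` (`]0, t[ : set R).
  move=> kn x /=; rewrite !in_itv/= => /andP[x1 x2].
  have x0 : 0 <= k%:R * step tau N by rewrite mulr_ge0// ltW.
  by rewrite (le_lt_trans x0 x1)/= tE (lt_le_trans x2)// ler_pM2r// ler_nat.
have mv k : (k < n)%N -> measurable_fun (`]k%:R * step tau N, k.+1%:R * step tau N[ : set R) (derive1 v).
  move=> kn; apply: open_continuous_measurable_fun => //.
  move=> x; rewrite inE/= in_itv/= => xk.
  by have [] := cell_derivable N0 (leq_trans kn nKN) erefl erefl erefl xk.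
have mw : measurable_fun (`]0, t[ : set R) (fun s => omega (1 - alpha) (t - s)).
  by apply/measurable_EFinP; exact: (measurable_int mu).
have ii : mu.-integrable `]0, t[ (EFin \o (fun s => omega (1 - alpha) (t - s) * derive1 v s)).
  have := @integrable_cells R (fun s => omega (1 - alpha) (t - s) * derive1 v s)
    (fun k => k%:R * step tau N) n xS.
  rewrite mul0r -tE; apply => k kn.
  have igk : mu.-integrable `]k%:R * step tau N, k.+1%:R * step tau N[ (EFin \o g).
    by apply: integrableS ig => //; exact: tcell.
  apply: (le_integrable _ _ _ igk) => //.
    apply/measurable_EFinP; apply: measurable_funM; last exact: mv.
    by apply: measurable_funS mw => //; exact: tcell.
  move=> s /=; rewrite in_itv/= => st; rewrite lee_fin.
  by rewrite (le_trans (gdom k s kn st))// ler_norm.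
split=> // n1.
apply: (@le_trans _ _ (\int[mu]_(s in `]0, t[) g s)).
  apply: le_Rintegral => //; first exact: integrable_norm.
  move=> s /=; rewrite in_itv/= => st; apply: (gdom 0%N) => //.
  by rewrite mul0r; move: st; rewrite tE n1.
rewrite (itvoo_RintD i1 (itvoo_intZ _ i2)) I1 itvoo_RintZ// I2 -/c powR0 ?gt_eqF// mulr0 !subr0 subrr.
rewrite /omega powR0; last by rewrite gt_eqF//; move: a1; lra.
have -> : 2 - alpha - 1 = 1 - alpha by lra.
have h1 : (t / 2) `^ (- alpha) * t `^ alpha = 2 `^ alpha.
  rewrite powRM ?invr_ge0 ?(ltW t0)// mulrAC powRN mulVf ?gt_eqF ?powR_gt0// mul1r.
  by rewrite -(@powR_inv1 _ 2)// -powRrM mulN1r opprK.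
have h2 : (t / 2) `^ (alpha - 1) * t `^ (1 - alpha) = 2 `^ (1 - alpha).
  have -> : alpha - 1 = - (1 - alpha) by lra.
  rewrite powRM ?invr_ge0 ?(ltW t0)// mulrAC powRN mulVf ?gt_eqF ?powR_gt0// mul1r.
  by rewrite -(@powR_inv1 _ 2)// -powRrM mulN1r opprK.
rewrite mul0r subr0 Gamma2B// le_eqVlt; apply/orP; left; apply/eqP.
rewrite -h1 -h2; field.
by rewrite !gt_eqF.
Qed.

(** The cell does not touch the singularity of the kernel, whose variation across it is of order
    [step^(-alpha) j^(-alpha - 1)] with [j = n - k.+1]. The powers of the step cancel against those
    of [cell_error_L1]. *)
Lemma cell_far (N k n : nat) (r t lo hi D : R) : (0 < N)%N -> (k.+1 < n <= 2 * K * N)%N ->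
  r = step tau N -> t = n%:R * r -> lo = k%:R * r -> hi = k.+1%:R * r -> D = (v hi - v lo) / r ->
  `|\int[mu]_(s in `]lo, hi[) (omega (1 - alpha) (t - s) * (D - derive1 v s))| <=
  alpha / Gamma (1 - alpha) * cell_const *
    ((n - k.+1)%:R `^ (- sigma - 1) * (k.+1%:R `^ (- sigma - 1) + r)).
Proof.
move=> N0 /andP[kn nKN] rE tE loE hiE DE.
have r0 : 0 < r by rewrite rE step_gt0.
have G1 := Gamma1B_gt0 alpha01.
have kKN : (k < 2 * K * N)%N by apply: leq_trans nKN; exact: ltnW.
have lohi : lo < hi by rewrite loE hiE ltr_pM2r// ltr_nat.
have hit : hi < t by rewrite tE hiE ltr_pM2r// ltr_nat.
have [inte e0] := cell_error_integrable N0 kKN rE loE hiE DE.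
have L1 := cell_error_L1 N0 kKN rE loE hiE DE.
have [c1 c2 c3] := consts_ge0.
have pw s : omega (1 - alpha) s = s `^ (- alpha) / Gamma (1 - alpha).
  by rewrite /omega; have -> : 1 - alpha - 1 = - alpha by lra.
have [iw _] := omega_integral alpha01 lohi (ltW hit).
have wmono s : lo < s < hi -> omega (1 - alpha) (t - lo) <= omega (1 - alpha) (t - s) <= omega (1 - alpha) (t - hi).
  move=> /andP[s1 s2]; rewrite !pw !ler_pM2r ?invr_gt0//.
  have na : - alpha <= 0 by rewrite oppr_le0 ltW.
  by apply/andP; split; apply: ler_powRN => //; move: hit s1 s2; lra.
have mw : measurable_fun (`]lo, hi[ : set R) (fun s => omega (1 - alpha) (t - s)).
  by apply/measurable_EFinP; exact: (measurable_int mu).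
have := kernel_mean_zero wmono mw inte e0.
move=> /le_trans; apply.
set j := (n - k.+1)%N.
have j0 : (0 < j)%N by rewrite subn_gt0.
have jR : 1 <= j%:R :> R by rewrite ler1n.
have e1 : t - hi = j%:R * r by rewrite tE hiE -mulrBl -natrB// ltnW.
have e2 : t - lo = j.+1%:R * r.
  by rewrite /j subnSK ?(ltnW kn)// tE loE -mulrBl -natrB// ltnW// ltnW.
have wd : omega (1 - alpha) (t - hi) - omega (1 - alpha) (t - lo) <=
    alpha / Gamma (1 - alpha) * (r `^ (- alpha) * j%:R `^ (- sigma - 1)).
  rewrite e1 e2 !pw -mulrBl !powRM ?ler0n ?(ltW r0)// -mulrBl.
  have -> : alpha / Gamma (1 - alpha) * (r `^ (- alpha) * j%:R `^ (- sigma - 1)) =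
     alpha * j%:R `^ (- sigma - 1) * r `^ (- alpha) / Gamma (1 - alpha) by ring.
  rewrite ler_pM2r ?invr_gt0// ler_wpM2r ?powR_ge0//.
  apply: (le_trans (powR_nat_diffN_le a0 j0)); rewrite ler_wpM2l ?(ltW a0)//.
  apply: ler_powR => //.
  have : sigma <= alpha by rewrite ge_min lexx.
  lra.
have I0 : 0 <= \int[mu]_(s in `]lo, hi[) `|D - derive1 v s| by apply: Rintegral_ge0.
apply: (le_trans (ler_wpM2r I0 wd)).
apply: (@le_trans _ _ (alpha / Gamma (1 - alpha) * (r `^ (- alpha) * j%:R `^ (- sigma - 1)) *
   (cell_const * (r `^ alpha * (k.+1%:R `^ (- sigma - 1) + r))))).
  by rewrite ler_wpM2l// !mulr_ge0 ?powR_ge0 ?invr_ge0 ?(ltW a0) ?(ltW G1).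
have h : r `^ (- alpha) * r `^ alpha = 1.
  by rewrite powRN mulVf// gt_eqF// powR_gt0.
rewrite le_eqVlt; apply/orP; left; apply/eqP; rewrite -[RHS]mul1r -h; ring.
Qed.

(** On the last cell the kernel is unbounded, so its integral is paired with the supremum of the
    error. For [n = 1] both singularities sit on this cell, and the contributions of [D] and of the
    derivative are bounded separately. *)
Lemma cell_near (N n : nat) (r t lo D : R) : (0 < N)%N -> (0 < n <= 2 * K * N)%N ->
  r = step tau N -> t = n%:R * r -> lo = n.-1%:R * r -> D = (v t - v lo) / r ->
  `|\int[mu]_(s in `]lo, t[) (omega (1 - alpha) (t - s) * (D - derive1 v s))| <=
  (cell_const / Gamma (2 - alpha) +
   const1 / alpha / Gamma (2 - alpha) +
   const1 / Gamma (1 - alpha) * (2 `^ alpha / alpha + 2 `^ (1 - alpha) / (1 - alpha))) *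
  (n%:R `^ (- sigma - 1) + r).
Proof.
move=> N0 /andP[n0 nKN] rE tE loE DE.
have r0 : 0 < r by rewrite rE step_gt0.
have G1 := Gamma1B_gt0 alpha01; have G2 := Gamma2B_gt0 alpha01.
have [c1 c2 c3] := consts_ge0.
have av : 0 <= alpha^-1 by rewrite invr_ge0 ltW.
have av1 : 0 <= (1 - alpha)^-1 by rewrite invr_ge0 ltW.
have cc0 : 0 <= cell_const by rewrite /cell_const; nonneg.
have G1v : 0 <= (Gamma (1 - alpha))^-1 by rewrite invr_ge0 ltW.
have G2v : 0 <= (Gamma (2 - alpha))^-1 by rewrite invr_ge0 ltW.
have k1 : 0 <= cell_const / Gamma (2 - alpha) by rewrite mulr_ge0.
have k2 : 0 <= const1 / alpha / Gamma (2 - alpha) by nonneg.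
have k3 : 0 <= const1 / Gamma (1 - alpha) * (2 `^ alpha / alpha + 2 `^ (1 - alpha) / (1 - alpha)).
  by nonneg.
have nE : n = n.-1.+1 by rewrite prednK.
have tE' : t = n.-1.+1%:R * r by rewrite prednK.
have mKN : (n.-1 < 2 * K * N)%N by rewrite prednK.
have lot : lo < t by rewrite tE loE ltr_pM2r// ltr_nat prednK.
have lo_ge0 : 0 <= lo by rewrite loE mulr_ge0// ltW.
have [inte e0] := cell_error_integrable N0 mKN rE loE tE' DE.
have [iw Iw] := omega_integral alpha01 lot (lexx t).
have w0 s : 0 <= omega (1 - alpha) s.
  by apply: omega_ge0; rewrite a1/= lerBlDr lerDl ltW.
have rw : r `^ (1 - alpha) = omega (2 - alpha) r * Gamma (2 - alpha).
  by rewrite /omega divfK ?gt_eqF// (_ : 2 - alpha - 1 = 1 - alpha)//; ring.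
have IwE : \int[mu]_(s in `]lo, t[) omega (1 - alpha) (t - s) = r `^ (1 - alpha) / Gamma (2 - alpha).
  have tlo : t - lo = r.
    by rewrite tE' loE -mulrBl -natrB// subSnn mul1r.
  rewrite Iw tlo subrr rw mulfK ?gt_eqF// /omega (_ : 2 - alpha - 1 = 1 - alpha); last by ring.
  by rewrite (powR0 (lt0r_neq0 a1)) mul0r subr0.
have nr0 : 0 <= n%:R `^ (- sigma - 1) + r by rewrite addr_ge0 ?powR_ge0// ltW.
case: (posnP n.-1) => [n1|n1].
  have nn1 : n = 1%N by rewrite nE n1.
  have lo0 : lo = 0 by rewrite loE n1 mul0r.
  have nlo : (0 < n <= 2 * K * N)%N by rewrite n0.
  have tEs : t = n%:R * step tau N by rewrite -rE.
  have [ic Ic] := caputo_integrable N0 nlo tEs.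
  have {}Ic := Ic nn1.
  have tr : t = r by rewrite tE nn1 mul1r.
  rewrite lo0 in inte iw IwE DE lot loE *.
  have [intv Iv] := cell_FTC N0 mKN rE loE tE'.
  have Dr : `|D| * r <= const1 / alpha * r `^ alpha.
    rewrite DE normrM normfV (gtr0_norm r0) divfK ?gt_eqF//.
    rewrite -Iv; apply: (le_trans (itvoo_Rint_norm intv)).
    have [ig Ig] := powR_FTC a0 (lexx 0) lot c1.
    apply: (@le_trans _ _ (\int[mu]_(s in `]0, t[) (const1 * s `^ (alpha - 1)))).
      apply: itvoo_Rint_le => //; first exact: itvoo_int_norm.
      exact: (cell_derive_bound N0 mKN rE loE tE').
    by rewrite Ig tr powR0 ?gt_eqF// mulr0 subr0.
  have -> : \int[mu]_(s in `]0, t[) (omega (1 - alpha) (t - s) * (D - derive1 v s)) =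
     D * \int[mu]_(s in `]0, t[) omega (1 - alpha) (t - s) -
     \int[mu]_(s in `]0, t[) (omega (1 - alpha) (t - s) * derive1 v s).
    rewrite -itvoo_RintZ// -itvoo_RintB//; last exact: itvoo_intZ.
    by apply: itvoo_Rint_eq => s _; ring.
  have h1 : `|D * \int[mu]_(s in `]0, t[) omega (1 - alpha) (t - s)| <= const1 / alpha / Gamma (2 - alpha).
    rewrite IwE normrM (@ger0_norm _ (_ / _)); last by rewrite divr_ge0 ?powR_ge0// ltW.
    have -> : `|D| * (r `^ (1 - alpha) / Gamma (2 - alpha)) =
       (`|D| * r) * r `^ (- alpha) / Gamma (2 - alpha).
      rewrite -[in LHS](mulr_powRB1 (ltW r0) a1).
      have -> : 1 - alpha - 1 = - alpha by ring.
      by rewrite !mulrA.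
    rewrite ler_wpM2r//; apply: (le_trans (ler_wpM2r (powR_ge0 _ _) Dr)).
    have rr : r `^ alpha * r `^ (- alpha) = 1.
      by rewrite powRN mulfV// gt_eqF// powR_gt0.
    by rewrite -(mulrA (const1 / alpha)) rr mulr1.
  apply: (le_trans (ler_normB _ _)).
  have h2 := itvoo_Rint_norm ic.
  rewrite nn1 powR1.
  have := le_trans (lerD h1 (le_trans h2 Ic)) _; apply.
  set A := cell_const / _ in k1 *; set B := const1 / alpha / _ in k2 *; set E := _ * (_ + _) in k3 *.
  apply: (@le_trans _ _ (A + B + E)); first by rewrite -addrA lerDr.
  by rewrite mulrDr mulr1 lerDl mulr_ge0 ?addr_ge0// ltW.
have sup s := @cell_error_sup _ _ r lo t D N0 mKN rE loE tE' DE s n1.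
rewrite -nE in sup.
have iwe : mu.-integrable `]lo, t[ (EFin \o (fun s => omega (1 - alpha) (t - s) * (D - derive1 v s))).
  have := @itvoo_intM R (fun s => D - derive1 v s) (fun s => omega (1 - alpha) (t - s))
    _ lo t (itvoo_int_measurable inte) sup iw.
  by apply: itvoo_int_eq => s _; rewrite mulrC.
apply: (le_trans (itvoo_Rint_norm iwe)).
apply: (@le_trans _ _ (\int[mu]_(s in `]lo, t[)
   (cell_const * (r `^ (alpha - 1) * (n%:R `^ (- sigma - 1) + r)) * omega (1 - alpha) (t - s)))).
  apply: itvoo_Rint_le; [exact: itvoo_int_norm|exact: itvoo_intZ|].
  by move=> s st; rewrite normrM (ger0_norm (w0 _)) mulrC; apply: ler_wpM2r; [exact: w0|exact: sup].
rewrite itvoo_RintZ// IwE.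
have h : r `^ (alpha - 1) * r `^ (1 - alpha) = 1.
  by rewrite -opprB powRN mulVf// gt_eqF// powR_gt0.
apply: (@le_trans _ _ (cell_const / Gamma (2 - alpha) * (n%:R `^ (- sigma - 1) + r))).
  rewrite le_eqVlt; apply/orP; left; apply/eqP.
  transitivity (cell_const / Gamma (2 - alpha) * (n%:R `^ (- sigma - 1) + r) *
    (r `^ (alpha - 1) * r `^ (1 - alpha))); first by ring.
  by rewrite h mulr1.
by apply: ler_wpM2r => //; rewrite -(addrA (cell_const / _)) lerDl addr_ge0.
Qed.

(** First the last cell, then the far cells: the convolution of two powers of exponent
    [- sigma - 1], and one such power summed against the step. The unsimplified [1 + sigma - 1] is
    the form produced by [powR_conv_le]. *)
Definition truncation_const :=
  (cell_const / Gamma (2 - alpha) +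
   const1 / alpha / Gamma (2 - alpha) +
   const1 / Gamma (1 - alpha) * (2 `^ alpha / alpha + 2 `^ (1 - alpha) / (1 - alpha))) +
  alpha / Gamma (1 - alpha) * cell_const *
   (2 * 2 `^ (1 + sigma) * (1 + (1 + sigma - 1)^-1) + (1 + sigma^-1)).

Lemma truncation_const_ge0 : 0 <= truncation_const.
Proof.
have G1 := Gamma1B_gt0 alpha01; have G2 := Gamma2B_gt0 alpha01.
have [c1 c2 c3] := consts_ge0.
have av : 0 <= alpha^-1 by rewrite invr_ge0 ltW.
have av1 : 0 <= (1 - alpha)^-1 by rewrite invr_ge0 ltW.
have sv : 0 <= sigma^-1 by rewrite invr_ge0 ltW.
have cc0 : 0 <= cell_const by rewrite /cell_const; nonneg.
have G1v : 0 <= (Gamma (1 - alpha))^-1 by rewrite invr_ge0 ltW.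
have G2v : 0 <= (Gamma (2 - alpha))^-1 by rewrite invr_ge0 ltW.
rewrite /truncation_const (_ : 1 + sigma - 1 = sigma); last by ring.
have a0' := ltW a0; nonneg.
Qed.

(** The L1 sum and the Caputo integral are cut along the same cells, on each of which they differ by
    the integral of the kernel against the cell error. The far cells then form a discrete
    convolution. *)
Lemma truncation (N n : nat) : (0 < N)%N -> (0 < n <= 2 * K * N)%N ->
  `|\sum_(1 <= k < n.+1) L1coef alpha tau N n k * (v (tm tau N k) - v (tm tau N (k%:Z - 1)))
     - caputo alpha v (tm tau N n)|
  <= truncation_const * (n%:R `^ (- sigma - 1) + step tau N).
Proof.
move=> N0 /andP[n0 nKN].
pose r := step tau N; pose x k := k%:R * r; pose t := x n.
have r0 : 0 < r by exact: step_gt0.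
have xS k : x k < x k.+1 by rewrite /x ltr_pM2r// ltr_nat.
have tmE (k : nat) : tm tau N k = x k by [].
have tmE1 (k : nat) : tm tau N (k.+1%:Z - 1) = x k.
  by rewrite /tm /x -/r (_ : k.+1%:Z - 1 = k%:Z)// -addn1 PoszD addrK.
pose D k := (v (x k.+1) - v (x k)) / r.
pose E k := \int[mu]_(s in `]x k, x k.+1[) (omega (1 - alpha) (t - s) * (D k - derive1 v s)).
have nKN' : (0 < n <= 2 * K * N)%N by rewrite n0.
have [ic _] := @caputo_integrable t N n N0 nKN' erefl.
have x0 : x 0%N = 0 by rewrite /x mul0r.
have EE k : (k < n)%N -> L1coef alpha tau N n k.+1 * (v (x k.+1) - v (x k)) -
   \int[mu]_(s in `]x k, x k.+1[) (omega (1 - alpha) (t - s) * derive1 v s) = E k.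
  move=> kn.
  have xkt : x k.+1 <= t by rewrite /t /x ler_pM2r// ler_nat.
  have xk0 : 0 <= x k by rewrite mulr_ge0// ltW.
  have [iw _] := omega_integral alpha01 (xS k) xkt.
  have -> : L1coef alpha tau N n k.+1 * (v (x k.+1) - v (x k)) =
     D k * \int[mu]_(s in `]x k, x k.+1[) omega (1 - alpha) (t - s).
    have := @L1coef_integral R alpha alpha01 tau N n k.+1 tau0 N0 kn.
    rewrite tmE1 !tmE -/t -/r => <-.
    by rewrite /D; field; rewrite gt_eqF.
  have icc : mu.-integrable `]x k, x k.+1[ (EFin \o (fun s => omega (1 - alpha) (t - s) * derive1 v s)).
    exact: itvoo_intS ic.
  rewrite -itvoo_RintZ// -itvoo_RintB//; last exact: itvoo_intZ.
  by apply: itvoo_Rint_eq => s _; ring.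
have -> : \sum_(1 <= k < n.+1) L1coef alpha tau N n k * (v (tm tau N k) - v (tm tau N (k%:Z - 1)))
     - caputo alpha v (tm tau N n) = \sum_(0 <= k < n) E k.
  have := @Rintegral_cells R (fun s => omega (1 - alpha) (t - s) * derive1 v s) x n (fun k _ => xS k).
  rewrite x0 -/t => /(_ ic) cE.
  rewrite /caputo tmE -/t cE big_add1/= -sumrB.
  apply: eq_big_nat => k /andP[_ kn].
  by rewrite tmE1 tmE EE.
clear EE ic; case: n n0 nKN nKN' @t @E => // n _ nKN nKN' t E.
rewrite big_nat_recr//=.
apply: (le_trans (ler_normD _ _)).
have Elast := @cell_near N n.+1 r t (x n) (D n) N0 nKN' erefl erefl erefl erefl.
have far k : (0 <= k < n)%N -> `|E k| <= alpha / Gamma (1 - alpha) * cell_const *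
    ((n.+1 - k.+1)%:R `^ (- sigma - 1) * (k.+1%:R `^ (- sigma - 1) + r)).
  move=> /andP[_ kn]; apply: (@cell_far N k n.+1 r t _ _ _ N0 _ erefl erefl erefl erefl erefl).
  by rewrite nKN andbT.
have sum : `|\sum_(0 <= k < n) E k| <= \sum_(0 <= k < n) (alpha / Gamma (1 - alpha) * cell_const *
    ((n.+1 - k.+1)%:R `^ (- sigma - 1) * (k.+1%:R `^ (- sigma - 1) + r))).
  apply: (le_trans (ler_norm_sum _ _ _)).
  rewrite big_nat_cond [leRHS]big_nat_cond; apply: ler_sum => k /[!andbT].
  exact: far.
rewrite addrC /truncation_const mulrDl.
apply: lerD; first exact: Elast.
apply: (le_trans sum); rewrite -mulr_sumr -[leRHS]mulrA.
have G1 := Gamma1B_gt0 alpha01.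
have [c1 c2 c3] := consts_ge0.
have av : 0 <= alpha^-1 by rewrite invr_ge0 ltW.
have cc0 : 0 <= cell_const by rewrite /cell_const; nonneg.
apply: ler_wpM2l; first by apply: mulr_ge0 => //; rewrite divr_ge0 ?(ltW a0) ?(ltW G1).
under eq_bigr do rewrite mulrDr.
rewrite big_split/=.
have sE : - sigma - 1 = - (1 + sigma) by lra.
have P0 : 0 <= n.+1%:R `^ (- sigma - 1) :> R by exact: powR_ge0.
have s1 : \sum_(0 <= k < n) (n.+1 - k.+1)%:R `^ (- sigma - 1) * k.+1%:R `^ (- sigma - 1) <=
    2 * 2 `^ (1 + sigma) * (1 + (1 + sigma - 1)^-1) * n.+1%:R `^ (- sigma - 1) :> R.
  have := @powR_conv_le R (1 + sigma) (1 + sigma) n.+1.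
  rewrite big_add1/= -sE; apply; first by rewrite ltrDl.
  by rewrite lexx andbT addr_ge0// ltW.
have s2 : \sum_(0 <= k < n) (n.+1 - k.+1)%:R `^ (- sigma - 1) * r <= (1 + sigma^-1) * r.
  rewrite -mulr_suml ler_wpM2r ?(ltW r0)//.
  rewrite big_nat_rev/= add0n.
  apply: le_trans (@powR_nat_sumN_le R sigma n sigma_gt0).
  rewrite big_add1/= le_eqVlt; apply/orP; left; apply/eqP.
  apply: eq_big_nat => k /andP[_ kn]; congr (_%:R `^ _).
  by rewrite subSS subKn.
have c10 : 0 <= 2 * 2 `^ (1 + sigma) * (1 + (1 + sigma - 1)^-1) :> R.
  rewrite (_ : 1 + sigma - 1 = sigma); last by ring.
  have sv : 0 <= sigma^-1 by rewrite invr_ge0 ltW.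
  by nonneg.
have c20 : 0 <= 1 + sigma^-1 :> R by rewrite addr_ge0// invr_ge0 ltW.
set c10' := 2 * _ * _ in c10 s1 *; set c20' := 1 + sigma^-1 in c20 s2 *.
have := mulr_ge0 c10 (ltW r0); have := mulr_ge0 c20 P0.
by move: s1 s2; rewrite -/r; set S1 := \sum_(0 <= k < n) _; set S2 := \sum_(0 <= k < n) _; lra.
Qed.

End FixedPath.
End Truncation.

(** * Quadrature of the delay term *)

Section Quadrature.
Context {R : realType}.
Local Notation mu := (@lebesgue_measure R).

Lemma within_bounded (g : R -> R) (a b : R) : {within `[a, b], continuous g} ->
  exists c, forall x, a <= x <= b -> `|g x| <= c.
Proof.
move=> cg; have [ab|ba] := leP a b; last first.
  by exists 0 => x /andP[ax xb]; have := le_trans ax xb; rewrite leNgt ba.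
have cn : {within `[a, b], continuous (fun x => `|g x|)}.
  by move=> x; apply: cvg_norm; exact: cg.
by have [c _ cmax] := EVT_max ab cn; exists `|g c| => x xab; apply: cmax; rewrite in_itv.
Qed.

Variable alpha : R.
Hypothesis alpha01 : 0 < alpha < 1.

Let alpha_gt0 : 0 < 1 - alpha. Proof. by case/andP: alpha01; lra. Qed.

Lemma frac_int_integrable (g : R -> R) (t : R) : 0 < t -> {within `[0, t], continuous g} ->
  mu.-integrable `]0, t[ (EFin \o (fun s => omega (1 - alpha) (t - s) * g s)).
Proof.
move=> t0 cg; have [c gc] := within_bounded cg.
have [iw _] := omega_integral alpha01 t0 (lexx t).
have ig := itvoo_int_within cg.
apply: (itvoo_int_eq (fun s _ => mulrC (g s) _)).
apply: (itvoo_intM (itvoo_int_measurable ig) _ iw) => s /andP[s0 st].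
by apply: gc; rewrite !ltW.
Qed.

(** The coefficients are kept in the bound because the complementary kernel will later turn the
    weighted sum of the [V k] into a plain sum. *)
Lemma frac_int_quadrature (tau : R) (N n : nat) (g : R -> R) (V : nat -> R) :
  0 < tau -> (0 < N)%N -> (0 < n)%N ->
  {within `[0, tm tau N n], continuous g} ->
  (forall (k : nat) (s : R), (0 < k <= n)%N -> tm tau N (k%:Z - 1) < s < tm tau N k ->
     `|g s - g (tm tau N k)| <= V k) ->
  `|frac_int (1 - alpha) g (tm tau N n) -
    \sum_(1 <= k < n.+1) step tau N * L1coef alpha tau N n k * g (tm tau N k)| <=
  \sum_(1 <= k < n.+1) step tau N * L1coef alpha tau N n k * V k.
Proof.
move=> tau0 N0 n0 cg gV.
pose r := step tau N; pose x k := k%:R * r; pose t := x n.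
have r0 : 0 < r by exact: step_gt0.
have xS k : x k < x k.+1 by rewrite /x ltr_pM2r// ltr_nat.
have tmE (k : nat) : tm tau N k = x k by [].
have tmE1 (k : nat) : tm tau N (k.+1%:Z - 1) = x k.
  by rewrite /tm /x -/r (_ : k.+1%:Z - 1 = k%:Z)// -addn1 PoszD addrK.
have x0 : x 0%N = 0 by rewrite /x mul0r.
have t0 : 0 < t by rewrite mulr_gt0// ltr0n.
rewrite tmE -/t in cg *.
have ig := frac_int_integrable t0 cg.
have := @Rintegral_cells R (fun s => omega (1 - alpha) (t - s) * g s) x n (fun k _ => xS k).
rewrite x0 -/t => /(_ ig) cE.
rewrite /frac_int cE !big_add1/= -sumrB.
apply: (le_trans (ler_norm_sum _ _ _)).
apply: ler_sum_nat => k /= kn.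
have xkt : x k.+1 <= t by rewrite /t /x ler_pM2r// ler_nat.
have xk0 : 0 <= x k by rewrite mulr_ge0// ltW.
have [iw _] := omega_integral alpha01 (xS k) xkt.
have w0 s : 0 <= omega (1 - alpha) s.
  by apply: omega_ge0; rewrite alpha_gt0/= lerBlDr lerDl ltW//; case/andP: alpha01.
have igk : mu.-integrable `]x k, x k.+1[ (EFin \o (fun s => omega (1 - alpha) (t - s) * g s)).
  exact: itvoo_intS ig.
have -> : step tau N * L1coef alpha tau N n k.+1 = \int[mu]_(s in `]x k, x k.+1[) omega (1 - alpha) (t - s).
  by rewrite L1coef_integral// tmE1.
have iwc c : mu.-integrable `]x k, x k.+1[ (EFin \o (fun s => c * omega (1 - alpha) (t - s))).
  exact: itvoo_intZ.
rewrite ![\int[mu]_(s in _) omega _ _ * _]mulrC -!itvoo_RintZ// -itvoo_RintB//.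
have id : mu.-integrable `]x k, x k.+1[ (EFin \o (fun s =>
    omega (1 - alpha) (t - s) * g s - g (tm tau N k.+1) * omega (1 - alpha) (t - s))).
  exact: itvoo_intB.
apply: (le_trans (itvoo_Rint_norm id)); apply: itvoo_Rint_le => //; first exact: itvoo_int_norm.
move=> s sk; rewrite mulrC -mulrBl normrM (ger0_norm (w0 _)) ler_wpM2r//.
by apply: gV; rewrite ?kn// tmE1.
Qed.

(** Compactness of the time interval makes continuity in [x] uniform in [s]; both values are
    compared with the one at a covering point [s0]. *)
Lemma rectangle_tube (f : R -> R -> R) (I : set R) (a b x0 e : R) :
  continuous_on_rectangle I `[a, b] f -> I x0 -> 0 < e ->
  \forall x \near x0, I x -> forall s, a <= s <= b -> `|f x s - f x0 s| < e.
Proof.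
move=> cf Ix0 e0; have e20 : 0 < e / 2 by rewrite divr_gt0.
have := @segment_compact R a b => /compact_near_coveringP/near_covering_withinP.
move=> /(_ R (nbhs x0) (fun x s => I x -> `|f x s - f x0 s| < e) _) H.
have {}H : \forall x \near x0, `[a, b] `<=` (fun s => I x -> `|f x s - f x0 s| < e).
  apply: H => s0 s0ab.
  have := cf => /subspace_continuousP/(_ (x0, s0)); rewrite /= => /(_ (conj Ix0 s0ab)).
  move=> /cvgr_dist_lt/(_ _ e20); rewrite near_withinE => -[[/= U V] [Ux0 Vs0] UV].
  exists (V, U) => // -[/= s x] [Vs Ux] sab Ix.
  have h1 := UV (x, s) (conj Ux Vs) (conj Ix sab).
  have h2 := UV (x0, s) (conj (nbhs_singleton Ux0) Vs) (conj Ix0 sab).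
  rewrite /= in h1 h2.
  rewrite (_ : f x s - f x0 s = (f x0 s0 - f x0 s) - (f x0 s0 - f x s)); last by ring.
  by rewrite (le_lt_trans (ler_normB _ _))// [e]splitr ltrD.
near=> x => Ix s sab; by apply: (near H x) => //=; rewrite in_itv.
Unshelve. all: by end_near. Qed.

Lemma rectangle_section (f : R -> R -> R) (I J : set R) (x : R) :
  continuous_on_rectangle I J f -> I x -> {within J, continuous (f x)}.
Proof.
move=> cf Ix; apply/subspace_continuousP => s Js.
have := cf => /subspace_continuousP/(_ (x, s) (conj Ix Js)) h.
apply/cvgrPdist_lt => e e0; move/cvgrPdist_lt: h => /(_ e e0).
rewrite !near_withinE => -[[/= U V] [Ux Vs] UV].
apply: filterS Vs => s' Vs' Js'.
exact: (UV (x, s') (conj (nbhs_singleton Ux) Vs') (conj Ix Js')).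
Qed.

(** Measurability comes from continuity in [x]: near [x0] the integrands are uniformly close, and
    the kernel has finite mass [W]. *)
Lemma frac_int_measurable (f : R -> R -> R) (L T t : R) :
  continuous_on_rectangle `]0, L[ `[0, T] f -> 0 < t <= T ->
  measurable_fun (`]0, L[ : set R) (fun x => frac_int (1 - alpha) (f x) t).
Proof.
move=> cf /andP[t0 tT].
apply: open_continuous_measurable_fun; first exact: interval_open.
move=> x0; rewrite inE /= => x0L.
have ci x : `]0, L[%classic x -> {within `[0, t], continuous (f x)}.
  move=> xL; apply: continuous_subspaceW (rectangle_section cf xL) => s /=.
  by rewrite !in_itv/= => /andP[-> /le_trans->].
have [iw Iw] := omega_integral alpha01 t0 (lexx t).
set W := omega _ _ - _ in Iw.
have w0 s : 0 <= omega (1 - alpha) s.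
  by apply: omega_ge0; rewrite alpha_gt0/= lerBlDr lerDl ltW//; case/andP: alpha01.
have W0 : 0 <= W by rewrite -Iw itvoo_Rint_ge0.
have W1 : 0 < W + 1 by rewrite ltr_pwDr.
apply/cvgrPdist_le => e e0.
have eW : 0 < e / (W + 1) by rewrite divr_gt0.
have tube := rectangle_tube cf x0L eW.
have xI : \forall x \near x0, `]0, L[%classic x.
  by apply: open_nbhs_nbhs; split => //; exact: interval_open.
apply: filterS2 xI tube => x xL /(_ xL) tube.
have i1 := frac_int_integrable t0 (ci _ x0L); have i2 := frac_int_integrable t0 (ci _ xL).
rewrite /frac_int -itvoo_RintB//.
have id := itvoo_intB i1 i2.
apply: (le_trans (itvoo_Rint_norm id)).
apply: (@le_trans _ _ (\int[mu]_(s in `]0, t[) (e / (W + 1) * omega (1 - alpha) (t - s)))).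
  apply: itvoo_Rint_le; [exact: itvoo_int_norm|exact: itvoo_intZ|].
  move=> s /andP[s0 st]; rewrite -mulrBr normrM (ger0_norm (w0 _)) mulrC ler_wpM2r//.
  by rewrite distrC ltW// tube// (ltW s0) (le_trans (ltW st)).
rewrite itvoo_RintZ// Iw mulrAC ler_pdivrMr// ler_wpM2l ?(ltW e0)//.
by rewrite lerDl.
Qed.

End Quadrature.

(** * Weak derivatives and regularity of the solution *)

Section WeakDerivative.
Context {R : realType}.
Local Notation mu := (@lebesgue_measure R).

Lemma is_derive_eps (f : R -> R) (x d : R) :
  (forall e, 0 < e -> \forall h \near (0 : R), `|f (x + h) - f x - h * d| <= e * `|h|) ->
  is_derive x 1 f d.
Proof.
move=> fd; suff h : h^-1 *: (f (h *: (1 : R) + x) - f x) @[h --> 0^'] --> d.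
  by apply: DeriveDef; [apply: cvgP; exact: h|exact/cvg_lim].
apply/cvgrPdist_le => e /fd; rewrite near_withinE.
apply: filterS => h H h0; rewrite /GRing.scale/= mulr1 (addrC h).
have hn : 0 < `|h| by rewrite normr_gt0.
rewrite -(ler_pM2r hn) -normrM.
suff -> : (d - h^-1 * (f (x + h) - f x)) * h = - (f (x + h) - f x - h * d) by rewrite normrN.
by field.
Qed.

Lemma ae_imp (P Q : R -> Prop) : (forall x, P x -> Q x) ->
  {ae mu, forall x, P x} -> {ae mu, forall x, Q x}.
Proof. by move=> PQ; apply: filterS; first exact: (ae_filter_ringOfSetsType mu). Qed.

Lemma ae_imp2 (P1 P2 Q : R -> Prop) : (forall x, P1 x -> P2 x -> Q x) ->
  {ae mu, forall x, P1 x} -> {ae mu, forall x, P2 x} -> {ae mu, forall x, Q x}.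
Proof. by move=> PQ; apply: filterS2; first exact: (ae_filter_ringOfSetsType mu). Qed.

Lemma small_interval_integral (h : R -> R) (c d e : R) : mu.-integrable `]c, d[ (EFin \o h) -> 0 < e ->
  exists2 r, 0 < r & forall a b, c <= a -> b <= d -> b - a < r ->
    \int[mu]_(x in `]a, b[) `|h x| <= e.
Proof.
move=> ih e0; pose g := h \_ `]c, d[.
have ig : mu.-integrable setT (EFin \o g).
  by rewrite -restrict_EFin; apply/integrable_restrict => //=; rewrite setTI.
have [r [r0 H]] := @integral_normr_continuous _ _ _ mu _ ig e e0.
exists r => // a b ca bd bar.
have -> : \int[mu]_(x in `]a, b[) `|h x| = \int[mu]_(x in `]a, b[) `|g x|.
  apply: itvoo_Rint_eq => x /andP[ax xb]; rewrite /g patchE ifT// inE/= in_itv/=.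
  by rewrite (le_lt_trans ca)//= (lt_le_trans xb).
apply: ltW; apply: H; first exact: measurable_itv.
rewrite /= lebesgue_measure_itv/= lte_fin.
by case: ifPn => ab; rewrite lte_fin.
Qed.

(** Only the right side of [x] matters, because the test functions built below rise on
    [[x, x + eps]]. *)
Definition right_lebesgue_pt (g : R -> R) (x : R) :=
  forall e, 0 < e -> exists2 r, 0 < r &
    forall eps, 0 < eps < r -> \int[mu]_(y in `]x, x + eps[) `|g y - g x| <= e * eps.

Lemma ae_right_lebesgue_pt (g : R -> R) (c d : R) : mu.-integrable `]c, d[ (EFin \o g) ->
  {ae mu, forall x, c < x < d -> right_lebesgue_pt g x}.
Proof.
move=> ig; have loc := integrable_locally_restrict (measurable_itv _) ig.
pose g0 : R -> R := g \_ `]c, d[.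
have := @lebesgue_differentiation R g0 loc; apply: filterS; first exact: (ae_filter_ringOfSetsType mu).
move=> x lx /andP[cx xd] e e0.
(* Half of [e] compensates the length [2 eps] of the ball, whose left half is dropped at the end. *)
have e20 : 0 < e / 2 by rewrite divr_gt0.
have : \forall r \near (0 : R)^'+, ((davg g0 x r) <= (e / 2)%:E)%E.
  have /fine_cvgP[fin /cvgr_dist_le/(_ _ e20)] := lx.
  apply: filterS2 fin => r fr; rewrite sub0r normrN => h.
  by rewrite -(fineK fr) lee_fin (le_trans (ler_norm _)).
rewrite near_withinE -nbhs_ballE => -[r /= r0 gr].
exists (Num.min r (Num.min (d - x) (x - c))); first by rewrite !lt_min r0 !subr_gt0 xd.
move=> eps /andP[eps0]; rewrite !lt_min => /and3P[epsr epsd epsc].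
have := gr eps; rewrite /ball/= sub0r normrN gtr0_norm// => /(_ epsr eps0).
rewrite /davg /iavg lebesgue_measure_ball ?(ltW eps0)//.
have b2 : ball x eps = `]x - eps, x + eps[%classic by rewrite ball_itv.
have e2eps : 0 < eps *+ 2 by rewrite mulrn_wgt0.
rewrite inver (gt_eqF e2eps) lee_pdivrMl// -EFinM b2.
have -> : eps *+ 2 * (e / 2) = e * eps by rewrite -mulr_natr; field.
have g0E y : x - eps < y < x + eps -> g0 y = g y.
  move=> /andP[y1 y2]; rewrite /g0 patchE ifT// inE/= in_itv/=; apply/andP; split; lra.
have igr : mu.-integrable `]x - eps, x + eps[ (EFin \o (fun y => `|g y - g x|)).
  apply: itvoo_int_norm; apply: itvoo_intB; last exact: itvoo_int_cst.
  by apply: itvoo_intS ig; lra.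
have -> : (\int[mu]_(y in `](x - eps)%R, (x + eps)%R[) `|((center (g0 x) \o g0) y)%:E| =
    \int[mu]_(y in `](x - eps)%R, (x + eps)%R[) (EFin \o (fun y => `|g y - g x|%R)) y)%E.
  apply: eq_integral => y; rewrite inE/= in_itv/= => yx.
  rewrite /= (g0E x); last by lra.
  by rewrite (g0E y).
rewrite -(fineK (integrable_fin_num _ igr))// lee_fin.
apply: le_trans.
have xx1 : x - eps <= x by lra.
have xx2 : x < x + eps by lra.
by rewrite -/(Rintegral _ _ _) (Rintegral_oo_split xx1 xx2 igr) lerDr itvoo_Rint_ge0.
Qed.

Lemma continuous_right_lebesgue_pt (g : R -> R) (c d x : R) :
  mu.-integrable `]c, d[ (EFin \o g) -> c < x < d ->
  {for x, continuous g} -> right_lebesgue_pt g x.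
Proof.
move=> ig /andP[cx xd] /cvgr_dist_le cg e e0; have := cg _ e0.
rewrite -nbhs_ballE => -[r /= r0 gr].
exists (Num.min r (d - x)) => [|eps /andP[eps0]]; first by rewrite lt_min r0 subr_gt0.
rewrite lt_min => /andP[epsr epsd].
have ig' : mu.-integrable `]x, x + eps[ (EFin \o g).
  by apply: itvoo_intS ig; lra.
have -> : e * eps = \int[mu]_(y in `]x, x + eps[) e.
  by rewrite itvoo_Rint_cst; [rewrite addrAC subrr add0r|lra].
apply: itvoo_Rint_le; [|exact: itvoo_int_cst|].
  by apply: itvoo_int_norm; apply: itvoo_intB => //; exact: itvoo_int_cst.
move=> y /andP[xy yx]; rewrite distrC; apply: gr.
by rewrite /ball/= distrC gtr0_norm ?subr_gt0//; lra.
Qed.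

Definition half_square (s : R) := s * `|s| / 2.

Lemma is_derive_half_square s : is_derive (s : R) 1 half_square `|s|.
Proof.
apply: is_derive_eps => e e0; near=> h.
apply: (@le_trans _ _ (`|h| * `|h|)); last first.
  by apply: ler_wpM2r => //; near: h; apply: (@nbhs0_le _ R).
rewrite -normrM ger0_norm ?sqr_ge0// /half_square ler_norml; last first.
case: (ger0P s) => s0; case: (ger0P (s + h)) => sh; nra.
Unshelve. all: by end_near. Qed.

(** A C^1 step with explicit derivative, obtained as a second difference of [half_square]. The
    derivative is a hat of mass 1 on [[0, 1]], and the constant [2^-1] makes the function vanish for
    [s <= 0]. *)
Definition smooth_step (s : R) : R :=
  2 * (half_square s - 2 * half_square (s - 2^-1) + half_square (s - 1)) + 2^-1.

Definition smooth_step' (s : R) : R := 2 * (`|s| - 2 * `|s - 2^-1| + `|s - 1|).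

Lemma is_derive_smooth_step (s : R) : is_derive s 1 smooth_step (smooth_step' s).
Proof.
have h c := @is_derive1_comp R half_square (fun z => z - c) s _ _
    (is_derive_half_square (s - c)) (is_deriveB (is_derive_id s 1) (is_derive_cst c s 1)).
have h1 := is_deriveD (is_deriveZ (2:R) (is_deriveD (is_deriveB (is_derive_half_square s) (is_deriveZ (2:R) (h 2^-1))) (h 1))) (is_derive_cst (2^-1 : R) s 1).
apply: (is_derive_eq h1).
by rewrite /smooth_step' /GRing.scale/= !subr0 !mulr1 addr0.
Qed.

Lemma smooth_step'_out (s : R) : s <= 0 \/ 1 <= s -> smooth_step' s = 0.
Proof.
rewrite /smooth_step'; case=> s0.
  rewrite !ler0_norm; lra.
rewrite !ger0_norm; lra.
Qed.

Lemma smooth_step'_bound (s : R) : 0 <= smooth_step' s <= 2.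
Proof.
rewrite /smooth_step'.
case: (ger0P s) => s0; case: (ger0P (s - 2^-1)) => s1; case: (ger0P (s - 1)) => s2; apply/andP; split; lra.
Qed.

Lemma smooth_step_le0 (s : R) : s <= 0 -> smooth_step s = 0.
Proof. by move=> s0; rewrite /smooth_step /half_square !ler0_norm; [field|lra..]. Qed.

Lemma smooth_step_ge1 (s : R) : 1 <= s -> smooth_step s = 1.
Proof. by move=> s0; rewrite /smooth_step /half_square !ger0_norm; [field|lra..]. Qed.

Lemma smooth_step_bound (s : R) : 0 <= smooth_step s <= 1.
Proof.
have [s0|s0] := leP s 0; first by rewrite smooth_step_le0// lexx ler01.
have [s1|s1] := leP 1 s; first by rewrite smooth_step_ge1// lexx ler01.
rewrite /smooth_step /half_square (ger0_norm (ltW s0)) (@ler0_norm _ (s - 1)); last lra.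
case: (ger0P (s - 2^-1)) => s2; apply/andP; split; nra.
Qed.

Definition step_at (x eps y : R) := smooth_step ((y - x) / eps).
Definition step_at' (x eps y : R) := smooth_step' ((y - x) / eps) / eps.

Lemma is_derive_step_at (x eps y : R) : is_derive y 1 (step_at x eps) (step_at' x eps y).
Proof.
have h := @is_derive1_comp R smooth_step (fun z => (z - x) / eps) y _ _
    (is_derive_smooth_step ((y - x) / eps)).
have := h eps^-1; rewrite /step_at' mulrC; apply.
have h2 := is_deriveZ eps^-1 (is_deriveB (is_derive_id y 1) (is_derive_cst x y 1)).
have -> : (fun z => (z - x) / eps) = eps^-1 \*: (id \- cst x).
  by apply/funext => z; rewrite /= /GRing.scale/= mulrC.
by apply: (is_derive_eq h2); rewrite subr0 /GRing.scale/= mulr1.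
Qed.

Lemma step_at'_continuous (x eps : R) : continuous (step_at' x eps).
Proof.
have ha (c : R) : continuous (fun y : R => `|(y - x) / eps - c|).
  move=> y; apply: cvg_norm; apply: cvgB; last exact: cvg_cst.
  by apply: cvgMl; apply: cvgB; [exact: cvg_id|exact: cvg_cst].
move=> y; apply: cvgMl; apply: cvgM; first exact: cvg_cst.
apply: cvgD; last exact: ha.
apply: cvgB; last by apply: cvgM; [exact: cvg_cst|exact: ha].
have := ha 0 y; rewrite (_ : (fun y0 => `|(y0 - x) / eps - 0|) = (fun y0 => `|(y0 - x) / eps|))// ?subr0//.
by apply/funext => z; rewrite subr0.
Qed.

Lemma step_at_continuous (x eps : R) : continuous (step_at x eps).
Proof. by move=> y; apply: (is_derive_continuous (is_derive_step_at x eps y)). Qed.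

Lemma step_at'_out (x eps y : R) : 0 < eps -> y <= x \/ x + eps <= y -> step_at' x eps y = 0.
Proof.
move=> eps0 h; rewrite /step_at' smooth_step'_out ?mul0r//.
by case: h => h; [left; rewrite pmulr_lle0 ?invr_gt0// subr_le0|right; rewrite ler_pdivlMr// mul1r; lra].
Qed.

Lemma step_at'_bound (x eps y : R) : 0 < eps -> 0 <= step_at' x eps y <= 2 / eps.
Proof.
move=> eps0; have /andP[h1 h2] := smooth_step'_bound ((y - x) / eps).
by rewrite /step_at' divr_ge0 ?(ltW eps0)//= ler_pM2r ?invr_gt0.
Qed.

Lemma step_at_le (x eps y : R) : 0 < eps -> y <= x -> step_at x eps y = 0.
Proof. by move=> eps0 h; rewrite /step_at smooth_step_le0// pmulr_lle0 ?invr_gt0// subr_le0. Qed.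

Lemma step_at_ge (x eps y : R) : 0 < eps -> x + eps <= y -> step_at x eps y = 1.
Proof. by move=> eps0 h; rewrite /step_at smooth_step_ge1// ler_pdivlMr// mul1r; lra. Qed.

Lemma step_at_bound (x eps y : R) : 0 <= step_at x eps y <= 1.
Proof. exact: smooth_step_bound. Qed.

Lemma itvoo_int_bounded_continuous (g s : R -> R) (c d B : R) : mu.-integrable `]c, d[ (EFin \o g) ->
  continuous s -> (forall x, `|s x| <= B) -> mu.-integrable `]c, d[ (EFin \o (fun y => g y * s y)).
Proof.
move=> ig cs sB; apply: (itvoo_int_eq (fun y _ => mulrC (s y) (g y))).
apply: (@itvoo_intM _ _ _ B) => //.
by apply: measurable_funTS; exact: continuous_measurable_fun.
Qed.

Lemma step_at'_integral (x eps : R) : 0 < eps ->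
  mu.-integrable `]x, x + eps[ (EFin \o step_at' x eps) /\
  \int[mu]_(y in `]x, x + eps[) step_at' x eps y = 1.
Proof.
move=> eps0; have xx : x < x + eps by rewrite ltrDl.
have cF : {within `[x, x + eps], continuous (step_at x eps)}.
  by apply: continuous_subspaceT; exact: step_at_continuous.
have dF y : x < y < x + eps -> is_derive y 1 (step_at x eps) (step_at' x eps y).
  by move=> _; exact: is_derive_step_at.
have cf y : x < y < x + eps -> {for y, continuous (step_at' x eps)}.
  by move=> _; exact: step_at'_continuous.
have dom y : x < y < x + eps -> `|step_at' x eps y| <= step_at' x eps y.
  by move=> _; rewrite ger0_norm//; have /andP[] := step_at'_bound x y eps0.
have := FTC_oo_dominated xx cF cF dF dF cf cf dom.
by rewrite step_at_ge// step_at_le// subr0.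
Qed.

(** [step_at'] has mass 1 on [[x, x + eps]] and is at most [2 / eps], so it samples [g] at [x] up to
    a one-sided Lebesgue average. *)
Lemma step_at'_average (g : R -> R) (c d x eps : R) : mu.-integrable `]c, d[ (EFin \o g) ->
  c <= x -> 0 < eps -> x + eps < d ->
  `|\int[mu]_(y in `]c, d[) (g y * step_at' x eps y) - g x| <=
    2 / eps * \int[mu]_(y in `]x, x + eps[) `|g y - g x|.
Proof.
move=> ig cx eps0 xd.
have sB y : `|step_at' x eps y| <= 2 / eps.
  by have /andP[h1 h2] := step_at'_bound x y eps0; rewrite ger0_norm.
have igs := itvoo_int_bounded_continuous ig (@step_at'_continuous x eps) sB.
have xx : x < x + eps by rewrite ltrDl.
rewrite (Rintegral_oo_split cx _ igs); last exact: lt_trans xd.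
have igs' : mu.-integrable `]x, d[ (EFin \o (fun y => g y * step_at' x eps y)) by exact: itvoo_intS igs.
rewrite (Rintegral_oo_split (ltW xx) xd igs').
have -> : \int[mu]_(y in `]c, x[) (g y * step_at' x eps y) = 0.
  rewrite -(mul0r (x - c)) -itvoo_Rint_cst//; apply: itvoo_Rint_eq => y /andP[_ yx].
  by rewrite step_at'_out ?mulr0//; left; exact: ltW.
have -> : \int[mu]_(y in `]x + eps, d[) (g y * step_at' x eps y) = 0.
  rewrite -(mul0r (d - (x + eps))) -itvoo_Rint_cst ?(ltW xd)//; apply: itvoo_Rint_eq => y /andP[yx _].
  by rewrite step_at'_out ?mulr0//; right; exact: ltW.
have [ist Ist] := step_at'_integral x eps0.
have ig' : mu.-integrable `]x, x + eps[ (EFin \o g) by apply: itvoo_intS ig => //; exact: ltW.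
have igc : mu.-integrable `]x, x + eps[ (EFin \o (fun y => g y - g x)).
  by apply: itvoo_intB => //; exact: itvoo_int_cst.
have igcs := itvoo_int_bounded_continuous igc (@step_at'_continuous x eps) sB.
have -> : \int[mu]_(y in `]x, x + eps[) (g y * step_at' x eps y) =
   \int[mu]_(y in `]x, x + eps[) ((g y - g x) * step_at' x eps y) + g x.
  transitivity (\int[mu]_(y in `]x, x + eps[)
      ((g y - g x) * step_at' x eps y + g x * step_at' x eps y)).
    by apply: itvoo_Rint_eq => y _; ring.
  by rewrite itvoo_RintD// ?itvoo_RintZ ?Ist ?mulr1//; exact: itvoo_intZ.
rewrite add0r addr0 addrK.
apply: (le_trans (itvoo_Rint_norm igcs)); rewrite -itvoo_RintZ; last exact: itvoo_int_norm.
apply: itvoo_Rint_le; [exact: itvoo_int_norm|by apply: itvoo_intZ; exact: itvoo_int_norm|].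
by move=> y _; rewrite normrM mulrC ler_wpM2r.
Qed.

Lemma step_at_average (g : R -> R) (c d x eps : R) : mu.-integrable `]c, d[ (EFin \o g) ->
  c <= x -> 0 < eps -> x + eps < d ->
  `|\int[mu]_(y in `]c, d[) (g y * step_at x eps y) - \int[mu]_(y in `]x, d[) g y| <=
    \int[mu]_(y in `]x, x + eps[) `|g y|.
Proof.
move=> ig cx eps0 xd.
have sB y : `|step_at x eps y| <= 1.
  by have /andP[h1 h2] := step_at_bound x eps y; rewrite ger0_norm.
have igs := itvoo_int_bounded_continuous ig (@step_at_continuous x eps) sB.
have xx : x < x + eps by rewrite ltrDl.
have ig' : mu.-integrable `]x, d[ (EFin \o g) by exact: itvoo_intS ig.
rewrite (Rintegral_oo_split cx _ igs); last exact: lt_trans xd.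
have igs' : mu.-integrable `]x, d[ (EFin \o (fun y => g y * step_at x eps y)) by exact: itvoo_intS igs.
rewrite (Rintegral_oo_split (ltW xx) xd igs') (Rintegral_oo_split (ltW xx) xd ig').
have -> : \int[mu]_(y in `]c, x[) (g y * step_at x eps y) = 0.
  rewrite -(mul0r (x - c)) -itvoo_Rint_cst//; apply: itvoo_Rint_eq => y /andP[_ yx].
  by rewrite step_at_le ?mulr0//; exact: ltW.
have -> : \int[mu]_(y in `]x + eps, d[) (g y * step_at x eps y) = \int[mu]_(y in `]x + eps, d[) g y.
  by apply: itvoo_Rint_eq => y /andP[yx _]; rewrite step_at_ge ?mulr1//; exact: ltW.
have ig2 : mu.-integrable `]x, x + eps[ (EFin \o g) by apply: itvoo_intS ig' => //; exact: ltW.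
have igs2 : mu.-integrable `]x, x + eps[ (EFin \o (fun y => g y * step_at x eps y)).
  by apply: itvoo_intS igs' => //; exact: ltW.
rewrite add0r opprD addrACA subrr addr0 -itvoo_RintB//.
apply: (le_trans (itvoo_Rint_norm (itvoo_intB igs2 ig2))).
apply: itvoo_Rint_le; [by apply: itvoo_int_norm; exact: itvoo_intB|exact: itvoo_int_norm|].
move=> y _; rewrite -{2}[g y]mulr1 -mulrBr normrM ler_piMr//.
by have /andP[h1 h2] := step_at_bound x eps y; rewrite ler_norml; apply/andP; split; lra.
Qed.

(** The test function is a difference of two smooth steps, close to the indicator of [[x1, x2]]: its
    derivative samples [g] at both points, and its integral against [dg] approximates the right-hand
    side. *)
Lemma weak_derivative_increment (c d x1 x2 : R) (g dg : R -> R) : weak_derivative c d g dg ->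
  c < x1 -> x1 < x2 -> x2 < d -> right_lebesgue_pt g x1 -> right_lebesgue_pt g x2 ->
  g x2 - g x1 = \int[mu]_(x in `]x1, x2[) dg x.
Proof.
move=> [ig idg wd] cx x12 xd l1 l2.
apply/eqP; rewrite -subr_eq0 -normr_le0; apply/ler_addgt0Pr => e e0; rewrite add0r.
have e8 : 0 < e / 8 by rewrite divr_gt0.
have [r1 r10 h1] := l1 _ e8; have [r2 r20 h2] := l2 _ e8.
have [r3 r30 h3] := small_interval_integral idg e8.
(* The layers must respect both Lebesgue radii, be short for the absolute continuity of [dg], stay
   inside []c, d[] and not overlap. The division by 2 makes all these conditions strict. *)
pose eps := Num.min (Num.min r1 r2) (Num.min r3 (Num.min (d - x2) (x2 - x1))) / 2.
have eps0 : 0 < eps.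
  by rewrite divr_gt0// !lt_min r10 r20 r30 !subr_gt0 xd x12.
have : eps < Num.min (Num.min r1 r2) (Num.min r3 (Num.min (d - x2) (x2 - x1))).
  by rewrite ltr_pdivrMr// ltr_pMr ?ltr1n// !lt_min r10 r20 r30 !subr_gt0 xd x12.
rewrite !lt_min => /andP[/andP[er1 er2] /and3P[er3 ed e12]].
clearbody eps.
have {}h1 := h1 eps _; have {}h2 := h2 eps _.
rewrite eps0 er1 in h1; rewrite eps0 er2 in h2; have {}h1 := h1 isT; have {}h2 := h2 isT.
have x1d : x1 + eps < d by lra.
have x2d : x2 + eps < d by lra.
have cx2 : c <= x2 by lra.
have s3 : \int[mu]_(y in `]x1, x1 + eps[) `|dg y| <= e / 8 by apply: h3; [exact: ltW|exact: ltW|rewrite addrC addKr].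
have s4 : \int[mu]_(y in `]x2, x2 + eps[) `|dg y| <= e / 8 by apply: h3; [exact: cx2|exact: ltW|rewrite addrC addKr].
have b1 := step_at'_average ig (ltW cx) eps0 x1d.
have b2 := step_at'_average ig cx2 eps0 x2d.
have b3 := step_at_average idg (ltW cx) eps0 x1d.
have b4 := step_at_average idg cx2 eps0 x2d.
have t1 : 2 / eps * \int[mu]_(y in `]x1, x1 + eps[) `|g y - g x1| <= e / 4.
  apply: (@le_trans _ _ (2 / eps * (e / 8 * eps))).
    by rewrite ler_wpM2l// divr_ge0// ltW.
  by rewrite le_eqVlt; apply/orP; left; apply/eqP; field; rewrite gt_eqF.
have t2 : 2 / eps * \int[mu]_(y in `]x2, x2 + eps[) `|g y - g x2| <= e / 4.
  apply: (@le_trans _ _ (2 / eps * (e / 8 * eps))).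
    by rewrite ler_wpM2l// divr_ge0// ltW.
  by rewrite le_eqVlt; apply/orP; left; apply/eqP; field; rewrite gt_eqF.
pose psi := step_at x1 eps \- step_at x2 eps.
have Dpsi (y : R) : is_derive y 1 psi (step_at' x1 eps y - step_at' x2 eps y).
  by apply: is_deriveB; exact: is_derive_step_at.
have dpsi : derive1 psi = fun y => step_at' x1 eps y - step_at' x2 eps y.
  by apply/funext => y; rewrite derive1E; case: (Dpsi y).
have tpsi : test_function c d psi.
  split.
  - by move=> y; case: (Dpsi y).
  - by rewrite dpsi => y; apply: cvgB; exact: step_at'_continuous.
  exists x1, (x2 + eps); split => // y.
  rewrite notin_setE/= in_itv/= => /negP; rewrite negb_and -!ltNge /psi /= => /orP[y1|y2].
    by rewrite !step_at_le ?subrr//; clear -x12 y1; lra.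
  by rewrite !step_at_ge ?subrr//; clear -x12 y2; lra.
have := wd psi tpsi; rewrite dpsi.
have i1 x : mu.-integrable `]c, d[ (EFin \o (fun y => g y * step_at' x eps y)).
  apply: (@itvoo_int_bounded_continuous _ _ _ _ (2 / eps)) => //; first exact: step_at'_continuous.
  by move=> y; have /andP[? ?] := step_at'_bound x y eps0; rewrite ger0_norm.
have i2 x : mu.-integrable `]c, d[ (EFin \o (fun y => dg y * step_at x eps y)).
  apply: (@itvoo_int_bounded_continuous _ _ _ _ 1) => //; first exact: step_at_continuous.
  by move=> y; have /andP[? ?] := step_at_bound x eps y; rewrite ger0_norm.
rewrite (_ : (fun x => _) = fun y => g y * step_at' x1 eps y - g y * step_at' x2 eps y); last first.
  by apply/funext => y; rewrite mulrBr.
rewrite (_ : (fun x => dg x * psi x) = fun y => dg y * step_at x1 eps y - dg y * step_at x2 eps y); last first.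
  by apply/funext => y; rewrite /psi/= mulrBr.
rewrite !itvoo_RintB//.
have idg1 : mu.-integrable `]x1, d[ (EFin \o dg) by apply: itvoo_intS idg => //; exact: ltW.
rewrite (Rintegral_oo_split (ltW x12) xd idg1) in b3.
move: b1 b2 b3 b4.
set A1 := \int[mu]_(y in `]c, d[) _; set A2 := \int[mu]_(y in `]c, d[) _.
set A3 := \int[mu]_(y in `]c, d[) _; set A4 := \int[mu]_(y in `]c, d[) _.
set B1 := \int[mu]_(y in `]x1, x2[) _; set B2 := \int[mu]_(y in `]x2, d[) _.
move=> /le_trans/(_ t1) + /le_trans/(_ t2) + /le_trans/(_ s3) + /le_trans/(_ s4).
clear; rewrite !ler_norml => /andP[? ?] /andP[? ?] /andP[? ?] /andP[? ?] ?.
apply/andP; split; lra.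
Qed.

Lemma integral_at_endpoints (h : R -> R) (c d e : R) : mu.-integrable `]c, d[ (EFin \o h) -> 0 < e ->
  exists2 r, 0 < r & forall a b a' b', c <= a -> b <= d -> a <= a' -> a' < b' -> b' <= b ->
    a' - a < r -> b - b' < r ->
    `|\int[mu]_(x in `]a, b[) h x - \int[mu]_(x in `]a', b'[) h x| <= e.
Proof.
move=> ih e0; have e20 : 0 < e / 2 by rewrite divr_gt0.
have [r r0 H] := small_interval_integral ih e20.
exists r => // a b a' b' ca bd aa ab bb ra rb.
have a'b : a' < b by exact: lt_le_trans bb.
have iab : mu.-integrable `]a, b[ (EFin \o h) by exact: itvoo_intS ih.
have iaa : mu.-integrable `]a, a'[ (EFin \o h) by apply: itvoo_intS iab => //; exact: ltW.
have ia'b : mu.-integrable `]a', b[ (EFin \o h) by exact: itvoo_intS iab.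
have ibb : mu.-integrable `]b', b[ (EFin \o h) by apply: itvoo_intS ia'b => //; exact: ltW.
have h1 := H a a' ca (le_trans (ltW a'b) bd) ra.
have h2 := H b' b (le_trans (le_trans ca aa) (ltW ab)) bd rb.
rewrite (Rintegral_oo_split aa a'b iab).
have -> : \int[mu]_(x in `]a', b[) h x = \int[mu]_(x in `]a', b'[) h x + \int[mu]_(x in `]b', b[) h x.
  move: bb; rewrite le_eqVlt => /predU1P[<-|b'b]; last exact: (Rintegral_oo_split (ltW ab) b'b ia'b).
  by rewrite set_itvoo0 Rintegral_set0 addr0.
have := le_trans (itvoo_Rint_norm iaa) h1; have := le_trans (itvoo_Rint_norm ibb) h2.
set I1 := Rintegral _ _ _; set I2 := Rintegral _ _ _; set I3 := Rintegral _ _ _; clear.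
by rewrite !ler_norml => /andP[? ?] /andP[? ?]; apply/andP; split; lra.
Qed.

(** Interior points of continuity are Lebesgue points, so increments are known inside; continuity of
    [g] and absolute continuity of the integral carry the identity to the endpoints. *)
Lemma weak_derivative_increment_closed (c d x1 x2 : R) (g dg : R -> R) : weak_derivative c d g dg ->
  {within `[c, d], continuous g} -> c <= x1 -> x1 < x2 -> x2 <= d ->
  g x2 - g x1 = \int[mu]_(x in `]x1, x2[) dg x.
Proof.
move=> wd cg cx x12 xd; have [ig idg _] := wd.
have inside y1 y2 : x1 < y1 -> y1 < y2 -> y2 < x2 -> g y2 - g y1 = \int[mu]_(x in `]y1, y2[) dg x.
  move=> y1x y12 y2x.
  have cdg y : x1 < y < x2 -> right_lebesgue_pt g y.
    move=> /andP[xy yx]; apply: (continuous_right_lebesgue_pt ig); first by apply/andP; split; lra.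
    have cgy : {within `]c, d[, continuous g}.
      by apply: continuous_subspaceW cg; exact: subset_itv_oo_cc.
    move: cgy; rewrite continuous_open_subspace; last exact: interval_open.
    by apply; rewrite inE/= in_itv/=; apply/andP; split; lra.
  by apply: (weak_derivative_increment wd) => //; try apply: cdg; try (apply/andP; split); lra.
apply/eqP; rewrite -subr_eq0 -normr_le0; apply/ler_addgt0Pr => e e0; rewrite add0r.
have e30 : 0 < e / 3 by rewrite divr_gt0.
have [r r0 H] := integral_at_endpoints idg e30.
have x1cd : `[c, d]%classic x1 by rewrite /= in_itv/= cx/= ltW// (lt_le_trans x12).
have x2cd : `[c, d]%classic x2 by rewrite /= in_itv/= xd andbT (le_trans cx)// ltW.
have := cg => /subspace_continuousP/(_ _ x1cd)/cvgr_dist_le/(_ _ e30).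
rewrite near_withinE -nbhs_ballE => -[r1 /= r10 gr1].
have := cg => /subspace_continuousP/(_ _ x2cd)/cvgr_dist_le/(_ _ e30).
rewrite near_withinE -nbhs_ballE => -[r2 /= r20 gr2].
pose m := Num.min (Num.min r r1) (Num.min r2 ((x2 - x1) / 2)).
have m0 : 0 < m by rewrite !lt_min r0 r10 r20 divr_gt0// subr_gt0.
pose eps := m / 2; have eps0 : 0 < eps by rewrite divr_gt0.
have : eps < m by rewrite ltr_pdivrMr// ltr_pMr ?ltr1n.
rewrite /m !lt_min => /andP[/andP[er er1] /andP[er2 er3]].
clearbody eps; clear m m0.
have h1 : `|g x1 - g (x1 + eps)| <= e / 3.
  apply: gr1; rewrite /ball/= ?in_itv/=; last by apply/andP; split; lra.
  by rewrite opprD addrA subrr add0r normrN gtr0_norm.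
have h2 : `|g x2 - g (x2 - eps)| <= e / 3.
  apply: gr2; rewrite /ball/= ?in_itv/=; last by apply/andP; split; lra.
  by rewrite opprB addrC subrK gtr0_norm.
have h3 := H x1 x2 (x1 + eps) (x2 - eps) cx xd.
have {}h3 : `|\int[mu]_(x in `]x1, x2[) dg x - \int[mu]_(x in `]x1 + eps, x2 - eps[) dg x| <= e / 3.
  by apply: h3; lra.
have in1 : x1 < x1 + eps by rewrite ltrDl.
have in2 : x1 + eps < x2 - eps by lra.
have in3 : x2 - eps < x2 by rewrite ltrBlDr ltrDl.
move: h3; rewrite -(inside _ _ in1 in2 in3).
move: h1 h2; set I := Rintegral _ _ _; clear.
by rewrite !ler_norml => /andP[? ?] /andP[? ?] /andP[? ?]; apply/andP; split; lra.
Qed.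

(** A concrete representative of an H^2 function: [v] is classically differentiable inside, and [v1]
    has density [g2] up to both endpoints, where it stands for the limit of the derivative. *)
Definition H2_path (L : R) (v v1 g2 : R -> R) : Prop :=
  [/\ {within `[0, L], continuous v},
      forall x, 0 < x < L -> is_derive x 1 v (v1 x),
      forall x y, 0 <= x -> x < y -> y <= L -> v1 y - v1 x = \int[mu]_(z in `]x, y[) g2 z,
      mu.-integrable `]0, L[ (EFin \o g2) & L2 L g2].

Lemma is_derive_increment (v v1 : R -> R) (c d x : R) :
  (forall x, c < x < d -> {for x, continuous v1}) ->
  mu.-integrable `]c, d[ (EFin \o v1) ->
  (forall x y, c < x -> x < y -> y < d -> v y - v x = \int[mu]_(z in `]x, y[) v1 z) ->
  c < x < d -> is_derive x 1 v (v1 x).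
Proof.
move=> cv1 iv inc xcd; apply: is_derive_eps => e e0.
have := cv1 x xcd; case/andP: xcd => cx xd.
move=> /cvgr_dist_le/(_ _ e0); rewrite -nbhs_ballE => -[r /= r0 gr].
near=> h.
have hr : `|h| < r by near: h; apply: (@nbhs0_lt _ R).
have hd : `|h| < d - x by near: h; apply: (@nbhs0_lt _ R); rewrite subr_gt0.
have hc : `|h| < x - c by near: h; apply: (@nbhs0_lt _ R); rewrite subr_gt0.
have main y1 y2 : c < y1 -> y1 < y2 -> y2 < d -> (forall z, y1 < z < y2 -> `|x - z| < r) ->
   `|v y2 - v y1 - (y2 - y1) * v1 x| <= e * (y2 - y1).
  move=> cy1 y12 y2d near_x; rewrite inc//.
  have iy : mu.-integrable `]y1, y2[ (EFin \o v1) by apply: itvoo_intS iv; exact: ltW.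
  rewrite [_ * v1 x]mulrC -itvoo_Rint_cst ?(ltW y12)// -itvoo_RintB//; last exact: itvoo_int_cst.
  have ic : mu.-integrable `]y1, y2[ (EFin \o (fun z => v1 z - v1 x)).
    by apply: itvoo_intB => //; exact: itvoo_int_cst.
  apply: (le_trans (itvoo_Rint_norm ic)); rewrite -itvoo_Rint_cst ?(ltW y12)//.
  apply: itvoo_Rint_le; [exact: itvoo_int_norm|exact: itvoo_int_cst|].
  by move=> z /near_x h1; rewrite distrC; exact: gr.
have [h0|h0|->] := ltgtP h 0; last by rewrite addr0 subrr mul0r subr0 normr0 mulr0.
  rewrite (ltr0_norm h0) in hr hd hc *.
  have := main (x + h) x; rewrite opprD addrA subrr sub0r => h1.
  have -> : v (x + h) - v x - h * v1 x = - (v x - v (x + h) - - h * v1 x) by ring.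
  rewrite normrN; apply: h1; [lra|lra|lra|move=> z /andP[z1 z2]].
  by rewrite gtr0_norm ?subr_gt0//; lra.
rewrite (gtr0_norm h0) in hr hd hc *.
have := main x (x + h); rewrite (addrC x) addrK => h1.
apply: h1; [lra|lra|lra|move=> z /andP[z1 z2]].
by rewrite ltr0_norm ?subr_lt0//; lra.
Unshelve. all: by end_near. Qed.

(** At a Lebesgue point of the density, the difference quotients of the primitive converge to the
    density, so a classical derivative can have no other value. This will identify classical and
    weak second derivatives. *)
Lemma is_derive_increment_unique (v v1 : R -> R) (c d x D : R) :
  mu.-integrable `]c, d[ (EFin \o v1) ->
  (forall x y, c < x -> x < y -> y < d -> v y - v x = \int[mu]_(z in `]x, y[) v1 z) ->
  c < x < d -> right_lebesgue_pt v1 x -> is_derive x 1 v D -> v1 x = D.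
Proof.
move=> iv inc /andP[cx xd] lv [dv Dv].
apply/eqP; rewrite -subr_eq0 -normr_le0; apply/ler_addgt0Pr => e e0; rewrite add0r.
have e20 : 0 < e / 2 by rewrite divr_gt0.
have [r r0 H] := lv _ e20.
have : \forall h \near 0^', `|h^-1 *: (v (h *: (1 : R) + x) - v x) - D| <= e / 2.
  by move/cvgr_dist_le: dv => /(_ _ e20); rewrite -Dv; apply: filterS => h; rewrite distrC.
rewrite near_withinE -nbhs_ballE => -[r1 /= r10 gr].
pose m := Num.min (Num.min r r1) (d - x).
have m0 : 0 < m by rewrite !lt_min r0 r10 subr_gt0.
pose h := m / 2; have h0 : 0 < h by rewrite divr_gt0.
have : h < m by rewrite ltr_pdivrMr// ltr_pMr ?ltr1n.
rewrite /m !lt_min => /andP[/andP[hr hr1] hd]; clearbody h; clear m m0.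
have := gr h; rewrite /ball/= sub0r normrN gtr0_norm// gt_eqF// => /(_ hr1 isT).
rewrite /GRing.scale/= mulr1.
have {}H : \int[mu]_(y in `]x, x + h[) `|v1 y - v1 x| <= e / 2 * h by apply: H; rewrite h0.
have xh : x < x + h by rewrite ltrDl.
have xhd : x + h < d by lra.
rewrite (addrC h) inc//.
have ix : mu.-integrable `]x, x + h[ (EFin \o v1) by apply: itvoo_intS iv; exact: ltW.
have ic : mu.-integrable `]x, x + h[ (EFin \o (fun z => v1 z - v1 x)).
  by apply: itvoo_intB => //; exact: itvoo_int_cst.
have : `|\int[mu]_(y in `]x, x + h[) v1 y - v1 x * h| <= e / 2 * h.
  apply: le_trans H; apply: le_trans (itvoo_Rint_norm ic).
  rewrite itvoo_RintB//; last exact: itvoo_int_cst.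
  by rewrite itvoo_Rint_cst ?(ltW xh)// (addrC x) addrK.
set I := Rintegral _ _ _ => h1 h2.
have {}h1 : `|h^-1 * I - v1 x| <= e / 2.
  rewrite -(ler_pM2r h0) -[X in _ * X <= _](gtr0_norm h0) -normrM.
  suff -> : (h^-1 * I - v1 x) * h = I - v1 x * h by [].
  by field; rewrite gt_eqF.
move: h1 h2; set q := _ * I; clear.
by rewrite !ler_norml => /andP[? ?] /andP[? ?]; apply/andP; split; lra.
Qed.

Lemma ae_itv_exists (P : R -> Prop) (c d : R) : c < d ->
  {ae mu, forall x, c < x < d -> P x} -> exists x, c < x < d /\ P x.
Proof.
move=> cd aeP; apply: contrapT => nP.
have sub : (`]c, d[%classic : set R) `<=` ~` [set x | c < x < d -> P x].
  move=> x /=; rewrite in_itv/= => xcd Px; apply: nP; exists x; split => //; exact: Px.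
have [A [mA A0 /subset_trans h]] := aeP.
have : (mu (`]c, d[%classic : set R) <= 0)%E.
  by rewrite -A0; apply: le_measure; rewrite ?inE//=; exact: subset_trans sub (h _ _).
by rewrite /= lebesgue_measure_itv/= lte_fin cd -EFinD lee_fin subr_le0 leNgt cd.
Qed.

Lemma ae_itvoo_Rint_eq (f g : R -> R) (a b : R) : mu.-integrable `]a, b[ (EFin \o f) ->
  measurable_fun (`]a, b[ : set R) g ->
  {ae mu, forall x, a < x < b -> f x = g x} ->
  mu.-integrable `]a, b[ (EFin \o g) /\ \int[mu]_(x in `]a, b[) f x = \int[mu]_(x in `]a, b[) g x.
Proof.
move=> intf mg aefg.
have mg' : measurable_fun (`]a, b[ : set R) (EFin \o g) by exact/measurable_EFinP.
have ae1 : ae_eq mu `]a, b[ (EFin \o f) (EFin \o g).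
  move: aefg; apply: filterS; first exact: (ae_filter_ringOfSetsType mu).
  by move=> x /= h; rewrite in_itv/= => /h ->.
have /integrableP[mf ltf] := intf.
split.
  apply/integrableP; split => //; apply: le_lt_trans ltf; rewrite le_eqVlt; apply/orP; left; apply/eqP.
  apply: ge0_ae_eq_integral => //; try exact: measurableT_comp.
  by apply: ae_imp ae1 => x h /h /= [->].
by congr fine; apply: ae_eq_integral => //; exact: (measurable_int mu).
Qed.

Lemma primitive_continuous (g : R -> R) (c d : R) (F : R -> R) :
  mu.-integrable `]c, d[ (EFin \o g) ->
  (forall x y, c < x -> x < y -> y < d -> F y - F x = \int[mu]_(z in `]x, y[) g z) ->
  forall x, c < x < d -> {for x, continuous F}.
Proof.
move=> ig inc x /andP[cx xd]; apply/cvgrPdist_le => e e0.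
have [r r0 H] := small_interval_integral ig e0.
have main y1 y2 : c < y1 -> y1 < y2 -> y2 < d -> y2 - y1 < r -> `|F y2 - F y1| <= e.
  move=> cy1 y12 y2d y12r; rewrite inc//.
  have iy : mu.-integrable `]y1, y2[ (EFin \o g) by apply: itvoo_intS ig; exact: ltW.
  by apply: (le_trans (itvoo_Rint_norm iy)); apply: H => //; exact: ltW.
near=> y.
have yr : `|x - y| < r by near: y; exact: cvgr_dist_lt.
have yd : y < d by near: y; exact: lt_nbhsl.
have cy : c < y by near: y; exact: lt_nbhsr.
have [yx|xy|->] := ltgtP y x; last by rewrite subrr normr0 ltW.
  by apply: main => //; move: yr; rewrite gtr0_norm ?subr_gt0.
by rewrite distrC; apply: main => //; move: yr; rewrite ltr0_norm ?subr_lt0// opprB.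
Unshelve. all: by end_near. Qed.

(** [v1] is the continuous representative of [g1]: the primitive of [g2], with its constant fixed at
    a Lebesgue point [x0] of [g1]. Then [v] has a continuous density, hence is differentiable at
    every interior point. *)
Lemma weak_derivatives_H2_path (L : R) (v g1 g2 : R -> R) : 0 < L ->
  {within `[0, L], continuous v} -> weak_derivative 0 L v g1 -> weak_derivative 0 L g1 g2 ->
  L2 L g2 -> exists v1, H2_path L v v1 g2.
Proof.
move=> L0 cv wd1 wd2 L2g2; have [iv ig1 _] := wd1; have [_ ig2 _] := wd2.
have aeL := ae_right_lebesgue_pt ig1.
have [x0 [x0L lx0]] := ae_itv_exists L0 aeL.
pose v1 x := g1 x0 - \int[mu]_(z in `]0, x0[) g2 z + \int[mu]_(z in `]0, x[) g2 z.
have inc1 x y : 0 <= x -> x < y -> y <= L -> v1 y - v1 x = \int[mu]_(z in `]x, y[) g2 z.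
  move=> x0' xy yL; rewrite /v1.
  have i2 : mu.-integrable `]0, y[ (EFin \o g2) by exact: itvoo_intS ig2.
  by rewrite (Rintegral_oo_split x0' xy i2); ring.
have v1x0 : v1 x0 = g1 x0 by rewrite /v1 subrK.
clearbody v1.
have cv1 := primitive_continuous ig2 (fun x y x0 xy yL => inc1 x y (ltW x0) xy (ltW yL)).
have ae1 : {ae mu, forall x, 0 < x < L -> g1 x = v1 x}.
  move: aeL; apply: filterS; first exact: (ae_filter_ringOfSetsType mu).
  move=> x lx xL; have {}lx := lx xL.
  suff : g1 x - g1 x0 = v1 x - v1 x0 by rewrite v1x0 => /addIr.
  case/andP: xL => x0' xL; case/andP: x0L => x00 x0L.
  have [xx|xx|->] := ltgtP x x0; last by rewrite !subrr.
    apply: oppr_inj; rewrite !opprB inc1//; [|exact: ltW|exact: ltW].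
    exact: (weak_derivative_increment wd2).
  rewrite inc1//; [|exact: ltW|exact: ltW].
  exact: (weak_derivative_increment wd2).
have mv1 : measurable_fun (`]0, L[ : set R) v1.
  apply: open_continuous_measurable_fun; first exact: interval_open.
  by move=> x; rewrite inE/= in_itv/=; exact: cv1.
have [iv1 _] := ae_itvoo_Rint_eq ig1 mv1 ae1.
exists v1; split => //.
move=> x xL; apply: (is_derive_increment cv1 iv1 _ xL) => y z y0 yz zL.
rewrite (weak_derivative_increment_closed wd1 cv (ltW y0) yz (ltW zL)).
have ig1' : mu.-integrable `]y, z[ (EFin \o g1) by apply: itvoo_intS ig1; exact: ltW.
apply: (ae_itvoo_Rint_eq ig1' _ _).2.
  by apply: measurable_funS mv1 => //; apply: subset_itvW; exact: ltW.
move: ae1; apply: filterS; first exact: (ae_filter_ringOfSetsType mu).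
by move=> t h /andP[yt tz]; apply: h; rewrite (lt_trans y0)//= (lt_trans tz).
Qed.

End WeakDerivative.

(** * The space L2(0, L) *)

Section L2space.
Context {R : realType} (L : R).
Local Notation mu := (@lebesgue_measure R).

Lemma L2_mul (v w : R -> R) : L2 L v -> L2 L w ->
  mu.-integrable `]0, L[ (EFin \o (fun x => v x * w x)).
Proof.
move=> [mv iv] [mw iw].
apply: (@itvoo_int_le _ _ (fun x => 2^-1 * (v x ^+ 2 + w x ^+ 2))).
- exact: measurable_funM.
- move=> x _; rewrite normrM -(@real_normK _ (v x)) ?num_real// -(@real_normK _ (w x)) ?num_real//.
  by have := sqr_ge0 (`|v x| - `|w x|); lra.
- by apply: itvoo_intZ; exact: itvoo_intD.
Qed.

Lemma L2_bounded (v : R -> R) (c : R) : measurable_fun (`]0, L[ : set R) v ->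
  (forall x, 0 < x < L -> `|v x| <= c) -> L2 L v.
Proof.
move=> mv vc; split => //; apply: (@itvoo_int_le _ _ (fun=> c ^+ 2)).
- exact: measurable_funX.
- move=> x /vc vxc; rewrite normrX; apply: lerXn2r => //; rewrite ?nnegrE//.
  exact: le_trans vxc.
- exact: itvoo_int_cst.
Qed.

Lemma L2_cst (c : R) : L2 L (fun=> c).
Proof. by apply: (@L2_bounded _ `|c|). Qed.

Lemma L2_integrable (v : R -> R) : L2 L v -> mu.-integrable `]0, L[ (EFin \o v).
Proof.
move=> Lv; apply: itvoo_int_eq (L2_mul (L2_cst 1) Lv) => x _.
by rewrite mul1r.
Qed.

Lemma L2D (v w : R -> R) : L2 L v -> L2 L w -> L2 L (fun x => v x + w x).
Proof.
move=> Lv Lw; split; first by apply: measurable_funD; [case: Lv|case: Lw].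
have := itvoo_intD (itvoo_intD (L2_mul Lv Lv) (itvoo_intZ 2 (L2_mul Lv Lw))) (L2_mul Lw Lw).
by apply: itvoo_int_eq => x _; ring.
Qed.

Lemma L2Z (c : R) (v : R -> R) : L2 L v -> L2 L (fun x => c * v x).
Proof.
move=> Lv; split.
  by apply: measurable_funM => //; case: Lv.
by apply: itvoo_int_eq (itvoo_intZ (c * c) (L2_mul Lv Lv)) => x _; ring.
Qed.

Lemma L2B (v w : R -> R) : L2 L v -> L2 L w -> L2 L (fun x => v x - w x).
Proof.
move=> Lv Lw; have := L2D Lv (L2Z (-1) Lw).
by congr L2; apply/funext => x; rewrite mulN1r.
Qed.

Lemma L2_sum (I : Type) (s : seq I) (P : pred I) (F : I -> R -> R) :
  (forall i, P i -> L2 L (F i)) -> L2 L (fun x => \sum_(i <- s | P i) F i x).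
Proof.
move=> LF; elim: s => [|i s IH].
  have := L2_cst 0; congr L2; apply/funext => x.
  by rewrite big_nil.
have [Pi|nPi] := boolP (P i).
  have := L2D (LF _ Pi) IH; congr L2; apply/funext => x.
  by rewrite big_cons Pi.
move: IH; congr L2; apply/funext => x.
by rewrite big_cons (negbTE nPi).
Qed.

Lemma ipC (v w : R -> R) : ip L v w = ip L w v.
Proof. by apply: itvoo_Rint_eq => x _; rewrite mulrC. Qed.

Lemma eq_ip (v v' w : R -> R) : (forall x, 0 < x < L -> v x = v' x) -> ip L v w = ip L v' w.
Proof. by move=> vv; apply: itvoo_Rint_eq => x /vv ->. Qed.

Lemma ipDl (v w z : R -> R) : L2 L v -> L2 L w -> L2 L z ->
  ip L (fun x => v x + w x) z = ip L v z + ip L w z.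
Proof.
move=> Lv Lw Lz; rewrite /ip -itvoo_RintD; [|exact: L2_mul..].
by apply: itvoo_Rint_eq => x _; ring.
Qed.

Lemma ipZl (c : R) (v z : R -> R) : L2 L v -> L2 L z ->
  ip L (fun x => c * v x) z = c * ip L v z.
Proof.
move=> Lv Lz; rewrite /ip -itvoo_RintZ; last exact: L2_mul.
by apply: itvoo_Rint_eq => x _; ring.
Qed.

Lemma ipBl (v w z : R -> R) : L2 L v -> L2 L w -> L2 L z ->
  ip L (fun x => v x - w x) z = ip L v z - ip L w z.
Proof.
move=> Lv Lw Lz; rewrite /ip -itvoo_RintB; [|exact: L2_mul..].
by apply: itvoo_Rint_eq => x _; ring.
Qed.

Lemma ip_suml (I : Type) (s : seq I) (P : pred I) (F : I -> R -> R) (z : R -> R) :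
  (forall i, P i -> L2 L (F i)) -> L2 L z ->
  ip L (fun x => \sum_(i <- s | P i) F i x) z = \sum_(i <- s | P i) ip L (F i) z.
Proof.
move=> LF Lz; rewrite /ip -itvoo_Rint_sum; last by move=> i /LF Li; exact: L2_mul.
by apply: itvoo_Rint_eq => x _; rewrite mulr_suml.
Qed.

Lemma ip_ge0 (v : R -> R) : 0 <= ip L v v.
Proof. by apply: itvoo_Rint_ge0 => x _; rewrite -expr2 sqr_ge0. Qed.

Lemma L2norm_ge0 (v : R -> R) : 0 <= L2norm L v.
Proof. exact: sqrtr_ge0. Qed.

Lemma L2norm_sqr (v : R -> R) : L2norm L v ^+ 2 = ip L v v.
Proof. by rewrite sqr_sqrtr// ip_ge0. Qed.

Lemma eq_L2norm (v v' : R -> R) : (forall x, 0 < x < L -> v x = v' x) -> L2norm L v = L2norm L v'.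
Proof. by move=> vv; rewrite /L2norm (eq_ip _ vv) ipC (eq_ip _ vv). Qed.

Lemma cauchy_schwarz (v w : R -> R) : L2 L v -> L2 L w ->
  `|ip L v w| <= L2norm L v * L2norm L w.
Proof.
move=> Lv Lw; rewrite -(@ler_pXn2r _ 2)// ?nnegrE ?mulr_ge0 ?L2norm_ge0//.
rewrite exprMn !L2norm_sqr real_normK ?num_real//.
have quad c : 0 <= ip L v v - 2 * c * ip L v w + c ^+ 2 * ip L w w.
  have := ip_ge0 (fun x => v x - c * w x).
  have Lcw := L2Z c Lw.
  rewrite ipBl//; last exact: L2B.
  rewrite [ip L v _]ipC [ip L (fun x => c * w x) _]ipC !ipBl// ?ipZl//.
  rewrite [ip L v (fun x => c * w x)]ipC [ip L w (fun x => c * w x)]ipC !ipZl// [ip L w v]ipC.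
  by congr (0 <= _); ring.
have [w0|w0] := eqVneq (ip L w w) 0.
  rewrite w0 mulr0; have [->|vw0] := eqVneq (ip L v w) 0; first by rewrite expr0n.
  (* When [w] has norm zero the quadratic is affine in its parameter, and this value makes it equal
     to -1. *)
  have := quad ((ip L v v + 1) / (2 * ip L v w)); rewrite w0 mulr0 addr0.
  have -> : 2 * ((ip L v v + 1) / (2 * ip L v w)) * ip L v w = ip L v v + 1 by field.
  lra.
have wp : 0 < ip L w w by rewrite lt0r w0 ip_ge0.
have := quad (ip L v w / ip L w w).
have -> : ip L v v - 2 * (ip L v w / ip L w w) * ip L v w + (ip L v w / ip L w w) ^+ 2 * ip L w w
  = (ip L v v * ip L w w - ip L v w ^+ 2) / ip L w w by field.
by rewrite pmulr_lge0 ?invr_gt0// subr_ge0.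
Qed.

Lemma L2norm_D (v w : R -> R) : L2 L v -> L2 L w ->
  L2norm L (fun x => v x + w x) <= L2norm L v + L2norm L w.
Proof.
move=> Lv Lw; rewrite -(@ler_pXn2r _ 2)// ?nnegrE ?addr_ge0 ?L2norm_ge0//.
have Lvw := L2D Lv Lw.
rewrite L2norm_sqr ipDl// [ip L v _]ipC [ip L w _]ipC !ipDl//.
have := cauchy_schwarz Lv Lw; rewrite [ip L w v]ipC -!L2norm_sqr => /(le_trans (ler_norm _)).
lra.
Qed.

Lemma L2normZ (c : R) (v : R -> R) : L2 L v -> L2norm L (fun x => c * v x) = `|c| * L2norm L v.
Proof.
move=> Lv; rewrite /L2norm ipZl//; last exact: L2Z.
by rewrite ipC ipZl// mulrA -expr2 sqrtrM ?sqr_ge0// sqrtr_sqr.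
Qed.

Lemma L2normN (v : R -> R) : L2norm L (fun x => - v x) = L2norm L v.
Proof. by rewrite /L2norm; congr Num.sqrt; apply: itvoo_Rint_eq => x _; rewrite mulrNN. Qed.

Lemma L2norm_B (v w : R -> R) : L2 L v -> L2 L w ->
  L2norm L (fun x => v x - w x) <= L2norm L v + L2norm L w.
Proof.
move=> Lv Lw; apply: (le_trans (L2norm_D Lv _)); last by rewrite L2normN.
by have := L2Z (-1) Lw; congr L2; apply/funext => x; rewrite mulN1r.
Qed.

Hypothesis L0 : 0 < L.

(** The bound holds almost everywhere only, so [v^2] is replaced by its minimum with [g], which is
    dominated by [|g|] everywhere and agrees with [v^2] almost everywhere. *)
Lemma ae_le_sqr_integral (v g : R -> R) : measurable_fun (`]0, L[ : set R) v ->
  mu.-integrable `]0, L[ (EFin \o g) ->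
  {ae mu, forall x, 0 < x < L -> v x ^+ 2 <= g x} ->
  L2 L v /\ L2norm L v ^+ 2 <= \int[mu]_(x in `]0, L[) g x.
Proof.
move=> mv ig ae.
have mv2 : measurable_fun (`]0, L[ : set R) (fun x => v x ^+ 2) by exact: measurable_funX.
pose k x := Num.min (v x ^+ 2) (g x).
have mk : measurable_fun (`]0, L[ : set R) k.
  by apply: measurable_minr => //; exact: itvoo_int_measurable.
have ik : mu.-integrable `]0, L[ (EFin \o k).
  apply: (@itvoo_int_le _ _ (fun x => `|g x|)) => //; last exact: itvoo_int_norm.
  move=> x _; have [h|/ltW h] := leP (v x ^+ 2) (g x).
    by rewrite /k min_l// ger0_norm ?sqr_ge0// (le_trans h)// ler_norm.
  by rewrite /k min_r.
have [iv2 Iv2] : mu.-integrable `]0, L[ (EFin \o (fun x => v x ^+ 2)) /\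
   \int[mu]_(x in `]0, L[) k x = \int[mu]_(x in `]0, L[) (v x ^+ 2).
  apply: ae_itvoo_Rint_eq => //; apply: ae_imp ae => x h /h vg.
  by rewrite /k min_l.
split; first by split.
rewrite L2norm_sqr /ip (itvoo_Rint_eq (g := fun x => v x ^+ 2))//.
rewrite -Iv2; apply: itvoo_Rint_le => // x _.
by rewrite /k ge_min lexx orbT.
Qed.

Lemma L2norm_ae_bounded (v : R -> R) (c : R) : 0 <= c -> measurable_fun (`]0, L[ : set R) v ->
  {ae mu, forall x, 0 < x < L -> `|v x| <= c} -> L2 L v /\ L2norm L v <= c * Num.sqrt L.
Proof.
move=> c0 mv ae.
have [||Lv h] := @ae_le_sqr_integral v (fun=> c ^+ 2) mv; first exact: itvoo_int_cst.
  apply: ae_imp ae => x h /h vc.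
  by rewrite -real_normK ?num_real// lerXn2r ?nnegrE.
split => //; rewrite -(@ler_pXn2r _ 2)// ?nnegrE ?mulr_ge0 ?L2norm_ge0 ?sqrtr_ge0//.
by apply: (le_trans h); rewrite exprMn sqr_sqrtr ?(ltW L0)// itvoo_Rint_cst ?(ltW L0)// subr0.
Qed.

Lemma L1_le_L2norm (v : R -> R) : L2 L v ->
  \int[mu]_(x in `]0, L[) `|v x| <= Num.sqrt L * L2norm L v.
Proof.
move=> Lv; have Lav : L2 L (fun x => `|v x|).
  case: Lv => mv iv; split; first exact: measurableT_comp.
  by apply: itvoo_int_eq iv => x _; rewrite real_normK ?num_real.
have := cauchy_schwarz (L2_cst 1) Lav.
have -> : L2norm L (fun=> 1) = Num.sqrt L.
  by rewrite /L2norm /ip mulr1 itvoo_Rint_cst ?(ltW L0)// mul1r subr0.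
have -> : L2norm L (fun x => `|v x|) = L2norm L v.
  congr Num.sqrt; apply: itvoo_Rint_eq => x _.
  by rewrite -!expr2 real_normK ?num_real.
apply: le_trans; rewrite (le_trans _ (ler_norm _))// le_eqVlt; apply/orP; left; apply/eqP.
by apply: itvoo_Rint_eq => x _; rewrite mul1r.
Qed.

Lemma L2_within (v : R -> R) : {within `[0, L], continuous v} -> L2 L v.
Proof.
move=> cv; have [c vc] := within_bounded cv.
apply: (@L2_bounded _ c); first exact: (itvoo_int_measurable (itvoo_int_within cv)).
by move=> x /andP[x0 xL]; apply: vc; rewrite !ltW.
Qed.

End L2space.

(** * Fubini's theorem on a rectangle *)

Section Fubini.
Context {R : realType}.
Local Notation mu := (@lebesgue_measure R).
Local Notation X := (measurableTypeR R).

Lemma patch_oo (T : pointedType) (g : R -> T) (c d r : R) :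
  (g \_ `]c, d[) r = if c < r < d then g r else point.
Proof.
rewrite patchE; case: ifPn; first by rewrite inE/= in_itv/= => ->.
by rewrite notin_setE/= in_itv/= => /negP/negbTE ->.
Qed.

(** Partial integrals are extended-valued on the whole line; [fine] makes them real functions on the
    interval without changing their integral, as they are finite almost everywhere. *)
Lemma integrable_slice (F : R -> \bar R) (V : R -> R) (a b : R) :
  mu.-integrable setT F -> (forall x, ~~ (a < x < b) -> F x = 0%E) ->
  (forall x, a < x < b -> V x = fine (F x)) ->
  mu.-integrable `]a, b[ (EFin \o V) /\ (\int[mu]_x F x = (\int[mu]_(x in `]a, b[) V x)%:E)%E.
Proof.
move=> iF F0 VF.
have iFab : mu.-integrable `]a, b[ F by exact: integrableS iF.
have mF := measurable_int mu iFab.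
have mV : measurable_fun (`]a, b[ : set R) V.
  apply: (@eq_measurable_fun _ _ _ _ _ (fine \o F)).
    by move=> x; rewrite inE/= in_itv/= => /VF ->.
  exact: measurableT_comp.
have iV : mu.-integrable `]a, b[ (EFin \o V).
  apply: (le_integrable _ _ _ iFab) => //; first exact/measurable_EFinP.
  move=> x /=; rewrite in_itv/= => /VF ->.
  by case: (F x) => [r| |]//=; rewrite normr0 leey.
split => //.
have -> : (\int[mu]_x F x = \int[mu]_(x in `]a, b[) F x)%E.
  rewrite [RHS]integral_mkcond; apply: eq_integral => x _.
  by rewrite patch_oo; case: ifPn => // /F0.
rewrite /Rintegral fineK; last exact: integrable_fin_num.
apply: ae_eq_integral => //; first exact/measurable_EFinP.
have := @integrable_ae _ _ _ mu _ (measurable_itv _) _ iFab.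
apply: ae_imp => x fx xab;  have fF := fx xab.
by move: xab; rewrite /= in_itv/= => /VF ->; rewrite fineK.
Qed.

Variables (a b c d : R) (G : R -> R -> R) (h : R -> R).
Let Q : set (X * X) := (`]a, b[ : set R) `*` (`]c, d[ : set R).

Hypothesis mG : measurable_fun Q (fun z => G z.1 z.2 : R).
Hypothesis ih : mu.-integrable `]c, d[ (EFin \o h).
Hypothesis Gh : {ae mu, forall r, c < r < d -> mu.-integrable `]a, b[ (EFin \o (G^~ r)) /\
  \int[mu]_(x in `]a, b[) `|G x r| <= h r}.

(** Extension by zero, so that the product of two full Lebesgue measures can be used. *)
Let G0 (z : X * X) : R := if (a < z.1 < b) && (c < z.2 < d) then G z.1 z.2 else 0.

Let mG0 : measurable_fun setT G0.
Proof.
have mQ : measurable Q by apply: measurableX; exact: measurable_itv.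
have := (measurable_restrictT _ mQ).1 mG.
apply: eq_measurable_fun => -[x r] _; rewrite /G0/= patchE.
case: ifPn; first by rewrite inE /Q/= !in_itv/= => -[-> ->].
by rewrite notin_setE /Q/= !in_itv/= => h'; case: ifPn => // /andP[h1 h2]; case: h'.
Qed.

Let mE : measurable_fun setT (EFin \o G0). Proof. exact/measurable_EFinP. Qed.

Let iG0 : (mu \x mu)%E.-integrable setT (EFin \o G0).
Proof.
have P := @integrable21ltyP _ _ X X R mu mu (EFin \o G0) mE.
apply: (iffRL P).
pose h0 := (EFin \o h) \_ `]c, d[.
have ih0 : mu.-integrable setT h0 by apply: (iffLR (integrable_mkcond _ _)) => //; exact: measurable_itv.
apply: (@le_lt_trans _ _ (\int[mu]_r `|h0 r|)%E); last by have /integrableP[] := ih0.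
apply: ae_ge0_le_integral => //.
- by move=> r _; exact: integral_ge0.
- apply: (measurable_fun_fubini_tonelli_G (abse \o (EFin \o G0))) => //.
  exact: measurableT_comp.
  by move=> z; exact: abse_ge0.
- by apply: measurableT_comp => //; exact: (measurable_int mu).
apply: filterS Gh; first exact: (ae_filter_ringOfSetsType mu).
move=> r Ghr _; rewrite /h0 patch_oo; case: ifPn => rcd; last first.
  rewrite integral0_eq// => x _; by rewrite /= /G0/= (negbTE rcd) andbF normr0.
have [iGr Ir] := Ghr rcd.
apply: (@le_trans _ _ (\int[mu]_(x in `]a, b[) `|(G x r)%:E|)%E).
  rewrite [leRHS]integral_mkcond le_eqVlt; apply/orP; left; apply/eqP; apply: eq_integral => x _.
  by rewrite patch_oo /= /G0/= rcd andbT; case: ifPn => // _; rewrite normr0.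
have iaG := itvoo_int_norm iGr.
rewrite (_ : (\int[mu]_(x in _) _)%E = (\int[mu]_(x in `]a, b[) `|G x r|)%:E).
  by rewrite /= lee_fin (le_trans Ir)// ler_norm.
by rewrite /Rintegral fineK//; exact: integrable_fin_num.
Qed.

Lemma fubini_integrable_rows : {ae mu, forall x, a < x < b -> mu.-integrable `]c, d[ (EFin \o G x)}.
Proof.
have := @ae_integrable1 _ _ X X R mu mu (EFin \o G0) iG0.
apply: ae_imp => x ix xab; apply/integrable_mkcond => //.
apply: eq_integrable ix => // r _; rewrite patch_oo /= /G0/= xab/=.
by case: ifP.
Qed.

Let F_slice : mu.-integrable `]a, b[ (EFin \o (fun x => \int[mu]_(r in `]c, d[) G x r)) /\
  (\int[mu]_x fubini_F mu (EFin \o G0) x = (\int[mu]_(x in `]a, b[) (\int[mu]_(r in `]c, d[) G x r))%:E)%E.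
Proof.
apply: integrable_slice; first exact: (@integrable_fubini_F _ _ X X R mu mu (EFin \o G0) iG0).
  move=> x xab; rewrite /fubini_F integral0_eq// => r _.
  by rewrite /= /G0/= (negbTE xab).
move=> x xab; rewrite /Rintegral /fubini_F integral_mkcond; congr fine.
by apply: eq_integral => r _; rewrite patch_oo /= /G0/= xab; case: ifPn.
Qed.

Let iGG : mu.-integrable setT (fubini_G mu (EFin \o G0)).
Proof.
have mGG := @measurable_fubini_G _ _ X X R mu mu (EFin \o G0) iG0.
apply/integrableP; split => //.
apply: le_lt_trans ((@integrable21ltyP _ _ X X R mu mu (EFin \o G0) mE).1 iG0).
apply: ge0_le_integral => //.
- exact: measurableT_comp.
- apply: (measurable_fun_fubini_tonelli_G (abse \o (EFin \o G0))) => //.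
  exact: measurableT_comp.
  by move=> z; exact: abse_ge0.
move=> r _; apply: le_abse_integral => //.
by apply: measurableT_comp.
Qed.

Let G_slice : mu.-integrable `]c, d[ (EFin \o (fun r => \int[mu]_(x in `]a, b[) G x r)) /\
  (\int[mu]_r fubini_G mu (EFin \o G0) r = (\int[mu]_(r in `]c, d[) (\int[mu]_(x in `]a, b[) G x r))%:E)%E.
Proof.
apply: integrable_slice; first exact: iGG.
  move=> r rcd; rewrite /fubini_G integral0_eq// => x _.
  by rewrite /= /G0/= (negbTE rcd) andbF.
move=> r rcd; rewrite /Rintegral /fubini_G integral_mkcond; congr fine.
by apply: eq_integral => x _; rewrite patch_oo /= /G0/= rcd andbT; case: ifPn.
Qed.

Lemma fubini_integrable : mu.-integrable `]a, b[ (EFin \o (fun x => \int[mu]_(r in `]c, d[) G x r)).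
Proof. exact: F_slice.1. Qed.

Lemma fubini_integrable_inner : mu.-integrable `]c, d[ (EFin \o (fun r => \int[mu]_(x in `]a, b[) G x r)).
Proof. exact: G_slice.1. Qed.

Lemma fubini_exchange : \int[mu]_(x in `]a, b[) (\int[mu]_(r in `]c, d[) G x r) =
  \int[mu]_(r in `]c, d[) (\int[mu]_(x in `]a, b[) G x r).
Proof.
by apply: EFin_inj; rewrite -F_slice.2 -G_slice.2; exact: (@Fubini _ _ X X R mu mu (EFin \o G0) iG0).
Qed.

Lemma fubini_le : \int[mu]_(x in `]a, b[) (\int[mu]_(r in `]c, d[) G x r) <= \int[mu]_(r in `]c, d[) h r.
Proof.
rewrite fubini_exchange; have iG := G_slice.1.
pose k r := Num.min (\int[mu]_(x in `]a, b[) G x r) (h r).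
have mk : measurable_fun (`]c, d[ : set R) k.
  by apply: measurable_minr; exact: itvoo_int_measurable.
have [ik ->] : mu.-integrable `]c, d[ (EFin \o k) /\
  \int[mu]_(r in `]c, d[) (\int[mu]_(x in `]a, b[) G x r) = \int[mu]_(r in `]c, d[) k r.
  apply: ae_itvoo_Rint_eq => //; apply: filterS Gh; first exact: (ae_filter_ringOfSetsType mu).
  move=> r H /H[iGr Ir]; rewrite /k min_l//; apply: le_trans Ir.
  by apply: itvoo_Rint_le => //; [exact: itvoo_int_norm|move=> x _; exact: ler_norm].
by apply: itvoo_Rint_le => // r _; rewrite /k ge_min lexx orbT.
Qed.

End Fubini.

(** * Time integrals of H^2-valued maps *)

Section Averages.
Context {R : realType}.
Local Notation mu := (@lebesgue_measure R).
Local Notation X := (measurableTypeR R).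

Lemma measurable_inv_ge1 (g : R -> R) (c d : R) : measurable_fun (`]c, d[ : set R) g ->
  (forall r, c < r < d -> 1 <= g r) -> measurable_fun (`]c, d[ : set R) (fun r => (g r)^-1).
Proof.
move=> mg g1.
have cinv : continuous (fun y : R => (Num.max 1 y)^-1).
  move=> y; have : Num.max 1 y != 0 by rewrite gt_eqF// lt_max ltr01.
  move=> h; apply: (@cvgV _ _ _ _ (fun y : R => Num.max 1 y)) => //.
  by apply: (@continuous_max _ _ (fun=> 1) id) => //; exact: cvg_cst.
apply: (@eq_measurable_fun _ _ _ _ _ ((fun y : R => (Num.max 1 y)^-1) \o g)).
  by move=> r; rewrite inE/= in_itv/= => /g1 h; rewrite /= max_r.
apply: measurableT_comp => //; exact: continuous_measurable_fun.
Qed.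

Lemma rectangle_snd (g : R -> R) (a b c d : R) : measurable_fun (`]c, d[ : set R) g ->
  measurable_fun ((`]a, b[ : set R) `*` (`]c, d[ : set R) : set (X * X)) (fun z => g z.2).
Proof.
move=> mg; apply: (@measurable_comp _ _ _ _ _ _ (`]c, d[ : set R) g _ snd) => //.
  by move=> r /= [[x r']/= [_ h] <-].
by apply: measurable_funTS; exact: measurable_snd.
Qed.

Lemma rectangle_fst (g : R -> R) (a b c d : R) : measurable_fun (`]a, b[ : set R) g ->
  measurable_fun ((`]a, b[ : set R) `*` (`]c, d[ : set R) : set (X * X)) (fun z => g z.1).
Proof.
move=> mg; apply: (@measurable_comp _ _ _ _ _ _ (`]a, b[ : set R) g _ fst) => //.
  by move=> r /= [[x r']/= [h _] <-].
by apply: measurable_funTS; exact: measurable_fst.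
Qed.

Lemma itvoo_int_continuous_mul (v s : R -> R) (c d : R) : mu.-integrable `]c, d[ (EFin \o v) ->
  continuous s -> mu.-integrable `]c, d[ (EFin \o (fun y => v y * s y)).
Proof.
move=> iv cs; have [B sB] := @within_bounded R s c d (continuous_subspaceT cs).
apply: (itvoo_int_eq (fun y _ => mulrC (s y) (v y))).
apply: (@itvoo_intM _ _ _ B) => //; last by move=> y /andP[cy yd]; apply: sB; rewrite !ltW.
by apply: measurable_funTS; exact: continuous_measurable_fun.
Qed.

(** Integrate [(l m - g)^2 / m >= 0] and take the optimal [l = A / I]. *)
Lemma weighted_cauchy_schwarz (g m : R -> R) (c d : R) : c < d ->
  mu.-integrable `]c, d[ (EFin \o g) -> mu.-integrable `]c, d[ (EFin \o m) ->
  (forall r, c < r < d -> 1 <= m r) ->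
  mu.-integrable `]c, d[ (EFin \o (fun r => g r ^+ 2 / m r)) ->
  (\int[mu]_(r in `]c, d[) g r) ^+ 2 <=
  (\int[mu]_(r in `]c, d[) m r) * \int[mu]_(r in `]c, d[) (g r ^+ 2 / m r).
Proof.
move=> cd ig im m1 igm.
set I := \int[mu]_(r in _) m r; set J := \int[mu]_(r in _) (_ / _); set A := \int[mu]_(r in _) g r.
have I0 : 0 < I.
  apply: (@lt_le_trans _ _ (\int[mu]_(r in `]c, d[) 1)).
    by rewrite itvoo_Rint_cst ?(ltW cd)// mul1r subr_gt0.
  by apply: itvoo_Rint_le => //; exact: itvoo_int_cst.
have key l : 2 * l * A <= l ^+ 2 * I + J.
  rewrite -[_ * A]itvoo_RintZ// -[_ * I]itvoo_RintZ// -itvoo_RintD//; last exact: itvoo_intZ.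
  apply: itvoo_Rint_le; [exact: itvoo_intZ|by apply: itvoo_intD => //; exact: itvoo_intZ|].
  move=> r /m1 mr1; have mr0 : 0 < m r by apply: lt_le_trans mr1.
  rewrite -subr_ge0.
  suff -> : l ^+ 2 * m r + g r ^+ 2 / m r - 2 * l * g r = (l * m r - g r) ^+ 2 / m r.
    by rewrite divr_ge0 ?sqr_ge0// ltW.
  by field; rewrite gt_eqF.
have := key (A / I).
have -> : 2 * (A / I) * A = 2 * (A ^+ 2 / I) by ring.
have -> : (A / I) ^+ 2 * I = A ^+ 2 / I by field; rewrite gt_eqF.
move=> h; have : A ^+ 2 / I <= J by lra.
by rewrite ler_pdivrMr// mulrC.
Qed.

Section Average.
Variables (L s t : R) (W : R -> R -> R) (m : R -> R).
Hypotheses (L0 : 0 < L) (st : s < t).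
Hypothesis mW : measurable_fun ((`]0, L[ : set R) `*` (`]s, t[ : set R) : set (X * X))
  (fun z => W z.1 z.2 : R).
Hypothesis im : mu.-integrable `]s, t[ (EFin \o m).
Hypothesis m1 : forall r, s < r < t -> 1 <= m r.
Hypothesis Wm : {ae mu, forall r, s < r < t -> L2 L (W^~ r) /\ L2norm L (W^~ r) <= m r}.

Local Notation V := (fun x => \int[mu]_(r in `]s, t[) W x r).

Let Wh : {ae mu, forall r, s < r < t -> mu.-integrable `]0, L[ (EFin \o W^~ r) /\
   \int[mu]_(x in `]0, L[) `|W x r| <= Num.sqrt L * m r}.
Proof.
apply: ae_imp Wm => r h /h[LW Wr]; split; first exact: L2_integrable.
apply: (le_trans (L1_le_L2norm L0 LW)); rewrite ler_wpM2l ?sqrtr_ge0//.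
Qed.

Let ih : mu.-integrable `]s, t[ (EFin \o (fun r => Num.sqrt L * m r)).
Proof. exact: itvoo_intZ. Qed.

Lemma average_integrable : mu.-integrable `]0, L[ (EFin \o V).
Proof. exact: (fubini_integrable mW ih Wh). Qed.

Lemma average_test (psi : R -> R) : continuous psi ->
  mu.-integrable `]s, t[ (EFin \o (fun r => \int[mu]_(x in `]0, L[) (W x r * psi x))) /\
  \int[mu]_(x in `]0, L[) (V x * psi x) =
  \int[mu]_(r in `]s, t[) \int[mu]_(x in `]0, L[) (W x r * psi x).
Proof.
move=> cpsi; have [B psiB] := @within_bounded R psi 0 L (continuous_subspaceT cpsi).
have B0 : 0 <= B by apply: (le_trans (normr_ge0 (psi 0))); apply: psiB; rewrite lexx ltW.
have mWp : measurable_fun ((`]0, L[ : set R) `*` (`]s, t[ : set R) : set (X * X))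
  (fun z => W z.1 z.2 * psi z.1 : R).
  apply: measurable_funM => //; apply: rectangle_fst.
  by apply: measurable_funTS; exact: continuous_measurable_fun.
have ihB : mu.-integrable `]s, t[ (EFin \o (fun r => B * (Num.sqrt L * m r))).
  exact: itvoo_intZ.
have WhB : {ae mu, forall r, s < r < t -> mu.-integrable `]0, L[ (EFin \o (fun x => W x r * psi x)) /\
   \int[mu]_(x in `]0, L[) `|W x r * psi x| <= B * (Num.sqrt L * m r)}.
  apply: ae_imp Wh => r h /h[iW Wr].
  have iWp := itvoo_int_continuous_mul iW cpsi.
  split => //; apply: (le_trans _ (ler_wpM2l B0 Wr)).
  rewrite -itvoo_RintZ; last exact: itvoo_int_norm.
  apply: itvoo_Rint_le; [exact: itvoo_int_norm|by apply: itvoo_intZ; exact: itvoo_int_norm|].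
  move=> x /andP[x0 xL]; rewrite normrM mulrC ler_wpM2r//.
  by apply: psiB; rewrite !ltW.
split; first exact: (fubini_integrable_inner mWp ihB WhB).
rewrite -(fubini_exchange mWp ihB WhB).
have rows := fubini_integrable_rows mW ih Wh.
have iV := itvoo_int_continuous_mul average_integrable cpsi.
have iE := fubini_integrable mWp ihB WhB.
apply: (ae_itvoo_Rint_eq iV (itvoo_int_measurable iE) _).2.
apply: ae_imp rows => x h /h iWx.
rewrite mulrC -itvoo_RintZ//; apply: itvoo_Rint_eq => r _.
exact: mulrC.
Qed.

(** Minkowski's integral inequality. Cauchy-Schwarz with weight [m] bounds the squared average at
    [x] by [I] times the integral of [W^2 / m]; integrating in [x] first produces a second factor
    [I]. The bound [m >= 1] makes the division safe. *)
Lemma average_L2 : L2 L V /\ L2norm L V <= \int[mu]_(r in `]s, t[) m r.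
Proof.
have mV := itvoo_int_measurable average_integrable.
set I := \int[mu]_(r in _) m r.
have I0 : 0 <= I by apply: itvoo_Rint_ge0 => r /m1; apply: le_trans.
have mS : measurable_fun ((`]0, L[ : set R) `*` (`]s, t[ : set R) : set (X * X))
  (fun z => W z.1 z.2 ^+ 2 / m z.2 : R).
  apply: measurable_funM; first exact: measurable_funX.
  apply: (@rectangle_snd (fun r => (m r)^-1)).
  by apply: measurable_inv_ge1 => //; exact: itvoo_int_measurable.
have hS : {ae mu, forall r, s < r < t -> mu.-integrable `]0, L[ (EFin \o (fun x => W x r ^+ 2 / m r)) /\
   \int[mu]_(x in `]0, L[) `|W x r ^+ 2 / m r| <= m r}.
  apply: ae_imp2 Wm Wh => r h1 h2 rst; have [LW Wr] := h1 rst.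
  have mr0 : 0 < m r by apply: lt_le_trans (m1 rst).
  have iq : mu.-integrable `]0, L[ (EFin \o (fun x => (m r)^-1 * W x r ^+ 2)).
    by apply: itvoo_intZ; case: LW.
  split; first by apply: itvoo_int_eq iq => x _; rewrite mulrC.
  rewrite (@itvoo_Rint_eq _ _ (fun x => (m r)^-1 * W x r ^+ 2)); last first.
    by move=> x _; rewrite mulrC ger0_norm// mulr_ge0 ?sqr_ge0// invr_ge0 ltW.
  rewrite itvoo_RintZ; last by case: LW.
  rewrite ler_pdivrMl// -expr2.
  have -> : \int[mu]_(x in `]0, L[) W x r ^+ 2 = L2norm L (W^~ r) ^+ 2.
    by rewrite L2norm_sqr.
  by apply: lerXn2r => //; rewrite nnegrE ?L2norm_ge0// ltW.
have iJ := fubini_integrable mS im hS.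
have Jle := fubini_le mS im hS.
have rows1 := fubini_integrable_rows mW ih Wh.
have rows2 := fubini_integrable_rows mS im hS.
have [||LV VI] := @ae_le_sqr_integral R L V
    (fun x => I * \int[mu]_(r in `]s, t[) (W x r ^+ 2 / m r)) mV.
- exact: itvoo_intZ.
- apply: ae_imp2 rows1 rows2 => x h1 h2 xL.
  by apply: weighted_cauchy_schwarz => //; [exact: h1|exact: h2].
split => //; rewrite -(@ler_pXn2r _ 2)// ?nnegrE ?L2norm_ge0//.
apply: (le_trans VI); rewrite itvoo_RintZ// [leRHS]expr2.
exact: ler_wpM2l.
Qed.

End Average.

Lemma ae_weak_derivative (c d : R) (g g' dg : R -> R) : weak_derivative c d g dg ->
  measurable_fun (`]c, d[ : set R) g' -> {ae mu, forall x, c < x < d -> g x = g' x} ->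
  weak_derivative c d g' dg.
Proof.
move=> [ig idg wd] mg' gg'; have [ig' _] := ae_itvoo_Rint_eq ig mg' gg'.
split => // psi tpsi; rewrite -(wd _ tpsi); have [_ cpsi _] := tpsi.
symmetry; apply: (ae_itvoo_Rint_eq (itvoo_int_continuous_mul ig cpsi) _ _).2.
  exact: (itvoo_int_measurable (itvoo_int_continuous_mul ig' cpsi)).
by apply: ae_imp gg' => x h /h ->.
Qed.

(** For a fixed test function the weak derivative identity is linear, so it passes under the time
    integral by Fubini. *)
Lemma average_weak_derivative (L s t : R) (W W' : R -> R -> R) (m : R -> R) : 0 < L ->
  measurable_fun ((`]0, L[ : set R) `*` (`]s, t[ : set R) : set (X * X)) (fun z => W z.1 z.2 : R) ->
  measurable_fun ((`]0, L[ : set R) `*` (`]s, t[ : set R) : set (X * X)) (fun z => W' z.1 z.2 : R) ->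
  mu.-integrable `]s, t[ (EFin \o m) ->
  {ae mu, forall r, s < r < t -> L2 L (W^~ r) /\ L2norm L (W^~ r) <= m r} ->
  {ae mu, forall r, s < r < t -> L2 L (W'^~ r) /\ L2norm L (W'^~ r) <= m r} ->
  {ae mu, forall r, s < r < t -> weak_derivative 0 L (W^~ r) (W'^~ r)} ->
  weak_derivative 0 L (fun x => \int[mu]_(r in `]s, t[) W x r) (fun x => \int[mu]_(r in `]s, t[) W' x r).
Proof.
move=> L0 mW mW' im Wm Wm' wd.
split; [exact: (average_integrable L0 mW im Wm)|exact: (average_integrable L0 mW' im Wm')|].
move=> psi tpsi; have [dpsi cpsi' _] := tpsi.
have cpsi : continuous psi by move=> x; exact: derivable_continuous.
have [i1 ->] := average_test L0 mW im Wm cpsi'.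
have [i2 ->] := average_test L0 mW' im Wm' cpsi.
rewrite -mulN1r -itvoo_RintZ//.
apply: (ae_itvoo_Rint_eq i1 _ _).2.
  exact: (itvoo_int_measurable (itvoo_intZ _ i2)).
by apply: ae_imp wd => r h /h[_ _ /(_ _ tpsi)]; rewrite mulN1r.
Qed.

Lemma H2_pathD (L : R) (v w v1 w1 g h : R -> R) : H2_path L v v1 g -> H2_path L w w1 h ->
  H2_path L (fun x => v x + w x) (fun x => v1 x + w1 x) (fun x => g x + h x).
Proof.
move=> [cv dv iv ig Lg] [cw dw iw ih Lh]; split.
- by move=> x; apply: cvgD; [exact: cv|exact: cw].
- by move=> x xL; apply: is_deriveD; [exact: dv|exact: dw].
- move=> x y x0 xy yL; have igxy : mu.-integrable `]x, y[ (EFin \o g) by exact: itvoo_intS ig.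
  have ihxy : mu.-integrable `]x, y[ (EFin \o h) by exact: itvoo_intS ih.
  by rewrite itvoo_RintD// -iv// -iw//; ring.
- exact: itvoo_intD.
- exact: L2D.
Qed.

Lemma H2_pathZ (L c : R) (v v1 g : R -> R) : H2_path L v v1 g ->
  H2_path L (fun x => c * v x) (fun x => c * v1 x) (fun x => c * g x).
Proof.
move=> [cv dv iv ig Lg]; split.
- by move=> x; apply: cvgM; [exact: cvg_cst|exact: cv].
- by move=> x xL; have := is_deriveZ c (dv x xL); apply.
- move=> x y x0 xy yL; have igxy : mu.-integrable `]x, y[ (EFin \o g) by exact: itvoo_intS ig.
  by rewrite itvoo_RintZ// -iv// mulrBr.
- exact: itvoo_intZ.
- exact: L2Z.
Qed.

Lemma H2norm_ge (L : R) (g g1 g2 : R -> R) : [/\ L2norm L g <= H2norm L g g1 g2,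
  L2norm L g1 <= H2norm L g g1 g2 & L2norm L g2 <= H2norm L g g1 g2].
Proof.
have s (x : R) : 0 <= x ^+ 2 by exact: sqr_ge0.
have n f := L2norm_ge0 L f.
split; rewrite -(@ler_pXn2r _ 2)// ?nnegrE ?sqrtr_ge0// [leRHS]sqr_sqrtr ?addr_ge0//.
- by rewrite -addrA lerDl addr_ge0.
- by rewrite addrAC lerDr addr_ge0.
- by rewrite lerDr addr_ge0.
Qed.

(** * Regularity of the solution in space at every time *)

Section Space_regularity.
Variables (L T0 T1 : R) (u : R -> R -> R).
Hypotheses (L0 : 0 < L) (T01 : T0 < T1).
Hypothesis cu : continuous_on_rectangle `[0, L] `[T0, T1] u.
Hypothesis u0 : forall t, T0 <= t <= T1 -> u 0 t = 0.

Lemma rectangle_section2 t : T0 <= t <= T1 -> {within `[0, L], continuous (u^~ t)}.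
Proof.
move=> tT; apply/subspace_continuousP => x xL.
have tI : `[T0, T1]%classic t by rewrite /= in_itv.
have := cu => /subspace_continuousP/(_ (x, t) (conj xL tI)) h.
apply/cvgrPdist_lt => e e0; move/cvgrPdist_lt: h => /(_ e e0).
rewrite !near_withinE => -[[/= U V] [Ux Vt] UV].
by apply: filterS Ux => y Uy yL; exact: (UV (y, t) (conj Uy (nbhs_singleton Vt)) (conj yL tI)).
Qed.

(** For almost every [x] the increment is the time integral of the weak derivative [w], so its
    second space derivative is that of [w2], bounded by Minkowski. The pointwise bound integrates
    the space derivative from [x = 0], where [u] vanishes. *)
Lemma time_increment_H2_path : dt_L1_H2 L T0 T1 u ->
  exists m : R -> R, [/\ mu.-integrable `]T0, T1[ (EFin \o m),
    forall r, 1 <= m r &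
    forall s t, T0 <= s -> s < t -> t <= T1 ->
      (exists v1 g2, H2_path L (fun x => u x t - u x s) v1 g2 /\
         L2norm L g2 <= \int[mu]_(r in `]s, t[) m r) /\
      (forall x, 0 <= x <= L -> `|u x t - u x s| <= Num.sqrt L * \int[mu]_(r in `]s, t[) m r)].
Proof.
move=> [w [wu [w1 [w2 [[mw mw1 mw2 aeH2] iH2]]]]].
(* Adding 1 makes [m] an admissible weight in [average_L2] and keeps it integrable on the bounded
   time interval. *)
pose m r := H2norm L (w^~ r) (w1^~ r) (w2^~ r) + 1.
have im : mu.-integrable `]T0, T1[ (EFin \o m).
  by apply: itvoo_intD => //; exact: itvoo_int_cst.
have m1 r : 1 <= m r by rewrite /m lerDr sqrtr_ge0.
exists m; split => // s t T0s st tT1.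
have sub r : s < r < t -> r \in (`]T0, T1[ : set R).
  by rewrite inE/= in_itv/= => /andP[sr rt]; rewrite (le_lt_trans T0s)//= (lt_le_trans rt).
have subQ : ((`]0, L[ : set R) `*` (`]s, t[ : set R) : set (X * X)) `<=`
   (`]0, L[ : set R) `*` (`]T0, T1[ : set R).
  by move=> [x r] /= [xL]; rewrite !in_itv/= => /sub; rewrite inE/= in_itv/=.
have mQ : measurable ((`]0, L[ : set R) `*` (`]T0, T1[ : set R) : set (X * X)).
  by apply: measurableX; exact: measurable_itv.
have {}mw := measurable_funS mQ subQ mw.
have {}mw1 := measurable_funS mQ subQ mw1.
have {}mw2 := measurable_funS mQ subQ mw2.
have imst : mu.-integrable `]s, t[ (EFin \o m) by exact: itvoo_intS im.
have h0 : {ae mu, forall r, s < r < t -> L2 L (w^~ r) /\ L2norm L (w^~ r) <= m r}.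
  apply: ae_imp aeH2 => r h /sub/h[Lw _ _ _ _]; split => //.
  by have [h1 _ _] := H2norm_ge L (w^~ r) (w1^~ r) (w2^~ r); rewrite (le_trans h1)// lerDl.
have h1 : {ae mu, forall r, s < r < t -> L2 L (w1^~ r) /\ L2norm L (w1^~ r) <= m r}.
  apply: ae_imp aeH2 => r h /sub/h[_ Lw _ _ _]; split => //.
  by have [_ h1 _] := H2norm_ge L (w^~ r) (w1^~ r) (w2^~ r); rewrite (le_trans h1)// lerDl.
have h2 : {ae mu, forall r, s < r < t -> L2 L (w2^~ r) /\ L2norm L (w2^~ r) <= m r}.
  apply: ae_imp aeH2 => r h /sub/h[_ _ Lw _ _]; split => //.
  by have [_ _ h1'] := H2norm_ge L (w^~ r) (w1^~ r) (w2^~ r); rewrite (le_trans h1')// lerDl.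
have wd01 : weak_derivative 0 L (fun x => \int[mu]_(r in `]s, t[) w x r) (fun x => \int[mu]_(r in `]s, t[) w1 x r).
  by apply: (average_weak_derivative L0 mw mw1 imst) => //; apply: ae_imp aeH2 => r h /sub/h[].
have wd12 : weak_derivative 0 L (fun x => \int[mu]_(r in `]s, t[) w1 x r) (fun x => \int[mu]_(r in `]s, t[) w2 x r).
  by apply: (average_weak_derivative L0 mw1 mw2 imst) => //; apply: ae_imp aeH2 => r h /sub/h[].
have stT : (T0 <= s <= T1) /\ (T0 <= t <= T1).
  by rewrite T0s tT1 (le_trans (ltW st) tT1) (le_trans T0s (ltW st)).
have cv : {within `[0, L], continuous (fun x => u x t - u x s)}.
  by move=> x; apply: cvgB; [exact: (rectangle_section2 stT.2)|exact: (rectangle_section2 stT.1)].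
have vE : {ae mu, forall x, 0 < x < L -> \int[mu]_(r in `]s, t[) w x r = u x t - u x s}.
  apply: ae_imp wu => x h xL; symmetry.
  apply: (weak_derivative_increment_closed (h _)) => //; first by rewrite inE/= in_itv.
  apply: rectangle_section cu _; rewrite /= in_itv/=.
  by case/andP: xL => /ltW -> /ltW ->.
have wdv := ae_weak_derivative wd01 (itvoo_int_measurable (itvoo_int_within cv)) vE.
have av1 := average_L2 L0 st mw1 imst (fun r _ => m1 r) h1.
have av2 := average_L2 L0 st mw2 imst (fun r _ => m1 r) h2.
have [Lav1 nav1] := av1; have [Lav2 nav2] := av2.
split.
  have [v1 hv1] := weak_derivatives_H2_path L0 cv wdv wd12 Lav2.
  exists v1; exists (fun x => \int[mu]_(r in `]s, t[) w2 x r); split; [exact: hv1|exact: nav2].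
have I0 : 0 <= \int[mu]_(r in `]s, t[) m r by apply: itvoo_Rint_ge0 => r _; exact: le_trans (m1 r).
move=> x /andP[]; rewrite le_eqVlt => /predU1P[<- _|x0 xL].
  by rewrite !u0 ?subrr ?normr0 ?mulr_ge0 ?sqrtr_ge0//; [exact: stT.1|exact: stT.2].
have := weak_derivative_increment_closed wdv cv (lexx 0) x0 xL.
rewrite !u0; [|exact: stT.1|exact: stT.2].
rewrite subrr subr0 => ->.
have [_ iV1 _] := wdv.
have iV1x := itvoo_intS (lexx 0) xL iV1.
apply: (le_trans (itvoo_Rint_norm iV1x)).
apply: (@le_trans _ _ (\int[mu]_(y in `]0, L[) `|\int[mu]_(r in `]s, t[) w1 y r|)).
  move: xL; rewrite le_eqVlt => /predU1P[->//|xL].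
  rewrite (Rintegral_oo_split (ltW x0) xL (itvoo_int_norm iV1)) lerDl.
  exact: itvoo_Rint_ge0.
apply: (le_trans (L1_le_L2norm L0 Lav1)); exact: (ler_wpM2l (sqrtr_ge0 _) nav1).
Qed.

(** The essential bound is available at almost every time; one such time [t0] is fixed, and any
    other is reached by a time increment, at the cost of at most the integral of [m]. *)
Lemma H2_path_bound : Linfty_H2 L T0 T1 u -> dt_L1_H2 L T0 T1 u ->
  exists M : R, 0 <= M /\ forall t, T0 <= t <= T1 ->
    exists v1 g2, H2_path L (u^~ t) v1 g2 /\ L2norm L g2 <= M.
Proof.
move=> [w1 [w2 [[_ _ _ ae1] [M0 ae2]]]] /time_increment_H2_path[m [im m1 inc]].
have ae12 : {ae mu, forall r, T0 < r < T1 -> H2_with L (u^~ r) (w1^~ r) (w2^~ r) /\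
   H2norm L (u^~ r) (w1^~ r) (w2^~ r) <= M0}.
  by apply: ae_imp2 ae1 ae2 => r h1 h2 rT; split; [apply: h1|apply: h2]; rewrite inE/= in_itv.
have [t0 [t0T [[_ _ L2w2 wd1 wd2] nM]]] := ae_itv_exists T01 ae12.
have t0T' : T0 <= t0 <= T1 by case/andP: t0T => /ltW -> /ltW ->.
have [v0 hv0] := weak_derivatives_H2_path L0 (rectangle_section2 t0T') wd1 wd2 L2w2.
have n0 : L2norm L (w2^~ t0) <= M0.
  by have [_ _ h] := H2norm_ge L (u^~ t0) (w1^~ t0) (w2^~ t0); exact: le_trans h nM.
have M00 : 0 <= M0 by apply: le_trans n0; exact: L2norm_ge0.
pose I := \int[mu]_(r in `]T0, T1[) m r.
have Ile s t : T0 <= s -> s < t -> t <= T1 -> 0 <= \int[mu]_(r in `]s, t[) m r <= I.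
  move=> T0s st tT1; have m0 r : 0 <= m r by exact: le_trans (m1 r).
  rewrite itvoo_Rint_ge0//= /I.
  have sT1 : s < T1 by exact: lt_le_trans tT1.
  rewrite (Rintegral_oo_split T0s sT1 im).
  have imsT := itvoo_intS T0s (lexx T1) im.
  move: tT1; rewrite le_eqVlt => /predU1P[->|tT1]; first by rewrite lerDr itvoo_Rint_ge0.
  rewrite (Rintegral_oo_split (ltW st) tT1 imsT).
  by rewrite addrCA lerDl addr_ge0// itvoo_Rint_ge0.
have I0 : 0 <= I by have /andP[h1 h2] := Ile _ _ (lexx T0) T01 (lexx T1).
exists (M0 + I); split; first exact: addr_ge0.
move=> t /andP[T0t tT1]; case/andP: t0T' => T0t0 t0T1.
have [tt0|tt0|->] := ltgtP t t0.
- have [[v1 [g2 [hv ng]]] _] := inc t t0 T0t tt0 t0T1.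
  exists (fun x => v0 x + -1 * v1 x), (fun x => w2 x t0 + -1 * g2 x); split.
    have := H2_pathD hv0 (H2_pathZ (-1) hv); congr H2_path.
    by apply/funext => x; ring.
  have [_ _ _ _ Lg2] := hv.
  apply: (le_trans (L2norm_D L2w2 (L2Z (-1) Lg2))).
  rewrite L2normZ// normrN1 mul1r lerD// (le_trans ng)//.
  by have /andP[] := Ile _ _ T0t tt0 t0T1.
- have [[v1 [g2 [hv ng]]] _] := inc t0 t T0t0 tt0 tT1.
  exists (fun x => v0 x + v1 x), (fun x => w2 x t0 + g2 x); split.
    have := H2_pathD hv0 hv; congr H2_path.
    by apply/funext => x; ring.
  have [_ _ _ _ Lg2] := hv.
  apply: (le_trans (L2norm_D L2w2 Lg2)); rewrite lerD// (le_trans ng)//.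
  by have /andP[] := Ile _ _ T0t0 tt0 tT1.
- exists v0, (w2^~ t0); split => //.
  by rewrite (le_trans n0)// lerDl.
Qed.

End Space_regularity.

End Averages.

(** * Interpolation in the finite element space *)

Section FiniteElements.
Context {R : realType} (L : R) (M : nat) (xs : nat -> R).
Local Notation mu := (@lebesgue_measure R).
Local Notation h := (mesh_size M xs).
Hypothesis hmesh : mesh L M xs.

Let M0 : (0 < M)%N. Proof. by case: hmesh. Qed.
Let xs0 : xs 0%N = 0. Proof. by case: hmesh. Qed.
Let xsM : xs M = L. Proof. by case: hmesh. Qed.
Let xsS i : (i < M)%N -> xs i < xs i.+1. Proof. by case: hmesh => _ _ _; apply. Qed.

Lemma mesh_le i j : (i <= j <= M)%N -> xs i <= xs j.
Proof.
move=> /andP[+ jM]; elim: j jM => [|j IH] jM; first by rewrite leqn0 => /eqP ->.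
rewrite leq_eqVlt => /predU1P[->//|ij].
exact: (le_trans (IH (ltnW jM) ij) (ltW (xsS jM))).
Qed.

Lemma mesh_bounds i : (i <= M)%N -> 0 <= xs i <= L.
Proof. by move=> iM; rewrite -xs0 -xsM !mesh_le//= ?leqnn ?iM. Qed.

Lemma mesh_cell_le i : (i < M)%N -> xs i.+1 - xs i <= h.
Proof. by move=> iM; rewrite /mesh_size (le_bigmax _ (fun i : 'I_M => xs i.+1 - xs i) (Ordinal iM)). Qed.

Lemma mesh_size_ge0 : 0 <= h.
Proof. by apply: (le_trans _ (mesh_cell_le M0)); rewrite subr_ge0 ltW// xsS. Qed.

Definition slope (v : R -> R) (i : nat) : R := (v (xs i.+1) - v (xs i)) / (xs i.+1 - xs i).

Lemma slope_mul v i : (i < M)%N -> slope v i * (xs i.+1 - xs i) = v (xs i.+1) - v (xs i).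
Proof. by move=> iM; rewrite /slope divfK// subr_eq0 gt_eqF// xsS. Qed.

Definition piecewise_affine (v : R -> R) : Prop := forall i x, (i < M)%N ->
  xs i <= x <= xs i.+1 -> v x = v (xs i) + slope v i * (x - xs i).

Lemma fem_piecewise_affine v : fem_space L M xs v -> piecewise_affine v.
Proof.
move=> [_ _ aff] i x iM xi; have [c [d cd]] := aff _ iM.
have lt := xsS iM.
have e0 : v (xs i) = c * xs i + d by apply: cd; rewrite inE/= in_itv/= lexx ltW.
have e1 : v (xs i.+1) = c * xs i.+1 + d by apply: cd; rewrite inE/= in_itv/= lexx ltW.
have ex : v x = c * x + d by apply: cd; rewrite inE/= in_itv.
rewrite /slope e0 e1 ex; field.
by rewrite subr_eq0 gt_eqF.
Qed.

Lemma piecewise_affine_fem v : piecewise_affine v -> v 0 = 0 -> v L = 0 -> fem_space L M xs v.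
Proof.
move=> aff v0 vL; split => // i iM; exists (slope v i), (v (xs i) - slope v i * xs i) => x.
by rewrite inE/= in_itv/= => /(aff _ _ iM) ->; ring.
Qed.

Lemma fem_spaceB v w : fem_space L M xs v -> fem_space L M xs w ->
  fem_space L M xs (fun x => v x - w x).
Proof.
move=> [v0 vL av] [w0 wL aw]; split; rewrite ?v0 ?w0 ?vL ?wL ?subrr//.
move=> i iM; have [c [d cd]] := av _ iM; have [c' [d' cd']] := aw _ iM.
by exists (c - c'), (d - d') => x xi; rewrite (cd x xi) (cd' x xi); ring.
Qed.

Lemma piecewise_affine_is_derive v i x : piecewise_affine v -> (i < M)%N ->
  xs i < x < xs i.+1 -> is_derive x 1 v (slope v i).
Proof.
move=> aff iM /andP[ix xi]; apply: is_derive_eps => e e0; near=> d.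
have d1 : xs i <= x + d.
  have : `|d| < x - xs i by near: d; apply: (@nbhs0_lt _ R); rewrite subr_gt0.
  by rewrite ltr_norml => /andP[]; lra.
have d2 : x + d <= xs i.+1.
  have : `|d| < xs i.+1 - x by near: d; apply: (@nbhs0_lt _ R); rewrite subr_gt0.
  by rewrite ltr_norml => /andP[]; lra.
rewrite (aff i (x + d))// ?d1// (aff i x)// ?(ltW ix) ?(ltW xi)//.
rewrite (_ : _ - _ = 0); last by ring.
by rewrite normr0 mulr_ge0// ltW.
Unshelve. all: by end_near. Qed.

Lemma piecewise_affine_derive1 v i x : piecewise_affine v -> (i < M)%N ->
  xs i < x < xs i.+1 -> derive1 v x = slope v i.
Proof.
by move=> aff iM xi; rewrite derive1E; case: (piecewise_affine_is_derive aff iM xi).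
Qed.

Lemma L2_cells (v : R -> R) :
  (forall i, (i < M)%N -> exists2 w : R -> R, continuous w & forall x, xs i < x < xs i.+1 -> v x = w x) ->
  L2 L v.
Proof.
move=> cells; rewrite /L2.
have mv : measurable_fun (`]0, L[ : set R) v.
  rewrite -{1}xs0 -xsM; apply: measurable_cells => // i iM; have [w cw vw] := cells _ iM.
  apply: (@eq_measurable_fun _ _ _ _ _ w).
    by move=> x; rewrite inE/= in_itv/= => /vw ->.
  by apply: measurable_funTS; exact: continuous_measurable_fun.
split => //; rewrite -{1}xs0 -xsM.
apply: (@integrable_cells R (fun x => v x ^+ 2)) => // i iM; have [w cw vw] := cells _ iM.
apply: (@itvoo_int_eq _ (fun x => w x ^+ 2)); first by move=> x /vw ->.
apply: itvoo_int_within; apply: continuous_subspaceT => x.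
exact: (cvgM (cw x) (cw x)).
Qed.

Lemma piecewise_affine_L2 v : piecewise_affine v -> L2 L v.
Proof.
move=> aff; apply: L2_cells => i iM.
exists (fun x => v (xs i) + slope v i * (x - xs i)).
  move=> x; apply: cvgD; first exact: cvg_cst.
  apply: cvgM; first exact: cvg_cst.
  by apply: cvgB; [exact: cvg_id|exact: cvg_cst].
by move=> x /andP[x1 x2]; apply: aff => //; rewrite !ltW.
Qed.

Lemma piecewise_affine_derive1_L2 v : piecewise_affine v -> L2 L (derive1 v).
Proof.
move=> aff; apply: L2_cells => i iM; exists (fun=> slope v i); first by move=> x; exact: cvg_cst.
by move=> x xi; exact: piecewise_affine_derive1.
Qed.

(* Each clamp is affine on one cell and constant on the others, so the slopes
   can be prescribed cell by cell. *)
Definition interpolant (v : R -> R) (x : R) : R :=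
  v 0 + \sum_(0 <= i < M) slope v i * Num.min (Num.max (x - xs i) 0) (xs i.+1 - xs i).

(** Clamps of earlier cells are saturated and telescope, those of later cells vanish. *)
Lemma interpolant_cell v i x : (i < M)%N -> xs i <= x <= xs i.+1 ->
  interpolant v x = v (xs i) + slope v i * (x - xs i).
Proof.
move=> iM /andP[ix xi]; rewrite /interpolant (big_cat_nat (n := i))//=; last exact: ltnW.
rewrite (@big_ltn _ _ _ i M)//= addrA.
have -> : \sum_(i.+1 <= j < M) slope v j * Num.min (Num.max (x - xs j) 0) (xs j.+1 - xs j) = 0.
  rewrite big_nat_cond big1// => j /andP[/andP[ij jM] _].
  rewrite max_r ?min_l ?mulr0// ?subr_ge0 ?(ltW (xsS jM))// subr_le0 (le_trans xi)//.
  by rewrite mesh_le// ij ltnW.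
have -> : \sum_(0 <= j < i) slope v j * Num.min (Num.max (x - xs j) 0) (xs j.+1 - xs j) =
   \sum_(0 <= j < i) (v (xs j.+1) - v (xs j)).
  apply: eq_big_nat => j /andP[_ ji]; have jM := ltn_trans ji iM.
  have xj : xs j.+1 <= x by rewrite (le_trans _ ix)// mesh_le// ji ltnW.
  rewrite max_l ?min_r ?slope_mul ?lerD2r// subr_ge0 (le_trans _ xj)// ltW// xsS//.
rewrite telescope_sumr// xs0 max_l ?subr_ge0// min_l ?lerD2r//; ring.
Qed.

Lemma interpolant_node v i : (i <= M)%N -> interpolant v (xs i) = v (xs i).
Proof.
rewrite leq_eqVlt => /predU1P[->|iM]; last first.
  by rewrite (@interpolant_cell v i)// ?lexx ?(ltW (xsS iM))// subrr mulr0 addr0.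
have M1 : (M.-1 < M)%N by rewrite prednK.
have e := slope_mul v M1; rewrite (@interpolant_cell v M.-1)//; last first.
  by rewrite prednK// lexx andbT -{2}(prednK M0) ltW// xsS.
by rewrite prednK// in e *; rewrite e addrC subrK.
Qed.

Lemma interpolant_slope v i : (i < M)%N -> slope (interpolant v) i = slope v i.
Proof. by move=> iM; rewrite /slope !interpolant_node// ltnW. Qed.

Lemma interpolant_piecewise_affine v : piecewise_affine (interpolant v).
Proof.
by move=> i x iM xi; rewrite interpolant_slope// interpolant_node ?(ltnW iM)// -interpolant_cell.
Qed.

Lemma interpolant_fem v : v 0 = 0 -> v L = 0 -> fem_space L M xs (interpolant v).
Proof.
move=> v0 vL; apply: piecewise_affine_fem; first exact: interpolant_piecewise_affine.
  by rewrite -xs0 interpolant_node// xs0.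
by rewrite -xsM interpolant_node// xsM.
Qed.

Lemma interpolantB v w x : interpolant (fun y => v y - w y) x = interpolant v x - interpolant w x.
Proof.
rewrite /interpolant opprD addrACA -sumrB; congr (_ + _).
by apply: eq_bigr => i _; rewrite /slope; ring.
Qed.

(** One piece of a Riemann-type integration by parts: the increment of [v] is a value of [v1] times
    the length, so the error involves only increments of [v1] within the piece. *)
Lemma H2_path_piece (v v1 g : R -> R) (A y1 y2 : R) : H2_path L v v1 g ->
  0 <= y1 -> y1 < y2 -> y2 <= L -> A <= y1 ->
  `|\int[mu]_(x in `]y1, y2[) ((x - A) * g x) -
    ((y2 - A) * v1 y2 - (y1 - A) * v1 y1 - (v y2 - v y1))| <=
  2 * (y2 - y1) * \int[mu]_(x in `]y1, y2[) `|g x|.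
Proof.
move=> [cv dv iv ig Lg] y10 y12 y2L Ay.
have igy : mu.-integrable `]y1, y2[ (EFin \o g) by exact: itvoo_intS ig.
have [xi xiy mvt] : exists2 xi, y1 < xi < y2 & v y2 - v y1 = v1 xi * (y2 - y1).
  have [||xi + h1] := @MVT R v v1 y1 y2 y12; last by rewrite in_itv/= => h2; exists xi.
  - by move=> x; rewrite in_itv/= => /andP[h1 h2]; apply: dv; rewrite (le_lt_trans y10)//= (lt_le_trans h2).
  - apply: continuous_subspaceW cv => x /=; rewrite !in_itv/= => /andP[h1 h2].
    by rewrite (le_trans y10)//= (le_trans h2).
have [/andP[yxi xiy2]] := xiy.
have xi0 : 0 <= xi by rewrite (le_trans y10)// ltW.
have e1 := iv xi y2 xi0 xiy2 y2L.
have e2 := iv y1 y2 y10 y12 y2L.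
have i1 : mu.-integrable `]y1, y2[ (EFin \o (fun x => (x - y1) * g x)).
  apply: itvoo_int_eq (itvoo_int_continuous_mul igy (s := fun x => x - y1) _) => [x _|x].
    exact: mulrC.
  by apply: cvgB; [exact: cvg_id|exact: cvg_cst].
have -> : \int[mu]_(x in `]y1, y2[) ((x - A) * g x) =
   \int[mu]_(x in `]y1, y2[) ((x - y1) * g x) + (y1 - A) * \int[mu]_(x in `]y1, y2[) g x.
  rewrite -itvoo_RintZ// -itvoo_RintD//; last exact: itvoo_intZ.
  by apply: itvoo_Rint_eq => x _; ring.
rewrite mvt -e2.
have -> : \int[mu]_(x in `]y1, y2[) ((x - y1) * g x) + (y1 - A) * (v1 y2 - v1 y1) -
   ((y2 - A) * v1 y2 - (y1 - A) * v1 y1 - v1 xi * (y2 - y1)) =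
   \int[mu]_(x in `]y1, y2[) ((x - y1) * g x) - (y2 - y1) * (v1 y2 - v1 xi) by ring.
rewrite e1 -mulrA mulr_natl mulr2n.
apply: (le_trans (ler_normB _ _)); apply: lerD.
  apply: (le_trans (itvoo_Rint_norm i1)); rewrite -itvoo_RintZ; last exact: itvoo_int_norm.
  apply: itvoo_Rint_le; [exact: itvoo_int_norm|by apply: itvoo_intZ; exact: itvoo_int_norm|].
  move=> x /andP[x1 x2]; rewrite normrM ler_wpM2r// gtr0_norm ?subr_gt0//.
  by rewrite lerD2r ltW.
rewrite normrM gtr0_norm ?subr_gt0// ler_wpM2l ?subr_ge0 ?(ltW y12)//.
have igx : mu.-integrable `]xi, y2[ (EFin \o g) by apply: itvoo_intS igy => //; exact: ltW.
apply: (le_trans (itvoo_Rint_norm igx)).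
rewrite [leRHS](Rintegral_oo_split (ltW yxi) xiy2 (itvoo_int_norm igy)) lerDr.
exact: itvoo_Rint_ge0.
Qed.

(** Integration by parts when [v1] is only the primitive of an integrable function: on [n] equal
    pieces the errors of [H2_path_piece] add up to order [1 / n]. *)
Lemma H2_path_taylor (v v1 g : R -> R) (A B : R) : H2_path L v v1 g -> 0 <= A -> A < B -> B <= L ->
  \int[mu]_(x in `]A, B[) ((x - A) * g x) = (B - A) * v1 B - (v B - v A).
Proof.
move=> hv A0 AB BL; have [_ _ _ ig _] := hv.
have igA : mu.-integrable `]A, B[ (EFin \o g) by exact: itvoo_intS ig.
have iA : mu.-integrable `]A, B[ (EFin \o (fun x => (x - A) * g x)).
  apply: itvoo_int_eq (itvoo_int_continuous_mul igA (s := fun x => x - A) _) => [x _|x].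
    exact: mulrC.
  by apply: cvgB; [exact: cvg_id|exact: cvg_cst].
apply/eqP; rewrite -subr_eq0 -normr_le0; apply/ler_addgt0Pr => e e0; rewrite add0r.
set I := \int[mu]_(x in `]A, B[) `|g x|; set Z := `|_|.
have I0 : 0 <= I by exact: itvoo_Rint_ge0.
have bound n : (0 < n)%N -> Z <= 2 * (B - A) / n%:R * I.
  move=> n0; pose r := (B - A) / n%:R; pose y k := A + k%:R * r.
  have nR : 0 < n%:R :> R by rewrite ltr0n.
  have r0 : 0 < r by rewrite divr_gt0// subr_gt0.
  have yS k : y k < y k.+1 by rewrite /y ltrD2l ltr_pM2r// ltr_nat.
  have yd k : y k.+1 - y k = r by rewrite /y -natr1; ring.
  have y0 : y 0%N = A by rewrite /y mul0r addr0.
  have yn : y n = B by rewrite /y /r mulrC divfK ?gt_eqF// addrC subrK.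
  have yA k : A <= y k by rewrite /y lerDl mulr_ge0// ltW.
  have yB k : (k <= n)%N -> y k <= B.
    by move=> kn; rewrite -yn /y lerD2l ler_pM2r// ler_nat.
  have := @Rintegral_cells R (fun x => (x - A) * g x) y n (fun k _ => yS k).
  rewrite y0 yn => /(_ iA) e1.
  have := @Rintegral_cells R (fun x => `|g x|) y n (fun k _ => yS k).
  rewrite y0 yn => /(_ (itvoo_int_norm igA)) e2.
  have e3 : (B - A) * v1 B - (v B - v A) =
     \sum_(0 <= k < n) ((y k.+1 - A) * v1 (y k.+1) - (y k - A) * v1 (y k) - (v (y k.+1) - v (y k))).
    have := telescope_sumr (fun k => (y k - A) * v1 (y k) - v (y k)) (leq0n n).
    rewrite y0 yn subrr mul0r => h1.
    transitivity ((B - A) * v1 B - v B - (0 - v A)); first by ring.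
    by rewrite -h1; apply: eq_bigr => k _; ring.
  rewrite /Z e1 e3 -sumrB /I e2.
  have -> : 2 * (B - A) / n%:R = 2 * r by rewrite /r; ring.
  rewrite mulr_sumr; apply: (le_trans (ler_norm_sum _ _ _)); apply: ler_sum_nat => k /andP[_ kn].
  have := @H2_path_piece v v1 g A (y k) (y k.+1) hv (le_trans A0 (yA k)) (yS k) (le_trans (yB _ kn) BL) (yA k).
  by rewrite yd.
have BA0 : 0 <= 2 * (B - A) * I by rewrite !mulr_ge0// subr_ge0 ltW.
pose n := (Num.truncn (2 * (B - A) * I / e)).+1.
apply: (le_trans (bound n (ltn0Sn _))).
have nR : 0 < n%:R :> R by rewrite ltr0n.
by rewrite mulrAC ler_pdivrMr// [e * _]mulrC -ler_pdivrMr// ltW// /n truncnS_gt.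
Qed.

(** On a cell [z] is affine, so integrating [g z] by parts leaves the products [z v1] at the nodes,
    which telescope to 0, and the slope of [z] times the increment of [v], which sees nodal values
    only. *)
Lemma interpolation_orthogonality (v v1 g z : R -> R) : H2_path L v v1 g -> fem_space L M xs z ->
  ip L (derive1 (interpolant v)) (derive1 z) = - ip L g z.
Proof.
move=> hv hz; have az := fem_piecewise_affine hz; have [z0 zL _] := hz.
have [_ _ iv ig Lg] := hv.
have aI := interpolant_piecewise_affine v.
have LI := piecewise_affine_derive1_L2 aI; have Lz' := piecewise_affine_derive1_L2 az.
have Lz := piecewise_affine_L2 az.
have e1 : ip L (derive1 (interpolant v)) (derive1 z) = \sum_(0 <= i < M) slope z i * (v (xs i.+1) - v (xs i)).
  have iI := L2_mul LI Lz'.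
  have := @Rintegral_cells R (fun x => derive1 (interpolant v) x * derive1 z x) xs M xsS.
  rewrite xs0 xsM /ip => /(_ iI) ->.
  apply: eq_big_nat => i /andP[_ iM].
  rewrite (@itvoo_Rint_eq _ _ (fun=> slope v i * slope z i)).
    by rewrite itvoo_Rint_cst ?(ltW (xsS iM))// -slope_mul//; ring.
  move=> x xi; rewrite (piecewise_affine_derive1 aI iM xi) (piecewise_affine_derive1 az iM xi).
  by rewrite interpolant_slope.
have e2 : ip L g z = \sum_(0 <= i < M)
   ((z (xs i.+1) * v1 (xs i.+1) - z (xs i) * v1 (xs i)) - slope z i * (v (xs i.+1) - v (xs i))).
  have iI := L2_mul Lg Lz.
  have := @Rintegral_cells R (fun x => g x * z x) xs M xsS.
  rewrite xs0 xsM /ip => /(_ iI) ->.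
  apply: eq_big_nat => i /andP[_ iM].
  have /andP[xi0 _] := mesh_bounds (ltnW iM); have /andP[_ xiL] := mesh_bounds iM.
  have igi : mu.-integrable `]xs i, xs i.+1[ (EFin \o g) by exact: itvoo_intS ig.
  have iA : mu.-integrable `]xs i, xs i.+1[ (EFin \o (fun x => (x - xs i) * g x)).
    apply: itvoo_int_eq (itvoo_int_continuous_mul igi (s := fun x => x - xs i) _) => [x _|x].
      exact: mulrC.
    by apply: cvgB; [exact: cvg_id|exact: cvg_cst].
  rewrite (@itvoo_Rint_eq _ _ (fun x => z (xs i) * g x + slope z i * ((x - xs i) * g x))); last first.
    by move=> x /andP[x1 x2]; rewrite (az i x iM)// ?(ltW x1) ?(ltW x2)//; ring.
  rewrite itvoo_RintD ?itvoo_RintZ//; [|exact: itvoo_intZ|exact: itvoo_intZ].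
  rewrite (H2_path_taylor hv xi0 (xsS iM) xiL) -(iv _ _ xi0 (xsS iM) xiL).
  have -> : z (xs i.+1) = z (xs i) + slope z i * (xs i.+1 - xs i) by rewrite slope_mul// addrC subrK.
  ring.
rewrite e1 e2 sumrB (telescope_sumr (fun i => z (xs i) * v1 (xs i)))// xs0 xsM z0 zL.
by ring.
Qed.

Lemma cell_cauchy_schwarz (g : R -> R) (c d : R) : c < d ->
  mu.-integrable `]c, d[ (EFin \o g) -> mu.-integrable `]c, d[ (EFin \o (fun x => g x ^+ 2)) ->
  (\int[mu]_(x in `]c, d[) `|g x|) ^+ 2 <= (d - c) * \int[mu]_(x in `]c, d[) (g x ^+ 2).
Proof.
move=> cd ig ig2.
have sq x : `|g x| ^+ 2 / 1 = g x ^+ 2 by rewrite divr1 real_normK ?num_real.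
have := @weighted_cauchy_schwarz R (fun x => `|g x|) (fun=> 1) c d cd (itvoo_int_norm ig) (itvoo_int_cst 1 c d).
rewrite itvoo_Rint_cst ?(ltW cd)// mul1r.
have -> : \int[mu]_(x in `]c, d[) (g x ^+ 2) = \int[mu]_(x in `]c, d[) (`|g x| ^+ 2 / 1).
  by apply: itvoo_Rint_eq => x _; rewrite sq.
by apply=> //; apply: itvoo_int_eq ig2 => x _; rewrite sq.
Qed.

(** By the mean value theorem the slope of the interpolant and the chord of [v] up to [x] are both
    values of [v1] in the cell, and these differ by at most the integral of [|g|]. *)
Lemma interpolation_error_cell (v v1 g : R -> R) i x : H2_path L v v1 g -> (i < M)%N ->
  xs i < x < xs i.+1 ->
  `|v x - interpolant v x| <= h * \int[mu]_(y in `]xs i, xs i.+1[) `|g y|.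
Proof.
move=> hv iM /andP[x1 x2]; have [cv dv iv ig Lg] := hv.
have lt := xsS iM.
have /andP[xi0 _] := mesh_bounds (ltnW iM); have /andP[_ xiL] := mesh_bounds iM.
have igi : mu.-integrable `]xs i, xs i.+1[ (EFin \o g) by exact: itvoo_intS ig.
have igi' := itvoo_int_norm igi.
have mvt y1 y2 : xs i <= y1 -> y1 < y2 -> y2 <= xs i.+1 ->
    exists2 xi, y1 < xi < y2 & v y2 - v y1 = v1 xi * (y2 - y1).
  move=> h1 h12 h2; have [||xi + h3] := @MVT R v v1 y1 y2 h12; last by rewrite in_itv/= => h4; exists xi.
  - move=> y; rewrite in_itv/= => /andP[h3 h4]; apply: dv.
    by rewrite (le_lt_trans (le_trans xi0 h1))//= (lt_le_trans (lt_le_trans h4 h2)).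
  - apply: continuous_subspaceW cv => y /=; rewrite !in_itv/= => /andP[h3 h4].
    by rewrite (le_trans (le_trans xi0 h1))//= (le_trans (le_trans h4 h2)).
have [xi /andP[xi1 xi2] exi] := mvt _ _ (lexx _) lt (lexx _).
have [eta /andP[et1 et2] eeta] := mvt _ _ (lexx _) x1 (ltW x2).
have sl : slope v i = v1 xi by rewrite /slope exi mulfK// subr_eq0 gt_eqF.
rewrite (interpolant_cell v iM) ?(ltW x1) ?(ltW x2)// sl.
have -> : v x - (v (xs i) + v1 xi * (x - xs i)) = (v1 eta - v1 xi) * (x - xs i).
  by rewrite mulrBl -eeta; ring.
rewrite normrM mulrC (@gtr0_norm _ (x - xs i)) ?subr_gt0//.
have osc y1 y2 : xs i < y1 -> y1 < y2 -> y2 < xs i.+1 ->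
    `|v1 y2 - v1 y1| <= \int[mu]_(y in `]xs i, xs i.+1[) `|g y|.
  move=> h1 h12 h2; rewrite iv//; last 2 first.
  - exact: le_trans xi0 (ltW h1).
  - exact: le_trans (ltW h2) xiL.
  have ig12 : mu.-integrable `]y1, y2[ (EFin \o g) by apply: itvoo_intS igi; exact: ltW.
  apply: (le_trans (itvoo_Rint_norm ig12)).
  have h1' : y1 < xs i.+1 := lt_trans h12 h2.
  rewrite (Rintegral_oo_split (ltW h1) h1' igi').
  have igy := itvoo_intS (ltW h1) (lexx _) igi'.
  rewrite (Rintegral_oo_split (ltW h12) h2 igy) addrCA lerDl.
  by rewrite addr_ge0// itvoo_Rint_ge0.
apply: ler_pM; rewrite ?subr_ge0 ?(ltW x1)//.
  by apply: le_trans (mesh_cell_le iM); rewrite lerD2r ltW.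
have etx : eta < xs i.+1 by exact: lt_trans x2.
have [e1|e1|->] := ltgtP eta xi.
- by rewrite distrC; apply: osc.
- exact: osc.
- by rewrite subrr normr0 itvoo_Rint_ge0.
Qed.

(** Cauchy-Schwarz on a cell costs one factor [h] and the length of the cell another, so the squared
    error there is at most [h^4] times the local squared norm of [g]. *)
Lemma interpolation_error (v v1 g : R -> R) : H2_path L v v1 g ->
  L2norm L (fun x => v x - interpolant v x) <= h ^+ 2 * L2norm L g.
Proof.
move=> hv; have [cv dv iv ig [mg ig2]] := hv.
have h0 := mesh_size_ge0.
have aI := interpolant_piecewise_affine v.
have Le : L2 L (fun x => v x - interpolant v x).
  by apply: L2B; [exact: L2_within|exact: piecewise_affine_L2].
rewrite -(@ler_pXn2r _ 2)// ?nnegrE ?mulr_ge0 ?L2norm_ge0 ?exprn_ge0//.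
rewrite exprMn !L2norm_sqr /ip.
have := @Rintegral_cells R (fun x => (v x - interpolant v x) * (v x - interpolant v x)) xs M xsS.
rewrite xs0 xsM => /(_ (L2_mul Le Le)) ->.
have := @Rintegral_cells R (fun x => g x * g x) xs M xsS.
rewrite xs0 xsM => /(_ ig2) ->.
rewrite mulr_sumr; apply: ler_sum_nat => i /andP[_ iM].
have lt := xsS iM.
have /andP[xi0 _] := mesh_bounds (ltnW iM); have /andP[_ xiL] := mesh_bounds iM.
have igi : mu.-integrable `]xs i, xs i.+1[ (EFin \o g) by exact: itvoo_intS ig.
have ig2i : mu.-integrable `]xs i, xs i.+1[ (EFin \o (fun x => g x ^+ 2)) by exact: itvoo_intS ig2.
set J := \int[mu]_(x in `]xs i, xs i.+1[) (g x * g x).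
set I := \int[mu]_(y in `]xs i, xs i.+1[) `|g y|.
have I0 : 0 <= I by exact: itvoo_Rint_ge0.
have J0 : 0 <= J by apply: itvoo_Rint_ge0 => y _; rewrite -expr2 sqr_ge0.
have hi := mesh_cell_le iM.
have hi0 : 0 <= xs i.+1 - xs i by rewrite subr_ge0 ltW.
have IJ : I ^+ 2 <= h * J.
  by apply: (le_trans (cell_cauchy_schwarz lt igi ig2i)); rewrite ler_wpM2r.
apply: (@le_trans _ _ (\int[mu]_(x in `]xs i, xs i.+1[) ((h * I) ^+ 2))).
  apply: itvoo_Rint_le; [|exact: itvoo_int_cst|].
    exact: itvoo_intS (L2_mul Le Le).
  move=> x xi; have := interpolation_error_cell hv iM xi => b.
  rewrite -expr2 -real_normK ?num_real//; apply: lerXn2r b => //; rewrite nnegrE//.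
  exact: mulr_ge0.
rewrite itvoo_Rint_cst ?(ltW lt)//.
apply: (@le_trans _ _ (h ^+ 2 * (h * J) * h)).
  apply: ler_pM => //; first by rewrite sqr_ge0.
  by rewrite exprMn ler_wpM2l ?sqr_ge0.
by rewrite le_eqVlt; apply/orP; left; apply/eqP; ring.
Qed.

End FiniteElements.

(** * Error equation and energy estimate *)

Section Consistency.
Context {R : realType} (alpha tau p a b L : R) (K : nat) (f phi u : R -> R -> R) (Creg : R).
Local Notation mu := (@lebesgue_measure R).
Local Notation T := (K%:R * tau).
Local Notation sigma := (Num.min alpha (1 - alpha)).
Hypotheses (alpha01 : 0 < alpha < 1) (tau0 : 0 < tau) (K0 : (0 < K)%N) (L0 : 0 < L).
Hypothesis hf : continuous_on_rectangle `]0, L[ `[0, T] f.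
Hypothesis hu : delay_solution alpha tau K p a b L f phi u.
Hypothesis hreg : time_regular alpha tau K L Creg u.

Variable N : nat.
Hypothesis N0 : (0 < N)%N.
Local Notation t := (tm tau N).
Local Notation r := (step tau N).
Local Notation U := (fun (n : int) x => u x (t n)).

Let r0 : 0 < r. Proof. exact: step_gt0. Qed.

Lemma tm_lt (i j : int) : i < j -> t i < t j.
Proof. by move=> ij; rewrite /tm ltr_pM2r// ltr_int. Qed.

Lemma tm_le (i j : int) : i <= j -> t i <= t j.
Proof. by move=> ij; rewrite /tm ler_pM2r// ler_int. Qed.

Lemma tm_history : t (- (2 * N)%:Z) = - tau.
Proof. by rewrite /tm mulrNz mulNr -[in RHS](mul_step tau N0) -pmulrn. Qed.

Lemma tm_final : t (2 * K * N)%:Z = T.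
Proof. by rewrite /tm -[in RHS](mul_step tau N0) -pmulrn mulrA -natrM mulnCA mulnA. Qed.

Lemma tm_delay (k : int) : t k - tau = t (k - (2 * N)%:Z).
Proof. by rewrite /tm intrB mulrBl -[((2 * N)%:Z)%:~R]pmulrn (mul_step tau N0). Qed.

Lemma tm_range (n : int) : - (2 * N)%:Z <= n <= (2 * K * N)%:Z -> - tau <= t n <= T.
Proof. by move=> /andP[n1 n2]; rewrite -tm_history -tm_final !tm_le. Qed.

Let cu : continuous_on_rectangle `[0, L] `[- tau, T] u. Proof. by case: hu. Qed.

Lemma solution_section (n : int) : - (2 * N)%:Z <= n <= (2 * K * N)%:Z ->
  {within `[0, L], continuous (U n)}.
Proof. by move=> /tm_range nT; exact: (rectangle_section2 cu nT). Qed.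

Lemma solution_L2 (n : int) : - (2 * N)%:Z <= n <= (2 * K * N)%:Z -> L2 L (U n).
Proof. by move=> /solution_section; exact: L2_within. Qed.

Lemma solution_boundary (n : int) : - (2 * N)%:Z <= n <= (2 * K * N)%:Z -> u 0 (t n) = 0 /\ u L (t n) = 0.
Proof. by move=> /tm_range nT; case: hu => _ _ h _ _; apply: h; rewrite inE/= in_itv. Qed.

Lemma solution_regular_path x : 0 < x < L -> regular_path alpha tau K Creg (u x).
Proof.
move=> xL; split; last first.
  move=> k s k1 sk; have xI : x \in (`]0, L[ : set R) by rewrite inE/= in_itv.
  have sI : s \in (`](k%:R - 1) * tau, k%:R * tau[ : set R) by rewrite inE/= in_itv.
  by have := hreg xI k1 sI.
have xc : `[0, L]%classic x by rewrite /= in_itv/=; case/andP: xL => /ltW -> /ltW ->.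
apply: continuous_subspaceW (rectangle_section cu xc) => s /=.
by rewrite !in_itv/= => /andP[s0 ->]; rewrite andbT (le_trans _ s0)// oppr_le0 ltW.
Qed.

Variable m : R -> R.
Hypothesis im : mu.-integrable `]- tau, T[ (EFin \o m).
Hypothesis m_ge0 : forall s, 0 <= m s.
Hypothesis um : forall x s s', - tau <= s -> s < s' -> s' <= T -> 0 <= x <= L ->
  `|u x s' - u x s| <= Num.sqrt L * \int[mu]_(y in `]s, s'[) m y.

Definition mcell (k : int) : R := \int[mu]_(s in `]t (k - 1), t k[) m s.

(** Cells are disjoint, so one integral bounds the sum for every mesh. The shift is 0 for the
    increments of the space error and [- 2N] for the delay term. *)
Lemma mcell_sum (j : int) (n : nat) : - (2 * N)%:Z <= j -> j + n%:Z <= (2 * K * N)%:Z ->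
  \sum_(1 <= k < n.+1) mcell (k%:Z + j) <= \int[mu]_(s in `]- tau, T[) m s.
Proof.
move=> jN jnK; have tau_t : - tau <= t j by rewrite -tm_history tm_le.
have t_T : t (j + n%:Z) <= T by rewrite -tm_final tm_le.
have ij : mu.-integrable `]t (j + 0%N), t (j + n%:Z)[ (EFin \o m).
  by apply: itvoo_intS im => //; rewrite addr0.
have := @Rintegral_cells R m (fun k => t (j + k%:Z)) n _ ij.
have inc k : (k < n)%N -> t (j + k%:Z) < t (j + k.+1%:Z).
  by move=> _; apply: tm_lt; rewrite ltrD2l ltz_nat.
move=> /(_ inc) e1.
have -> : \sum_(1 <= k < n.+1) mcell (k%:Z + j) = \int[mu]_(s in `]t (j + 0%N), t (j + n%:Z)[) m s.
  rewrite e1 big_add1/=; apply: eq_big_nat => k _; rewrite /mcell.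
  have -> : k.+1%:Z + j - 1 = j + k%:Z by rewrite -addn1 PoszD; ring.
  by rewrite [k.+1%:Z + j]addrC.
rewrite addr0; case: n jnK t_T ij inc e1 => [|n] jnK t_T ij inc e1.
  by rewrite addr0 set_itvoo0 Rintegral_set0 itvoo_Rint_ge0.
have jj : t j < t (j + n.+1%:Z) by apply: tm_lt; rewrite ltrDl ltz_nat.
have jT : t j < T by exact: lt_le_trans t_T.
rewrite (Rintegral_oo_split tau_t jT im).
have imj := itvoo_intS tau_t (lexx T) im.
move: t_T; rewrite le_eqVlt => /predU1P[->|t_T]; first by rewrite lerDr itvoo_Rint_ge0.
rewrite (Rintegral_oo_split (ltW jj) t_T imj).
by rewrite addrCA lerDl addr_ge0// itvoo_Rint_ge0.
Qed.

(** Shifting by [tau] moves the mesh onto itself by [2N] cells, so the oscillation of the delayed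
    factor is controlled by the integral of [m] over one cell. *)
Lemma delay_quadrature_error (n : nat) x : (0 < n <= 2 * K * N)%N -> 0 < x < L ->
  `|frac_int (1 - alpha) (fun s => b * u x (s - tau)) (t n) - b * L1_J alpha tau N U n x| <=
  \sum_(1 <= k < n.+1) r * L1coef alpha tau N n k * (`|b| * Num.sqrt L * mcell (k%:Z - (2 * N)%:Z)).
Proof.
move=> /andP[n0 nKN] xL.
have xL' : 0 <= x <= L by case/andP: xL => /ltW -> /ltW ->.
have tT : t n <= T by rewrite -tm_final tm_le// lez_nat.
pose g s := b * u x (s - tau).
have cg : {within `[0, t n], continuous g}.
  have xc : `[0, L]%classic x by rewrite /= in_itv.
  have cx := rectangle_section cu xc.
  apply/subspace_continuousP => s; rewrite /= in_itv/= => /andP[s0 st].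
  apply: cvgM; first exact: cvg_cst.
  have sI : `[- tau, T]%classic (s - tau).
    rewrite /= in_itv/= lerBlDr lerBrDr addNr s0/= (le_trans st)// (le_trans tT)// lerDl ltW//.
  have := cx => /subspace_continuousP/(_ _ sI) => h.
  apply/cvgrPdist_lt => e e0; move/cvgrPdist_lt: h => /(_ e e0).
  rewrite !near_withinE => -[d /= d0 dH]; exists d => // s' ss' s'I.
  apply: dH; first by rewrite /= (_ : s - tau - (s' - tau) = s - s')//; ring.
  move: s'I; rewrite /= !in_itv/= => /andP[s'0 s't].
  by rewrite lerBlDr lerBrDr addNr s'0/= (le_trans s't)// (le_trans tT)// lerDl ltW.
have -> : b * L1_J alpha tau N U n x = \sum_(1 <= k < n.+1) r * L1coef alpha tau N n k * g (t k).
  rewrite /L1_J mulr_sumr; apply: eq_bigr => k _.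
  by rewrite /g tm_delay; ring.
apply: frac_int_quadrature => // k s /andP[k0 kn] /andP[s1 s2].
have kKN := leq_trans kn nKN.
rewrite /g -mulrBr normrM -mulrA ler_wpM2l//.
have h1 : - tau <= s - tau.
  rewrite lerBrDr addNr (le_trans _ (ltW s1))// -[leLHS](mul0r r).
  by rewrite ler_pM2r// ler0z subr_ge0 lez_nat.
have h2 : t k - tau <= T.
  by rewrite tm_delay -tm_final tm_le// lerBlDr -PoszD lez_nat (leq_trans kKN)// leq_addr.
have h3 : s - tau < t k - tau by rewrite ltrD2r.
rewrite distrC; apply: (le_trans (um h1 h3 h2 xL')).
rewrite ler_wpM2l ?sqrtr_ge0// /mcell -!tm_delay.
have -> : t (k%:Z - (2 * N)%:Z - 1) = t (k%:Z - 1) - tau by rewrite tm_delay addrAC.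
have i1 : mu.-integrable `]t (k%:Z - 1) - tau, t k - tau[ (EFin \o m).
  apply: itvoo_intS im => //.
  by rewrite lerBrDr addNr -[leLHS](mul0r r) ler_pM2r// ler0z subr_ge0 lez_nat.
have h4 : t (k%:Z - 1) - tau <= s - tau by rewrite lerD2r ltW.
by rewrite (Rintegral_oo_split h4 h3 i1) lerDr itvoo_Rint_ge0.
Qed.

(** [delay_solution] provides a classical second derivative at every interior point, H^2 regularity
    a density [g2]; the two agree at the Lebesgue points of [g2]. *)
Lemma classical_second_derivative (n : nat) (v1 g2 : R -> R) : (0 < n <= 2 * K * N)%N ->
  H2_path L (U n) v1 g2 ->
  {ae mu, forall x, 0 < x < L -> derive1n 2 (u^~ (t n)) x = g2 x}.
Proof.
move=> /andP[n0 nKN] [cv dv iv ig Lg].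
apply: ae_imp (ae_right_lebesgue_pt ig) => x lx xL; have {}lx := lx xL.
have d1 y : 0 < y < L -> derive1 (u^~ (t n)) y = v1 y.
  by move=> yL; rewrite derive1E; case: (dv y yL).
have tI : t n \in (`]0, T] : set R).
  rewrite inE/= in_itv/= -tm_final tm_le ?lez_nat// andbT.
  by rewrite mulr_gt0// ltr0z ltz_nat.
have [_ _ _ hd _] := hu; have xI : x \in (`]0, L[ : set R) by rewrite inE/= in_itv.
have [_ dd] := hd x _ xI tI.
symmetry; apply: (is_derive_increment_unique ig _ xL lx (v := derive1 (u^~ (t n)))).
  move=> y z y0 yz zL; rewrite !d1 ?(lt_trans y0 yz) ?(lt_trans yz zL) ?y0 ?zL//.
  by apply: iv => //; exact: ltW.
by rewrite derive1nS derive1n1 derive1E; exact: derivableP.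
Qed.

(** The defect of the exact solution in the scheme, with the density [g2] in place of the classical
    second derivative so that it can be tested in L2. *)
Definition residual (n : nat) (g2 : R -> R) (x : R) : R :=
  L1_D alpha tau N U n x - p * g2 x - a * U n x - b * L1_J alpha tau N U n x
  - frac_int (1 - alpha) (f x) (t n).

Lemma L1_D_L2 (w : int -> R -> R) (n : nat) : (n <= 2 * K * N)%N ->
  (forall i : int, - (2 * N)%:Z <= i <= (2 * K * N)%:Z -> L2 L (w i)) ->
  L2 L (L1_D alpha tau N w n).
Proof.
move=> nKN Lw; rewrite /L1_D.
have -> : (fun x => \sum_(1 <= k < n.+1) L1coef alpha tau N n k * (w k%:Z x - w (k%:Z - 1) x)) =
   fun x => \sum_(1 <= k < n.+1 | (0 < k <= n)%N) L1coef alpha tau N n k * (w k%:Z x - w (k%:Z - 1) x).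
  by apply/funext => x; rewrite big_nat_cond [RHS]big_nat_cond; apply: eq_bigl => k; rewrite ltnS andbT andbb.
apply: L2_sum => k /andP[k0 kn]; apply: L2Z; apply: L2B; apply: Lw.
  by apply/andP; split; [rewrite (le_trans (y := 0))// oppr_le0|rewrite lez_nat (leq_trans kn)].
apply/andP; split; first by rewrite (le_trans (y := 0)) ?oppr_le0// subr_ge0 lez_nat.
by rewrite lerBlDr -PoszD lez_nat (leq_trans kn)// (leq_trans nKN)// leq_addr.
Qed.

Lemma L1_J_L2 (w : int -> R -> R) (n : nat) : (n <= 2 * K * N)%N ->
  (forall i : int, - (2 * N)%:Z <= i <= (2 * K * N)%:Z -> L2 L (w i)) ->
  L2 L (L1_J alpha tau N w n).
Proof.
move=> nKN Lw; rewrite /L1_J.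
have -> : (fun x => \sum_(1 <= k < n.+1) r * L1coef alpha tau N n k * w (k%:Z - (2 * N)%:Z) x) =
   fun x => \sum_(1 <= k < n.+1 | (0 < k <= n)%N) r * L1coef alpha tau N n k * w (k%:Z - (2 * N)%:Z) x.
  by apply/funext => x; rewrite big_nat_cond [RHS]big_nat_cond; apply: eq_bigl => k; rewrite ltnS andbT andbb.
apply: L2_sum => k /andP[k0 kn]; apply: L2Z; apply: Lw.
rewrite lerBrDr addNr le0z_nat/= lerBlDr -PoszD lez_nat (leq_trans kn)// (leq_trans nKN)// leq_addr//.
Qed.

(** Inserting the equation leaves only the truncation error of the L1 formula and the quadrature
    error of the delay. Both bounds are uniform in [x], and [sqrt L] is the norm of the constant
    1. *)
Lemma residual_bound (n : nat) (v1 g2 : R -> R) : (0 < n <= 2 * K * N)%N -> H2_path L (U n) v1 g2 ->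
  L2 L (residual n g2) /\
  L2norm L (residual n g2) <=
   (truncation_const alpha tau K Creg * (n%:R `^ (- sigma - 1) + r) +
    \sum_(1 <= k < n.+1) r * L1coef alpha tau N n k * (`|b| * Num.sqrt L * mcell (k%:Z - (2 * N)%:Z)))
   * Num.sqrt L.
Proof.
move=> hn hv; have [_ _ _ _ Lg] := hv; have /andP[n0 nKN] := hn.
have nr : - (2 * N)%:Z <= n%:Z <= (2 * K * N)%:Z.
  by apply/andP; split; [rewrite (le_trans (y := 0))// oppr_le0|rewrite lez_nat].
have tn : 0 < t n <= T by rewrite -tm_final tm_le ?lez_nat// andbT mulr_gt0// ltr0z ltz_nat.
have L1 := L1_D_L2 nKN solution_L2; have L2' := L1_J_L2 nKN solution_L2.
have mr : measurable_fun (`]0, L[ : set R) (residual n g2).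
  apply: measurable_funB; last exact: (frac_int_measurable alpha01 hf tn).
  have := L2B (L2B (L2B L1 (L2Z p Lg)) (L2Z a (solution_L2 nr))) (L2Z b L2').
  by case.
set Bd := _ + _.
have ae : {ae mu, forall x, 0 < x < L -> `|residual n g2 x| <= Bd}.
  apply: ae_imp (classical_second_derivative hn hv) => x dx xL.
  have xI : x \in (`]0, L[ : set R) by rewrite inE/= in_itv.
  have tI : t n \in (`]0, T] : set R) by rewrite inE/= in_itv.
  have [_ _ _ _ /(_ x _ xI tI)] := hu; rewrite (dx xL) => pde.
  have tr := truncation alpha01 tau0 K0 (solution_regular_path xL) N0 hn.
  have qd := delay_quadrature_error hn xL.
  rewrite /residual.
  have -> : L1_D alpha tau N U n x - p * g2 x - a * U n x - b * L1_J alpha tau N U n x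
     - frac_int (1 - alpha) (f x) (t n) =
     (L1_D alpha tau N U n x - caputo alpha (u x) (t n)) +
     (frac_int (1 - alpha) (fun s => b * u x (s - tau)) (t n) - b * L1_J alpha tau N U n x).
    by rewrite pde; ring.
  apply: (le_trans (ler_normD _ _)); exact: lerD tr qd.
(* Nonnegativity of the bound is read off at one point where it holds. *)
have Bd0 : 0 <= Bd.
  have [x [xL hx]] := ae_itv_exists L0 ae.
  exact: le_trans (normr_ge0 _) hx.
exact: L2norm_ae_bounded.
Qed.

End Consistency.

(** * From the tested error equation to scalar inequalities *)

Section EnergyEstimate.
Context {R : realType}.

Lemma nondecreasing_abel (B d : nat -> R) n :
  (forall k, (1 <= k <= n.+1)%N -> 0 <= B k) -> (forall k, (1 <= k <= n)%N -> B k <= B k.+1) ->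
  (forall k, (k <= n.+1)%N -> 0 <= d k) -> \sum_(1 <= k < n.+2) B k * (d k - d k.-1) <= B n.+1 * d n.+1.
Proof.
elim: n => [|n IH] B0 Binc d0.
  by rewrite big_nat1 /= ler_wpM2l ?B0// lerBlDr lerDl d0.
rewrite big_nat_recr//=.
have := IH _ _ (fun k kn => d0 k (leqW kn)).
have h1 k : (1 <= k <= n.+1)%N -> 0 <= B k by move=> /andP[k1 kn]; apply: B0; rewrite k1 leqW.
have h2 k : (1 <= k <= n)%N -> B k <= B k.+1 by move=> /andP[k1 kn]; apply: Binc; rewrite k1 leqW.
move=> /(_ h1 h2) h3.
have h4 : B n.+1 * d n.+1 <= B n.+2 * d n.+1 by rewrite ler_wpM2r ?Binc//= ?leqnn ?d0.
by move: h3; set S := \sum_(_ <= _ < _) _; lra.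
Qed.

(* With [x k = (e_k, e_n)], [y k = ||e_k||] and [B] the L1 weights, testing the
   discrete fractional derivative with [e_n] bounds that of the norms. *)
Lemma energy_comparison (B x y : nat -> R) (c S : R) n :
  (forall k, (1 <= k <= n.+1)%N -> 0 <= B k) -> (forall k, (1 <= k <= n)%N -> B k <= B k.+1) ->
  (forall k, 0 <= y k) -> c = y n.+1 -> (forall k, (k <= n.+1)%N -> x k <= y k * c) -> x n.+1 = c ^+ 2 -> 0 <= S ->
  \sum_(1 <= k < n.+2) B k * (x k - x k.-1) <= c * S ->
  \sum_(1 <= k < n.+2) B k * (y k - y k.-1) <= S.
Proof.
move=> B0 Binc y0 cE xy xn S0 xS.
have c0 : 0 <= c by rewrite cE.
move: (c0); rewrite le_eqVlt => /predU1P[c00|cgt0].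
  (* If [e_n] vanishes no division by its norm is possible, but then the Abel bound for the norms
     themselves is 0. *)
  apply: le_trans S0; apply: (le_trans (nondecreasing_abel B0 Binc (fun k _ => y0 k))).
  by rewrite -cE -c00 mulr0.
(* The Cauchy-Schwarz gap [y k c - x k] is nonnegative and vanishes at the last index, so its
   weighted increments sum to at most 0. *)
have := @nondecreasing_abel B (fun k => y k * c - x k) n B0 Binc.
have d0 k : (k <= n.+1)%N -> 0 <= y k * c - x k by move=> kn; rewrite subr_ge0 xy.
move=> /(_ d0); rewrite xn -cE -expr2 subrr mulr0.
have -> : \sum_(1 <= k < n.+2) B k * (y k * c - x k - (y k.-1 * c - x k.-1)) =
   c * \sum_(1 <= k < n.+2) B k * (y k - y k.-1) - \sum_(1 <= k < n.+2) B k * (x k - x k.-1).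
  by rewrite mulr_sumr -sumrB; apply: eq_bigr => k _; ring.
rewrite subr_le0 => /le_trans/(_ xS); by rewrite ler_pM2l.
Qed.

End EnergyEstimate.

Section ErrorEquation.
Context {R : realType} (alpha tau p a b L : R) (K : nat) (f phi u : R -> R -> R) (Creg : R).
Local Notation mu := (@lebesgue_measure R).
Local Notation T := (K%:R * tau).
Local Notation sigma := (Num.min alpha (1 - alpha)).
Hypotheses (alpha01 : 0 < alpha < 1) (tau0 : 0 < tau) (K0 : (0 < K)%N) (L0 : 0 < L).
Hypotheses (p0 : 0 < p) (a0 : a <= 0).
Hypothesis hf : continuous_on_rectangle `]0, L[ `[0, T] f.
Hypothesis hu : delay_solution alpha tau K p a b L f phi u.
Hypothesis hreg : time_regular alpha tau K L Creg u.
Variables (N M : nat) (xs : nat -> R) (uh : int -> R -> R).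
Hypothesis N0 : (0 < N)%N.
Hypothesis hmesh : mesh L M xs.
Hypothesis huh : fem_solution alpha tau K p a b L f N M xs uh.
Local Notation t := (tm tau N).
Local Notation r := (step tau N).
Local Notation U := (fun (n : int) x => u x (t n)).
Local Notation h := (mesh_size M xs).
Local Notation interp := (interpolant M xs).
Local Notation in_time n := (- (2 * N)%:Z <= n <= (2 * K * N)%:Z).

Definition total_error (n : int) (x : R) : R := u x (t n) - uh n x.
Definition space_error (n : int) (x : R) : R := u x (t n) - interp (U n) x.
Definition nodal_error (n : int) (x : R) : R := interp (U n) x - uh n x.

Lemma nat_in_time (n : nat) : (n <= 2 * K * N)%N -> in_time n%:Z.
Proof. by move=> nK; apply/andP; split; [rewrite (le_trans (y := 0))// oppr_le0|rewrite lez_nat]. Qed.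

Lemma prev_in_time (n : nat) : (0 < n <= 2 * K * N)%N -> in_time (n%:Z - 1).
Proof.
move=> /andP[n0 nK]; apply/andP; split; first by rewrite (le_trans (y := 0)) ?oppr_le0// subr_ge0 lez_nat.
by rewrite lerBlDr -PoszD lez_nat (leq_trans nK)// leq_addr.
Qed.

Lemma delayed_in_time (n : nat) : (n <= 2 * K * N)%N -> in_time (n%:Z - (2 * N)%:Z).
Proof.
by move=> nK; rewrite lerBrDr addNr le0z_nat/= lerBlDr -PoszD lez_nat (leq_trans nK)// leq_addr.
Qed.

Lemma interp_solution_fem n : in_time n -> fem_space L M xs (interp (U n)).
Proof.
by move=> nt; have [h0 hL] := solution_boundary tau0 hu N0 nt; exact: (interpolant_fem hmesh h0 hL).
Qed.

Lemma nodal_error_fem n : in_time n -> fem_space L M xs (nodal_error n).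
Proof.
move=> nt; have [huh1 _] := huh.
by apply: fem_spaceB; [exact: interp_solution_fem|exact: huh1].
Qed.

Lemma uh_L2 n : in_time n -> L2 L (uh n).
Proof.
have [huh1 _] := huh.
by move=> nt; exact: (piecewise_affine_L2 hmesh (fem_piecewise_affine hmesh (huh1 _ nt))).
Qed.

Lemma interp_L2 n : in_time n -> L2 L (interp (U n)).
Proof. by move=> nt; exact: (piecewise_affine_L2 hmesh (interpolant_piecewise_affine hmesh _)). Qed.

Lemma space_error_L2 n : in_time n -> L2 L (space_error n).
Proof. by move=> nt; apply: L2B; [exact: (solution_L2 tau0 hu N0 nt)|exact: interp_L2]. Qed.

Lemma nodal_error_L2 n : in_time n -> L2 L (nodal_error n).
Proof. by move=> nt; apply: L2B; [exact: interp_L2|exact: uh_L2]. Qed.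

Lemma total_error_L2 n : in_time n -> L2 L (total_error n).
Proof. by move=> nt; apply: L2B; [exact: (solution_L2 tau0 hu N0 nt)|exact: uh_L2]. Qed.

Lemma ip_derive1 v z : piecewise_affine M xs v -> piecewise_affine M xs z ->
  ip L (derive1 v) (derive1 z) = \sum_(0 <= i < M) slope xs v i * slope xs z i * (xs i.+1 - xs i).
Proof.
move=> av az; have iI := L2_mul (piecewise_affine_derive1_L2 hmesh av) (piecewise_affine_derive1_L2 hmesh az).
have [_ xs0 xsM xsS] := hmesh.
have := @Rintegral_cells R (fun x => derive1 v x * derive1 z x) xs M xsS.
rewrite xs0 xsM /ip => /(_ iI) ->.
apply: eq_big_nat => i /andP[_ iM].
rewrite (@itvoo_Rint_eq _ _ (fun=> slope xs v i * slope xs z i)).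
  by rewrite itvoo_Rint_cst ?(ltW (xsS _ iM)).
by move=> x xi; rewrite (piecewise_affine_derive1 av iM xi) (piecewise_affine_derive1 az iM xi).
Qed.

Lemma ip_derive1_coercive v w : fem_space L M xs v -> fem_space L M xs w ->
  0 <= ip L (derive1 v) (derive1 (fun x => v x - w x)) - ip L (derive1 w) (derive1 (fun x => v x - w x)).
Proof.
move=> fv fw; have av := fem_piecewise_affine hmesh fv; have aw := fem_piecewise_affine hmesh fw.
have avw := fem_piecewise_affine hmesh (fem_spaceB fv fw).
rewrite !ip_derive1// -sumrB; rewrite big_nat_cond; apply: sumr_ge0 => i /andP[/andP[_ iM] _].
have -> : slope xs (fun x => v x - w x) i = slope xs v i - slope xs w i by rewrite /slope; ring.
rewrite -mulrBl -mulrBl mulr_ge0//; first by rewrite -expr2 sqr_ge0.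
by have [_ _ _ xsS] := hmesh; rewrite subr_ge0 ltW// xsS.
Qed.

Lemma ip_L1_D (w : int -> R -> R) (n : nat) z : (n <= 2 * K * N)%N ->
  (forall i, in_time i -> L2 L (w i)) -> L2 L z ->
  ip L (L1_D alpha tau N w n) z =
  \sum_(1 <= k < n.+1) L1coef alpha tau N n k * (ip L (w k%:Z) z - ip L (w (k%:Z - 1)) z).
Proof.
move=> nKN Lw Lz; rewrite /L1_D.
have -> : (fun x => \sum_(1 <= k < n.+1) L1coef alpha tau N n k * (w k%:Z x - w (k%:Z - 1) x)) =
   fun x => \sum_(1 <= k < n.+1 | (0 < k <= n)%N) L1coef alpha tau N n k * (w k%:Z x - w (k%:Z - 1) x).
  by apply/funext => x; rewrite big_nat_cond [RHS]big_nat_cond; apply: eq_bigl => k; rewrite ltnS andbT andbb.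
have LD k : (0 < k <= n)%N -> L2 L (w k%:Z) /\ L2 L (w (k%:Z - 1)).
  move=> /andP[k0 kn]; split; apply: Lw; first by rewrite nat_in_time// (leq_trans kn).
  by rewrite prev_in_time// k0 (leq_trans kn).
rewrite ip_suml//; last first.
  by move=> k /LD[L1 L2']; apply: L2Z; exact: L2B.
rewrite big_nat_cond [RHS]big_nat_cond; apply: eq_big => [k|k]; first by rewrite ltnS andbT andbb.
by move=> /andP[_ /LD[L1 L2']]; rewrite ipZl ?ipBl//; exact: L2B.
Qed.

Lemma ip_L1_J (w : int -> R -> R) (n : nat) z : (n <= 2 * K * N)%N ->
  (forall i, in_time i -> L2 L (w i)) -> L2 L z ->
  ip L (L1_J alpha tau N w n) z =
  \sum_(1 <= k < n.+1) r * L1coef alpha tau N n k * ip L (w (k%:Z - (2 * N)%:Z)) z.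
Proof.
move=> nKN Lw Lz; rewrite /L1_J.
have -> : (fun x => \sum_(1 <= k < n.+1) r * L1coef alpha tau N n k * w (k%:Z - (2 * N)%:Z) x) =
   fun x => \sum_(1 <= k < n.+1 | (0 < k <= n)%N) r * L1coef alpha tau N n k * w (k%:Z - (2 * N)%:Z) x.
  by apply/funext => x; rewrite big_nat_cond [RHS]big_nat_cond; apply: eq_bigl => k; rewrite ltnS andbT andbb.
have LD k : (0 < k <= n)%N -> L2 L (w (k%:Z - (2 * N)%:Z)).
  by move=> /andP[k0 kn]; apply: Lw; rewrite delayed_in_time// (leq_trans kn).
rewrite ip_suml//; last by move=> k /LD L1; exact: L2Z.
rewrite big_nat_cond [RHS]big_nat_cond; apply: eq_big => [k|k]; first by rewrite ltnS andbT andbb.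
by move=> /andP[_ /LD L1]; rewrite ipZl.
Qed.

Lemma L1coef_ge0 n k : (0 < k <= n)%N -> 0 <= L1coef alpha tau N n k.
Proof.
move=> kn; rewrite L1coefE// mulr_ge0 ?divr_ge0 ?powR_ge0//.
  by rewrite ltW// Gamma2B_gt0.
by rewrite ltW// L1weight_gt0.
Qed.

Lemma L1coef_nondecreasing n k : (0 < k < n)%N -> L1coef alpha tau N n k <= L1coef alpha tau N n k.+1.
Proof.
move=> /andP[k0 kn]; rewrite !L1coefE// ?k0 ?(ltnW kn)// ler_wpM2l//.
  by rewrite divr_ge0 ?powR_ge0// ltW// Gamma2B_gt0.
by rewrite -(subnSK kn) L1weight_noninc.
Qed.

(** The scheme is subtracted from the definition of the residual tested with [z]. By
    [interpolation_orthogonality] the term in [g2] becomes the stiffness of the interpolant, whereas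
    the zero order term keeps the total error. *)
Lemma error_equation (n : nat) (v1 g2 z : R -> R) : (0 < n <= 2 * K * N)%N -> H2_path L (U n) v1 g2 ->
  L2 L (residual alpha tau p a b f u N n g2) -> fem_space L M xs z ->
  ip L (L1_D alpha tau N U n) z - ip L (L1_D alpha tau N uh n) z
  + p * (ip L (derive1 (interp (U n))) (derive1 z) - ip L (derive1 (uh n)) (derive1 z)) =
  a * ip L (total_error n) z
  + b * (ip L (L1_J alpha tau N U n) z - ip L (L1_J alpha tau N uh n) z)
  + ip L (residual alpha tau p a b f u N n g2) z.
Proof.
move=> hn hv Lres fz; have /andP[n0 nKN] := hn; have [_ _ _ _ Lg] := hv.
have Lz := piecewise_affine_L2 hmesh (fem_piecewise_affine hmesh fz).
have LU := solution_L2 tau0 hu N0; have nt := nat_in_time nKN.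
have LDU := @L1_D_L2 R alpha tau L K N _ n nKN LU.
have LJU := @L1_J_L2 R alpha tau L K N _ n nKN LU.
have Luh := uh_L2.
have fG : forall x, frac_int (1 - alpha) (f x) (t n) =
    L1_D alpha tau N U n x - p * g2 x - a * U n x - b * L1_J alpha tau N U n x
    - residual alpha tau p a b f u N n g2 x.
  by move=> x; rewrite /residual; ring.
have ipG : ip L (fun x => frac_int (1 - alpha) (f x) (t n)) z =
    ip L (L1_D alpha tau N U n) z - p * ip L g2 z - a * ip L (U n) z
    - b * ip L (L1_J alpha tau N U n) z - ip L (residual alpha tau p a b f u N n g2) z.
  have L1 := L2B LDU (L2Z p Lg); have L2' := L2B L1 (L2Z a (LU _ nt)).
  have L3 := L2B L2' (L2Z b LJU).
  rewrite (eq_ip _ (fun x _ => fG x)); apply: (etrans (ipBl L3 Lres Lz)); congr (_ - _).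
  apply: (etrans (ipBl L2' (L2Z b LJU) Lz)); congr (_ - _); last exact: ipZl.
  apply: (etrans (ipBl L1 (L2Z a (LU _ nt)) Lz)); congr (_ - _); last exact: (ipZl a (LU _ nt) Lz).
  by apply: (etrans (ipBl LDU (L2Z p Lg) Lz)); congr (_ - _); exact: ipZl.
have [_ /(_ n hn z fz)] := huh.
rewrite ipG /bilin (ipZl a (Luh _ nt) Lz) (ipZl b (L1_J_L2 alpha tau nKN Luh) Lz).
have orth := interpolation_orthogonality hmesh hv fz.
have -> : ip L (total_error n) z = ip L (U n) z - ip L (uh n) z by rewrite ipBl//; [exact: LU|exact: Luh].
move: orth.
set D1 := ip L (derive1 (interp _)) _; set D2 := ip L (derive1 (uh n)) _.
by move=> ->; set A1 := ip L (L1_D _ _ _ _ _) z; set A2 := ip L (L1_D _ _ _ _ _) z; lra.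
Qed.

(** The delay term is kept under the L1 coefficients, next to the increments, so that
    [complementary_sum] can collapse both. *)
Definition energy_rhs (n : nat) (res : R) : R :=
  \sum_(1 <= k < n.+1) L1coef alpha tau N n k *
    (L2norm L (fun x => space_error k%:Z x - space_error (k%:Z - 1) x)
     + `|b| * r * L2norm L (total_error (k%:Z - (2 * N)%:Z)))
  + `|a| * L2norm L (space_error n) + res.

(** The test function is the nodal error itself: diffusion drops out by coercivity, and [a <= 0]
    removes the nodal part of the reaction term. [energy_comparison] then passes from inner products
    to norms. *)
Lemma energy_inequality (n : nat) (v1 g2 : R -> R) : (0 < n <= 2 * K * N)%N -> H2_path L (U n) v1 g2 ->
  L2 L (residual alpha tau p a b f u N n g2) ->
  \sum_(1 <= k < n.+1) L1coef alpha tau N n k *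
    (L2norm L (nodal_error k%:Z) - L2norm L (nodal_error k.-1%:Z)) <=
  energy_rhs n (L2norm L (residual alpha tau p a b f u N n g2)).
Proof.
move=> hn hv Lres; have /andP[n0 nKN] := hn; have nt := nat_in_time nKN.
pose z := nodal_error n; have fz := nodal_error_fem nt; have Lz := nodal_error_L2 nt.
rewrite -/z in fz Lz.
have eq := error_equation hn hv Lres fz.
have coer := ip_derive1_coercive (interp_solution_fem nt) (huh.1 _ nt).
rewrite -/z in coer.
have LU := solution_L2 tau0 hu N0.
have i1 := @ip_L1_D (fun k x => u x (t k)) n z nKN LU Lz.
have i2 := @ip_L1_D uh n z nKN uh_L2 Lz.
have i3 := @ip_L1_J (fun k x => u x (t k)) n z nKN LU Lz.
have i4 := @ip_L1_J uh n z nKN uh_L2 Lz.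
rewrite i1 i2 i3 i4 -!sumrB in eq; clear i1 i2 i3 i4.
have nz := L2norm_ge0 L z.
pose d k x := space_error k%:Z x - space_error (k%:Z - 1) x.
have bnd v : L2 L v -> `|ip L v z| <= L2norm L z * L2norm L v.
  by move=> Lv; rewrite mulrC; exact: cauchy_schwarz.
have term k : (0 < k <= n)%N -> [/\ in_time k%:Z, in_time (k%:Z - 1) & in_time (k%:Z - (2 * N)%:Z)].
  move=> /andP[k0 kn]; have kK := leq_trans kn nKN.
  by split; [exact: nat_in_time|apply: prev_in_time; rewrite k0|exact: delayed_in_time].
have ipe k : in_time k -> ip L (U k) z - ip L (uh k) z = ip L (total_error k) z.
  by move=> kt; rewrite ipBl//; [exact: LU|exact: uh_L2].
have ipe2 k : in_time k -> ip L (total_error k) z = ip L (space_error k) z + ip L (nodal_error k) z.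
  move=> kt; rewrite -ipDl//; [|exact: space_error_L2|exact: nodal_error_L2].
  by apply: eq_ip => x _; rewrite /total_error /space_error /nodal_error; ring.
pose A k := L1coef alpha tau N n k.
have A0 k : (0 < k <= n)%N -> 0 <= A k by exact: L1coef_ge0.
have lhs : \sum_(1 <= k < n.+1) A k * (ip L (nodal_error k%:Z) z - ip L (nodal_error k.-1%:Z) z) <=
   L2norm L z * energy_rhs n (L2norm L (residual alpha tau p a b f u N n g2)).
  have e1 : \sum_(1 <= k < n.+1) A k * (ip L (nodal_error k%:Z) z - ip L (nodal_error k.-1%:Z) z) =
     - \sum_(1 <= k < n.+1) A k * ip L (d k) z +
     \sum_(1 <= k < n.+1)
        (A k * (ip L (U k%:Z) z - ip L (U (k%:Z - 1)) z) - A k * (ip L (uh k%:Z) z - ip L (uh (k%:Z - 1)) z)).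
    rewrite -sumrN -big_split/=; apply: eq_big_nat => k kn.
    have [t1 t2 t3] := term k kn.
    rewrite -mulrBr; have -> : ip L (U k%:Z) z - ip L (U (k%:Z - 1)) z - (ip L (uh k%:Z) z - ip L (uh (k%:Z - 1)) z)
      = (ip L (U k%:Z) z - ip L (uh k%:Z) z) - (ip L (U (k%:Z - 1)) z - ip L (uh (k%:Z - 1)) z) by ring.
    rewrite !ipe// !ipe2// /d ipBl//; [|exact: space_error_L2|exact: space_error_L2].
    have -> : k.-1%:Z = k%:Z - 1 by case: k kn {t1 t2 t3} => // k _; rewrite /= intS addrC addKr.
    by ring.
  have e2 : - \sum_(1 <= k < n.+1) A k * ip L (d k) z <= L2norm L z * \sum_(1 <= k < n.+1) A k * L2norm L (d k).
    rewrite mulr_sumr -sumrN; apply: ler_sum_nat => k kn; have [t1 t2 t3] := term k kn.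
    rewrite mulrCA -mulrN ler_wpM2l ?A0//.
    have := bnd (d k); rewrite ler_norml => /(_ (L2B (space_error_L2 t1) (space_error_L2 t2)))/andP[+ _].
    by rewrite lerNl.
  have e3 : b * \sum_(1 <= k < n.+1)
      (r * A k * ip L (U (k%:Z - (2 * N)%:Z)) z - r * A k * ip L (uh (k%:Z - (2 * N)%:Z)) z) <=
     L2norm L z * \sum_(1 <= k < n.+1) A k * (`|b| * r * L2norm L (total_error (k%:Z - (2 * N)%:Z))).
    rewrite !mulr_sumr; apply: ler_sum_nat => k kn; have [t1 t2 t3] := term k kn.
    rewrite -mulrBr ipe//.
    have := bnd _ (total_error_L2 t3); set P := ip _ _ _; set Q := L2norm L (total_error _) => PQ.
    have rk : 0 <= r * A k by rewrite mulr_ge0 ?A0// ltW// step_gt0.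
    apply: (@le_trans _ _ (`|b| * (r * A k * (L2norm L z * Q)))); last by rewrite le_eqVlt; apply/orP; left; apply/eqP; ring.
    apply: (le_trans (ler_norm _)); rewrite normrM ler_wpM2l// normrM (ger0_norm rk) ler_wpM2l//.
  have e4 : a * ip L (total_error n) z <= L2norm L z * (`|a| * L2norm L (space_error n)).
    rewrite ipe2// mulrDr -/z -L2norm_sqr.
    have h1 : a * L2norm L z ^+ 2 <= 0 by rewrite mulr_le0_ge0// sqr_ge0.
    have h2 : a * ip L (space_error n) z <= L2norm L z * (`|a| * L2norm L (space_error n)).
      apply: (le_trans (ler_norm _)); rewrite normrM mulrCA ler_wpM2l//.
      exact: (bnd _ (space_error_L2 nt)).
    by rewrite -[leRHS]addr0 lerD.
  have e5 : ip L (residual alpha tau p a b f u N n g2) z <= L2norm L z * L2norm L (residual alpha tau p a b f u N n g2).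
    by apply: (le_trans (ler_norm _)); exact: bnd.
  have e6 := mulr_ge0 (ltW p0) coer.
  rewrite e1 /energy_rhs !mulrDr.
  have -> : \sum_(1 <= k < n.+1) L1coef alpha tau N n k *
    (L2norm L (fun x => space_error k%:Z x - space_error (k%:Z - 1) x)
     + `|b| * r * L2norm L (total_error (k%:Z - (2 * N)%:Z))) =
    \sum_(1 <= k < n.+1) A k * L2norm L (d k) +
    \sum_(1 <= k < n.+1) A k * (`|b| * r * L2norm L (total_error (k%:Z - (2 * N)%:Z))).
    by rewrite -big_split/=; apply: eq_bigr => k _; rewrite mulrDr.
  rewrite mulrDr; move: eq e2 e3 e4 e5 e6.
  set S1 := \sum_(1 <= k < n.+1) (_ - _); set S2 := \sum_(1 <= k < n.+1) (_ - _).
  set S3 := \sum_(1 <= k < n.+1) _ * ip _ _ _; set S4 := L2norm L z * \sum_(1 <= k < n.+1) _.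
  set S5 := L2norm L z * \sum_(1 <= k < n.+1) _; set S6 := L2norm L z * (_ * _).
  set S7 := L2norm L z * L2norm _ _; set S8 := p * _; set S9 := ip L (residual _ _ _ _ _ _ _ _ _ _) z.
  set S10 := a * _; set S11 := b * _.
  by clear; lra.
case: n n0 nKN hn nt hv Lres @z fz Lz eq coer nz bnd term ipe ipe2 @A A0 lhs => // n.
move=> _ nKN hn nt hv Lres z fz Lz eq coer nz bnd term ipe ipe2 A A0 lhs.
apply: (@energy_comparison R A (fun k => ip L (nodal_error k%:Z) z) (fun k => L2norm L (nodal_error k%:Z)) (L2norm L z)).
- exact: A0.
- by move=> k kn; apply: L1coef_nondecreasing.
- by move=> k; exact: L2norm_ge0.
- by [].
- move=> k kn; apply: (le_trans (ler_norm _)); apply: cauchy_schwarz => //.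
  by apply: nodal_error_L2; rewrite nat_in_time// (leq_trans kn).
- by rewrite L2norm_sqr.
- rewrite /energy_rhs !addr_ge0 ?mulr_ge0 ?L2norm_ge0//.
  rewrite big_nat_cond; apply: sumr_ge0 => k /andP[kn _].
  by rewrite mulr_ge0 ?A0// addr_ge0 ?mulr_ge0 ?L2norm_ge0// ltW// step_gt0.
- exact: lhs.
Qed.

End ErrorEquation.

(** * Discrete Gronwall inequality and error bound *)

Section KernelSums.
Context {R : realType} (alpha : R) (q : nat -> R).
Local Notation sigma := (Num.min alpha (1 - alpha)).
Hypothesis alpha01 : 0 < alpha < 1.
Hypothesis q_ge0 : forall m, 0 <= q m.
Hypothesis q_le : forall m, q m <= m.+1%:R `^ (alpha - 1).

Let al0 : 0 < alpha. Proof. by case/andP: alpha01. Qed.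
Let al1 : 0 < 1 - alpha. Proof. by case/andP: alpha01; lra. Qed.

Lemma kernel_sum n : \sum_(1 <= j < n.+1) q (n - j)%N <= n%:R `^ alpha / alpha.
Proof.
apply: (@le_trans _ _ (\sum_(1 <= j < n.+1) j%:R `^ (alpha - 1))); last first.
  by apply: powR_nat_sum_le; case/andP: alpha01 => -> /ltW ->.
rewrite !big_add1/= [leRHS]big_nat_rev/= add0n.
apply: ler_sum_nat => j /andP[_ jn]; apply: (le_trans (q_le _)).
by rewrite subnSK.
Qed.

(** The constant of [powR_conv_le] for the exponents [1 + sigma] and [1 - alpha]. *)
Definition convolution_const : R := 2 * 2 `^ (1 - alpha) * (1 + sigma^-1).

(** The bound on [q] has argument [n - j + 1], hence the convolution at [n + 1]. Since
    [1 - alpha <= 1 + sigma], the decay of [q] is the one that survives. *)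
Lemma kernel_convolution n : (0 < n)%N ->
  \sum_(1 <= j < n.+1) q (n - j)%N * j%:R `^ (- sigma - 1) <= convolution_const * n%:R `^ (alpha - 1).
Proof.
move=> n0; have s0 : 0 < sigma by rewrite lt_min al0 al1.
have := @powR_conv_le R (1 + sigma) (1 - alpha) n.+1.
rewrite ltrDl => /(_ s0).
have h : 0 <= 1 - alpha <= 1 + sigma by rewrite (ltW al1)/= lerD2l (le_trans _ (ltW s0))// oppr_le0 ltW.
move=> /(_ h); have -> : 1 + sigma - 1 = sigma by ring.
rewrite -/convolution_const => conv.
apply: (@le_trans _ _ (convolution_const * n.+1%:R `^ (- (1 - alpha)))); last first.
  have -> : - (1 - alpha) = alpha - 1 by ring.
  apply: ler_wpM2l.
    by rewrite /convolution_const !mulr_ge0 ?powR_ge0// addr_ge0// invr_ge0 ltW.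
  apply: ler_powRN; rewrite ?ltr0n// ?ler_nat//.
  by rewrite subr_le0; case/andP: alpha01 => _ /ltW.
apply: le_trans conv; rewrite [leRHS]big_add1/= big_add1/= [leRHS]big_nat_rev/= add0n.
apply: ler_sum_nat => j /andP[_ jn].
have -> : - sigma - 1 = - (1 + sigma) by ring.
rewrite (subnSK jn) subSn ?leq_subr// (subKn (ltnW jn)) mulrC ler_wpM2l ?powR_ge0//.
apply: (le_trans (q_le _)); rewrite (subnSK jn).
by have -> : - (1 - alpha) = alpha - 1 by ring.
Qed.

End KernelSums.

(** * Gronwall's inequality with delay *)

Section DelayGronwall.
Context {R : realType} (alpha T r h2 C D beta : R) (n0 n1 : nat) (E : int -> R).
Hypotheses (alpha01 : 0 < alpha < 1) (r0 : 0 < r) (h20 : 0 <= h2) (C_ge0 : 0 <= C) (D0 : 0 <= D) (beta0 : 0 <= beta).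
Hypothesis n1T : n1%:R * r <= T.
Hypothesis n0_gt0 : (0 < n0)%N.
Hypothesis E_ge0 : forall n, 0 <= E n.
Hypothesis E_history : forall n : int, - n0%:Z <= n <= 0 -> E n <= D * h2.
Local Notation rate n := (h2 + r + r * (n%:R * r) `^ (alpha - 1)).
Hypothesis E_rec : forall n : nat, (1 <= n <= n1)%N ->
  E n <= C * rate n + beta * r * \sum_(1 <= k < n.+1) E (k%:Z - n0%:Z).

Let al0 : 0 < alpha. Proof. by case/andP: alpha01. Qed.
Let T0 : 0 <= T. Proof. by apply: le_trans n1T; rewrite mulr_ge0// ltW. Qed.

(** Terms with [k <= n0] lie in the initial history, where the error is at most [D h2]; the others
    are errors up to index [n - n0]. Counting [n] history terms is harmless because [n r <= T]. *)
Let history n : \sum_(1 <= k < n.+1) E (k%:Z - n0%:Z) <= n%:R * (D * h2) + \sum_(1 <= m < n.+1 - n0) E m.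
Proof.
elim: n => [|n IH].
  by rewrite big_geq// mul0r add0r big_nat_cond sumr_ge0.
rewrite big_nat_recr//=; have [nn|nn] := leqP n.+1 n0.
  have h : E (n.+1%:Z - n0%:Z) <= D * h2.
    apply: E_history; rewrite lerBrDr addNr le0z_nat/=.
    by rewrite subr_le0 lez_nat.
  have z1 : \sum_(1 <= m < n.+1 - n0) E m = 0 by rewrite big_geq// leq_subLR addn1 ltnW.
  have z2 : \sum_(1 <= m < n.+2 - n0) E m = 0 by rewrite big_geq// leq_subLR addn1.
  rewrite z1 addr0 in IH; rewrite z2 addr0.
  by rewrite -natr1 mulrDl mul1r lerD.
have e : (n.+2 - n0 = (n.+1 - n0).+1)%N by rewrite subSn// ltnW.
rewrite e [\sum_(1 <= m < (n.+1 - n0).+1) _]big_nat_recr ?subn_gt0//=.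
rewrite addrA; apply: lerD.
  apply: (le_trans IH); rewrite lerD2r ler_wpM2r ?mulr_ge0//.
  by rewrite ler_nat.
by rewrite -subzn// ltnW.
Qed.

(** [C] and [beta T D] come from the recursion itself, the exponential term from the Gronwall bound
    on the sum of errors inserted into it. *)
Definition gronwall_const : R :=
  C + beta * T * D + beta * expR (beta * T) * (C * (T + T `^ alpha / alpha) + beta * T ^+ 2 * D).

Lemma gronwall_const_ge0 : 0 <= T -> 0 <= gronwall_const.
Proof.
move=> T_ge0.
have e0 := expR_ge0 (beta * T); have av : 0 <= alpha^-1 by rewrite invr_ge0 ltW.
have T2 : 0 <= T ^+ 2 by rewrite sqr_ge0.
by rewrite /gronwall_const; nonneg.
Qed.

(** The delayed sum is at most the sum of all earlier errors, to which [discrete_gronwall] applies.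
    The resulting bound is free of the singularity, which reappears only through the last use of the
    recursion at index [n]. *)
Lemma delay_gronwall (n : nat) : (1 <= n <= n1)%N -> E n <= gronwall_const * rate n.
Proof.
move=> /andP[n_gt0 nn1].
have rt (k : nat) : 0 <= (k%:R * r) `^ (alpha - 1) by exact: powR_ge0.
have DT : 0 <= beta * T * (D * h2) by nonneg.
pose g (k : nat) := C * rate k + beta * T * (D * h2).
have g0 k : 0 <= g k.
  by rewrite /g addr_ge0// mulr_ge0// !addr_ge0 ?mulr_ge0 ?(ltW r0).
have kT k : (k <= n1)%N -> k%:R * r <= T.
  by move=> kn; apply: le_trans n1T; rewrite ler_pM2r// ler_nat.
have br : 0 <= beta * r by rewrite mulr_ge0// ltW.
have rec k : (1 <= k <= n1)%N -> E k <= g k + beta * r * \sum_(1 <= j < k) E j.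
  move=> /andP[k1 kn]; have := @E_rec k; rewrite k1 kn => /(_ isT)/le_trans; apply.
  rewrite /g -[leRHS]addrA lerD2l; apply: (le_trans (ler_wpM2l br (history k))).
  rewrite mulrDr; apply: lerD.
    have -> : beta * r * (k%:R * (D * h2)) = beta * (k%:R * r) * (D * h2) by ring.
    by rewrite ler_wpM2r ?mulr_ge0// ler_wpM2l// kT.
  rewrite ler_wpM2l//.
  have kk : (k.+1 - n0 <= k)%N by rewrite leq_subLR -addn1 addnC leq_add2r.
  case: (leqP 1 (k.+1 - n0)%N) => c; last by rewrite big_geq ?(ltnW c)// big_nat_cond sumr_ge0.
  rewrite [leRHS](big_cat_nat c kk)/= lerDl big_nat_cond sumr_ge0//.
have gw := @discrete_gronwall R (fun k => E k) g (beta * r) n br g0.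
have {}gw : \sum_(1 <= k < n.+1) E k <= expR (beta * r * n%:R) * \sum_(1 <= k < n.+1) g k.
  by apply: gw => k /andP[k1 kn]; apply: rec; rewrite k1 (leq_trans kn).
have eT : expR (beta * r * n%:R) <= expR (beta * T).
  by rewrite ler_expR -mulrA ler_wpM2l// mulrC kT.
(* The values [r (k r)^(alpha - 1)] sum to at most [T^alpha / alpha], so the singular part of [g]
   enters this sum like the regular term [r]. *)
have sg : r * \sum_(1 <= k < n.+1) g k <=
   C * (T * h2 + T * r + r * (T `^ alpha / alpha)) + beta * T ^+ 2 * (D * h2).
  rewrite /g big_split/= -mulr_sumr !big_split/= !sumr_const_nat !subSS !subn0.
  have s1 : r * (h2 *+ n) <= T * h2.
    by rewrite -mulr_natl mulrA ler_wpM2r// mulrC kT.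
  have s2 : r * (r *+ n) <= T * r.
    by rewrite -mulr_natl mulrA ler_wpM2r ?(ltW r0)// mulrC kT.
  have s3 : r * (beta * T * (D * h2) *+ n) <= beta * T ^+ 2 * (D * h2).
    rewrite -mulr_natl mulrA [r * _]mulrC; apply: (le_trans (ler_wpM2r DT (kT _ nn1))).
    by rewrite le_eqVlt; apply/orP; left; apply/eqP; ring.
  have s4 : \sum_(1 <= k < n.+1) r * (k%:R * r) `^ (alpha - 1) <= T `^ alpha / alpha.
    apply: (@le_trans _ _ (r `^ alpha * \sum_(1 <= k < n.+1) k%:R `^ (alpha - 1))).
      rewrite mulr_sumr; apply: ler_sum_nat => k _.
      rewrite powRM ?ler0n ?(ltW r0)// mulrCA mulrC (mulr_powRB1 (ltW r0) al0).
      by rewrite mulrC.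
    have a01 : 0 < alpha <= 1 by case/andP: alpha01 => -> /ltW ->.
    apply: (le_trans (ler_wpM2l (powR_ge0 _ _) (powR_nat_sum_le n a01))).
    rewrite mulrA -powRM ?ler0n ?(ltW r0)// ler_wpM2r ?invr_ge0 ?(ltW al0)//.
    rewrite mulrC; apply: ler_powRP; rewrite ?(ltW al0)// ?mulr_ge0 ?(ltW r0)//.
    exact: kT.
  have s5 := ler_wpM2l (ltW r0) s4.
  rewrite mulrDr; apply: lerD => //.
  rewrite mulrCA ler_wpM2l// !mulrDr; apply: lerD => //; exact: lerD.
have := rec n; rewrite n_gt0 nn1 => /(_ isT)/le_trans; apply.
have B : beta * r * \sum_(1 <= k < n) E k <=
    beta * expR (beta * T) * (C * (T * h2 + T * r + r * (T `^ alpha / alpha)) + beta * T ^+ 2 * (D * h2)).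
  apply: (@le_trans _ _ (beta * r * \sum_(1 <= k < n.+1) E k)).
    by rewrite ler_wpM2l// [leRHS]big_nat_recr//= lerDl.
  rewrite -(mulrA beta r) -(mulrA beta (expR _)) ler_wpM2l//.
  apply: (@le_trans _ _ (r * (expR (beta * T) * \sum_(1 <= k < n.+1) g k))).
    rewrite ler_wpM2l ?(ltW r0)//; apply: (le_trans gw); rewrite ler_wpM2r//.
    by rewrite big_nat_cond sumr_ge0.
  by rewrite mulrCA ler_wpM2l ?expR_ge0.
apply: (le_trans (lerD (lexx _) B)).
set P := r * (n%:R * r) `^ (alpha - 1); have P0 : 0 <= P by rewrite mulr_ge0// ltW.
set e := expR _; have e0 : 0 <= e by exact: expR_ge0.
set q := T `^ alpha / alpha; have q0 : 0 <= q by rewrite divr_ge0 ?powR_ge0// ltW.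
have rr := ltW r0.
rewrite /g /gronwall_const -/P -/e -/q.
rewrite -subr_ge0.
have -> : (C + beta * T * D + beta * e * (C * (T + q) + beta * T ^+ 2 * D)) * (h2 + r + P) -
  (C * (h2 + r + P) + beta * T * (D * h2) + beta * e * (C * (T * h2 + T * r + r * q) + beta * T ^+ 2 * (D * h2))) =
  beta * T * D * (r + P) + beta * e * (C * (T * P + q * (h2 + P)) + beta * T ^+ 2 * D * (r + P)) by ring.
have T2 : 0 <= T ^+ 2 by rewrite sqr_ge0.
by nonneg.
Qed.

End DelayGronwall.

(** * Assembly of the error bound *)

Section Final.
Context {R : realType} (alpha tau p a b L : R) (K : nat) (f phi u : R -> R -> R) (Creg C0 : R).
Local Notation mu := (@lebesgue_measure R).
Local Notation T := (K%:R * tau).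
Local Notation sigma := (Num.min alpha (1 - alpha)).
Hypotheses (alpha01 : 0 < alpha < 1) (tau0 : 0 < tau) (K0 : (0 < K)%N) (L0 : 0 < L).
Hypotheses (p0 : 0 < p) (a0 : a <= 0).
Hypothesis hf : continuous_on_rectangle `]0, L[ `[0, T] f.
Hypothesis hu : delay_solution alpha tau K p a b L f phi u.
Hypothesis hreg : time_regular alpha tau K L Creg u.
Variables (m : R -> R) (Mu : R).
Hypothesis im : mu.-integrable `]- tau, T[ (EFin \o m).
Hypothesis m1 : forall s, 1 <= m s.
Hypothesis u_inc : forall s t, - tau <= s -> s < t -> t <= T ->
      (exists v1 g2, H2_path L (fun x => u x t - u x s) v1 g2 /\
         L2norm L g2 <= \int[mu]_(r in `]s, t[) m r) /\
      (forall x, 0 <= x <= L -> `|u x t - u x s| <= Num.sqrt L * \int[mu]_(r in `]s, t[) m r).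
Hypothesis Mu0 : 0 <= Mu.
Hypothesis u_H2 : forall t, - tau <= t <= T ->
    exists v1 g2, H2_path L (u^~ t) v1 g2 /\ L2norm L g2 <= Mu.

Variables (N M : nat) (xs : nat -> R) (uh : int -> R -> R).
Hypothesis N0 : (0 < N)%N.
Hypothesis hmesh : mesh L M xs.
Hypothesis huh : fem_solution alpha tau K p a b L f N M xs uh.
Local Notation h := (mesh_size M xs).
Hypothesis hinit : forall n : int, - (2 * N)%:Z <= n <= 0 ->
  L2norm L (fun x => uh n x - phi x (tm tau N n)) <= C0 * h ^+ 2.
Local Notation t := (tm tau N).
Local Notation r := (step tau N).
Local Notation U := (fun (n : int) x => u x (t n)).
Local Notation in_time n := (- (2 * N)%:Z <= n <= (2 * K * N)%:Z).
Local Notation err := (total_error tau u N uh).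
Local Notation eta := (space_error tau u N M xs).
Local Notation theta := (nodal_error tau u N M xs uh).
Local Notation I := (\int[mu]_(s in `]- tau, T[) m s).

Let m_ge0 s : 0 <= m s. Proof. exact: le_trans (m1 s). Qed.
Let r0 : 0 < r. Proof. exact: step_gt0. Qed.
Let h0 : 0 <= h. Proof. exact: (mesh_size_ge0 hmesh). Qed.
Let I0 : 0 <= I. Proof. exact: itvoo_Rint_ge0. Qed.

Lemma space_error_bound (n : int) : in_time n -> L2norm L (eta n) <= h ^+ 2 * Mu.
Proof.
move=> /(tm_range tau0 N0)/u_H2[v1 [g2 [hv ng]]].
by apply: (le_trans (interpolation_error hmesh hv)); rewrite ler_wpM2l ?exprn_ge0.
Qed.

(** Interpolation is linear, so the increment of the space error is the interpolation error of the
    increment of [u]. *)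
Lemma space_error_increment (k : int) : in_time k -> in_time (k - 1) ->
  L2norm L (fun x => eta k x - eta (k - 1) x) <= h ^+ 2 * mcell tau N m k.
Proof.
move=> /(tm_range tau0 N0)/andP[_ tk] /(tm_range tau0 N0)/andP[tk1 _].
have tt : t (k - 1) < t k by apply: tm_lt => //; rewrite ltrBlDr ltrDl.
have [[v1 [g2 [hv ng]]] _] := u_inc tk1 tt tk.
apply: (@le_trans _ _ (h ^+ 2 * L2norm L g2)); last by rewrite ler_wpM2l ?exprn_ge0.
apply: le_trans (interpolation_error hmesh hv).
rewrite le_eqVlt; apply/orP; left; apply/eqP; apply: eq_L2norm => x _.
by rewrite interpolantB /space_error; ring.
Qed.

Lemma initial_error (n : int) : - (2 * N)%:Z <= n <= 0 -> L2norm L (err n) <= `|C0| * h ^+ 2.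
Proof.
move=> hn; have := hinit hn => b1.
have tI : t n \in (`[- tau, 0] : set R).
  rewrite inE/= in_itv/= -(tm_history tau N0) tm_le//=; last by case/andP: hn.
  by rewrite -[leRHS](mul0r r) /tm ler_pM2r// lerz0; case/andP: hn.
have -> : L2norm L (err n) = L2norm L (fun x => uh n x - phi x (t n)).
  rewrite -L2normN; apply: eq_L2norm => x xL.
  have [_ hphi _ _ _] := hu.
  by rewrite /total_error hphi ?opprB// inE/= in_itv.
by apply: (le_trans b1); rewrite ler_wpM2r ?exprn_ge0// ler_norm.
Qed.

Let Tc := truncation_const alpha tau K Creg.
Let G2 := Gamma (2 - alpha) : R.
Let sL := Num.sqrt L.

Let Tc0 : 0 <= Tc.
Proof.
have xL : 0 < L / 2 < L by rewrite divr_gt0//= ltr_pdivrMr// ltr_pMr ?ltr1n.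
exact: (truncation_const_ge0 alpha01 tau0 K0 (solution_regular_path tau0 hu hreg xL)).
Qed.

(** In order: the initial nodal error, the increments of the space error, the delay quadrature, the
    reaction and regular truncation terms, and the singular part of the truncation error. *)
Definition nodal_const : R :=
  Mu + `|C0| + I + `|b| * L * I + G2 * (T `^ alpha / alpha) * (`|a| * Mu + Tc * sL)
  + G2 * Tc * sL * convolution_const alpha.

(** [A] is the scaled L1 kernel and [Q] its complementary kernel. The factor [r^alpha] of [Q] turns
    the decay [n^(alpha - 1)] of the convolved truncation error into [r t_n^(alpha - 1)]. *)
Lemma nodal_error_bound (n : nat) : (0 < n <= 2 * K * N)%N ->
  L2norm L (theta n) <= nodal_const * (h ^+ 2 + r + r * t n `^ (alpha - 1)) +
   `|b| * r * \sum_(1 <= k < n.+1) L2norm L (err (k%:Z - (2 * N)%:Z)).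
Proof.
move=> /andP[n_gt0 nK].
have [q [q1 q0 qle]] := L1_complementary_kernel alpha01.
have G20 : 0 < G2 by exact: Gamma2B_gt0.
pose c := r `^ (- alpha) / G2.
have c0 : 0 < c by rewrite divr_gt0// powR_gt0.
pose A k := c * L1weight alpha k; pose Q k := c^-1 * q k.
have QA1 l : \sum_(0 <= j < l.+1) Q j * A (l - j)%N = 1.
  rewrite -[RHS](q1 l); apply: eq_bigr => j _; rewrite /Q /A; field.
  by rewrite gt_eqF.
have Q0 l : 0 <= Q l by rewrite mulr_ge0// invr_ge0 ltW.
pose E k := L2norm L (err k).
(* [z] collects what enters with an L1 coefficient, [w] the rest. Of the two factors [sL] in [z],
   one comes from the pointwise bound on increments, the other from passing to the L2 norm. *)
pose z (k : nat) := h ^+ 2 * mcell tau N m k%:Z + `|b| * r * E (k%:Z - (2 * N)%:Z) +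
   r * (`|b| * sL * mcell tau N m (k%:Z - (2 * N)%:Z)) * sL.
pose w (j : nat) := `|a| * (h ^+ 2 * Mu) + Tc * sL * (j%:R `^ (- sigma - 1) + r).
have main : L2norm L (theta n) <= L2norm L (theta 0) +
    \sum_(1 <= j < n.+1) Q (n - j)%N * (\sum_(1 <= k < j.+1) A (j - k)%N * z k + w j).
  apply: (@discrete_comparison R A Q QA1 Q0 (fun k => L2norm L (theta k%:Z))) => j /andP[j0 jn].
  have jK := leq_trans jn nK; have hj : (0 < j <= 2 * K * N)%N by rewrite j0.
  have [v1 [g2 [hv ng]]] := u_H2 (tm_range tau0 N0 (nat_in_time jK)).
  have um : forall x s s', - tau <= s -> s < s' -> s' <= T -> 0 <= x <= L ->
      `|u x s' - u x s| <= Num.sqrt L * \int[mu]_(y in `]s, s'[) m y.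
    by move=> x s s' h1 h2 h3 h4; have [_ ->] := u_inc h1 h2 h3.
  have [Lres nres] := residual_bound alpha01 tau0 K0 L0 hf hu hreg N0 im m_ge0 um hj hv.
  have en := energy_inequality alpha01 tau0 p0 a0 hu N0 hmesh huh hj hv Lres.
  have AE k : (0 < k <= j)%N -> A (j - k)%N = L1coef alpha tau N j k.
    by move=> kj; rewrite L1coefE.
  have e1 : \sum_(1 <= k < j.+1) A (j - k)%N * (L2norm L (theta k%:Z) - L2norm L (theta k.-1%:Z)) =
     \sum_(1 <= k < j.+1) L1coef alpha tau N j k * (L2norm L (theta k%:Z) - L2norm L (theta k.-1%:Z)).
    by apply: eq_big_nat => k kj; rewrite AE.
  rewrite e1; apply: (le_trans en); rewrite /energy_rhs.
  have e2 : \sum_(1 <= k < j.+1) A (j - k)%N * z k =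
    \sum_(1 <= k < j.+1) L1coef alpha tau N j k * (h ^+ 2 * mcell tau N m k%:Z + `|b| * r * E (k%:Z - (2 * N)%:Z)) +
    (\sum_(1 <= k < j.+1) r * L1coef alpha tau N j k * (`|b| * sL * mcell tau N m (k%:Z - (2 * N)%:Z))) * sL.
    rewrite mulr_suml -big_split/=; apply: eq_big_nat => k kj; rewrite AE// /z; ring.
  have e3 : \sum_(1 <= k < j.+1) L1coef alpha tau N j k *
      (L2norm L (fun x => eta k%:Z x - eta (k%:Z - 1) x) + `|b| * r * L2norm L (err (k%:Z - (2 * N)%:Z))) <=
     \sum_(1 <= k < j.+1) L1coef alpha tau N j k * (h ^+ 2 * mcell tau N m k%:Z + `|b| * r * E (k%:Z - (2 * N)%:Z)).
    apply: ler_sum_nat => k kj; rewrite ler_wpM2l ?L1coef_ge0// lerD2r.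
    have kK : (k <= 2 * K * N)%N by case/andP: kj => _ kj; exact: leq_trans jK.
    apply: space_error_increment; first exact: nat_in_time.
    by apply: prev_in_time => //; case/andP: kj => -> _.
  have e4 : `|a| * L2norm L (eta j) <= `|a| * (h ^+ 2 * Mu).
    by rewrite ler_wpM2l// space_error_bound// nat_in_time.
  have e5 : L2norm L (residual alpha tau p a b f u N j g2) <=
     Tc * sL * (j%:R `^ (- sigma - 1) + r) +
    (\sum_(1 <= k < j.+1) r * L1coef alpha tau N j k * (`|b| * sL * mcell tau N m (k%:Z - (2 * N)%:Z))) * sL.
    by apply: (le_trans nres); rewrite mulrDl -/Tc -/sL lerD2r mulrAC.
  rewrite e2 /w; move: e3 e4 e5.
  set S1 := \sum_(1 <= k < j.+1) _; set S2 := \sum_(1 <= k < j.+1) _; set S3 := \sum_(1 <= k < j.+1) _.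
  set s4 := `|a| * L2norm _ _; set s5 := `|a| * (_ * _); set s6 := L2norm _ (residual _ _ _ _ _ _ _ _ _ _).
  set s7 := Tc * _ * _; set s8 := S3 * sL.
  move=> x1 x2 x3; apply: (le_trans (lerD (lerD x1 x2) x3)).
  by rewrite le_eqVlt; apply/orP; left; apply/eqP; ring.
have split : \sum_(1 <= j < n.+1) Q (n - j)%N * (\sum_(1 <= k < j.+1) A (j - k)%N * z k + w j) =
   \sum_(1 <= k < n.+1) z k + \sum_(1 <= j < n.+1) Q (n - j)%N * w j.
  have cs := complementary_sum QA1 z n; rewrite -cs -big_split/=; apply: eq_bigr => j _.
  exact: mulrDr.
rewrite split in main.
have tnE : t n = n%:R * r by [].
have theta0 : L2norm L (theta 0) <= (Mu + `|C0|) * h ^+ 2.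
  have z0 : in_time 0 by rewrite oppr_le0.
  have -> : L2norm L (theta 0) = L2norm L (fun x => err 0 x - eta 0 x).
    by apply: eq_L2norm => x _; rewrite /nodal_error /total_error /space_error; ring.
  apply: (le_trans (L2norm_B (total_error_L2 tau0 hu N0 hmesh huh z0) (space_error_L2 tau0 hu N0 hmesh z0))).
  have h1 := space_error_bound z0.
  have h2 := @initial_error 0; rewrite oppr_le0/= in h2; have {}h2 := h2 isT.
  rewrite mulrDl addrC (mulrC Mu); exact: lerD.
have zsum : \sum_(1 <= k < n.+1) z k <= h ^+ 2 * I + r * (`|b| * L * I) +
   `|b| * r * \sum_(1 <= k < n.+1) E (k%:Z - (2 * N)%:Z).
  rewrite /z !big_split/= -!mulr_sumr -mulr_suml -!mulr_sumr.
  have s1 : \sum_(1 <= k < n.+1) mcell tau N m k%:Z <= I.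
    have b1 : - (2 * N)%:Z <= 0 :> int by rewrite oppr_le0.
    have b2 : 0 + n%:Z <= (2 * K * N)%:Z by rewrite add0r lez_nat.
    apply: le_trans (@mcell_sum R tau K tau0 N N0 m im m_ge0 0 n b1 b2); rewrite le_eqVlt; apply/orP; left; apply/eqP.
    by apply: eq_bigr => k _; rewrite addr0.
  have s2 : \sum_(1 <= k < n.+1) mcell tau N m (k%:Z - (2 * N)%:Z) <= I.
    apply: (@mcell_sum R tau K tau0 N N0 m im m_ge0) => //.
    by rewrite addrC lerBlDr -PoszD lez_nat (leq_trans nK)// leq_addr.
  rewrite -addrA [leRHS]addrAC -addrA; apply: lerD; first by rewrite ler_wpM2l ?exprn_ge0.
  rewrite lerD2l.
  have -> : r * (`|b| * L * I) = r * (`|b| * sL * I) * sL.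
    have LE : L = sL * sL by rewrite -expr2 sqr_sqrtr// ltW.
    by rewrite {1}LE; ring.
  rewrite ler_wpM2r ?sqrtr_ge0// ler_wpM2l ?(ltW r0)// ler_wpM2l// mulr_ge0 ?sqrtr_ge0//.
have cinv : c^-1 = G2 * r `^ alpha by rewrite /c invf_div powRN invrK.
have al0 : 0 < alpha by case/andP: alpha01.
have nT : n%:R * r <= T.
  by rewrite -(tm_final tau K N0) -tnE tm_le// lez_nat.
have QS : \sum_(1 <= j < n.+1) Q (n - j)%N <= G2 * (T `^ alpha / alpha).
  rewrite -mulr_sumr cinv -mulrA ler_wpM2l ?(ltW G20)//.
  apply: (le_trans (ler_wpM2l (powR_ge0 _ _) (kernel_sum alpha01 qle n))).
  rewrite mulrA ler_wpM2r ?invr_ge0 ?(ltW al0)// -powRM ?ler0n ?(ltW r0)//.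
  apply: ler_powRP; [exact: ltW|by rewrite mulr_ge0// ltW|by rewrite mulrC].
pose P := r * t n `^ (alpha - 1).
have P0 : 0 <= P by rewrite mulr_ge0 ?powR_ge0// ltW.
have QC : \sum_(1 <= j < n.+1) Q (n - j)%N * j%:R `^ (- sigma - 1) <= G2 * convolution_const alpha * P.
  have -> : \sum_(1 <= j < n.+1) Q (n - j)%N * j%:R `^ (- sigma - 1) =
     c^-1 * \sum_(1 <= j < n.+1) q (n - j)%N * j%:R `^ (- sigma - 1).
    by rewrite mulr_sumr; apply: eq_bigr => j _; rewrite /Q mulrA.
  rewrite cinv -[leLHS]mulrA -[leRHS]mulrA ler_wpM2l ?(ltW G20)//.
  apply: (le_trans (ler_wpM2l (powR_ge0 _ _) (kernel_convolution alpha01 qle n_gt0))).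
  have -> : P = r `^ alpha * n%:R `^ (alpha - 1).
    by rewrite /P tnE powRM ?ler0n ?(ltW r0)// mulrCA mulrC (mulr_powRB1 (ltW r0) al0).
  by rewrite le_eqVlt; apply/orP; left; apply/eqP; ring.
have wsum : \sum_(1 <= j < n.+1) Q (n - j)%N * w j <=
   G2 * (T `^ alpha / alpha) * (`|a| * (h ^+ 2 * Mu) + Tc * sL * r) +
   Tc * sL * (G2 * convolution_const alpha * P).
  have -> : \sum_(1 <= j < n.+1) Q (n - j)%N * w j =
    (\sum_(1 <= j < n.+1) Q (n - j)%N) * (`|a| * (h ^+ 2 * Mu) + Tc * sL * r) +
    Tc * sL * \sum_(1 <= j < n.+1) Q (n - j)%N * j%:R `^ (- sigma - 1).
    by rewrite mulr_suml mulr_sumr -big_split/=; apply: eq_bigr => j _; rewrite /w; ring.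
  apply: lerD; last by rewrite ler_wpM2l// mulr_ge0 ?sqrtr_ge0.
  apply: ler_wpM2r QS; apply: addr_ge0.
    by apply: mulr_ge0 => //; apply: mulr_ge0 => //; exact: exprn_ge0.
  by apply: mulr_ge0; [apply: mulr_ge0 => //; exact: sqrtr_ge0|exact: ltW].
have Cc0 : 0 <= convolution_const alpha.
  have s0 : 0 < sigma by rewrite lt_min al0/=; case/andP: alpha01 => _; rewrite subr_gt0.
  by rewrite /convolution_const !mulr_ge0 ?powR_ge0// addr_ge0// invr_ge0 ltW.
apply: (le_trans main); apply: (le_trans (lerD theta0 (lerD zsum wsum))).
rewrite -/P -/E addrA [leRHS]addrC !addrA -subr_ge0.
set H := `|b| * r * _; set q' := T `^ alpha / alpha; set h2 := h ^+ 2.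
have q'0 : 0 <= q' by rewrite divr_ge0 ?powR_ge0// ltW.
have h20 : 0 <= h2 by rewrite exprn_ge0.
have rr := ltW r0; have gg := ltW G20; have LL := ltW L0; have sL0 : 0 <= sL by exact: sqrtr_ge0.
have nb : 0 <= `|b| by []; have na : 0 <= `|a| by []; have nC : 0 <= `|C0| by [].
rewrite /nodal_const -/q' -/H.
have -> : H + (Mu + `|C0| + I + `|b| * L * I + G2 * q' * (`|a| * Mu + Tc * sL) + G2 * Tc * sL * convolution_const alpha) *
   (h2 + r + P) -
   ((Mu + `|C0|) * h2 + h2 * I + r * (`|b| * L * I) + H + G2 * q' * (`|a| * (h2 * Mu) + Tc * sL * r) +
    Tc * sL * (G2 * convolution_const alpha * P)) =
   (Mu + `|C0|) * (r + P) + I * (r + P) + `|b| * L * I * (h2 + P) +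
   G2 * q' * (`|a| * Mu * (r + P) + Tc * sL * (h2 + P)) + G2 * Tc * sL * convolution_const alpha * (h2 + r) by ring.
by nonneg.
Qed.

Lemma nodal_const_ge0 : 0 <= nodal_const.
Proof.
have al0 : 0 < alpha by case/andP: alpha01.
have s0 : 0 < sigma by rewrite lt_min al0/=; case/andP: alpha01 => _; rewrite subr_gt0.
have Cc0 : 0 <= convolution_const alpha.
  by rewrite /convolution_const !mulr_ge0 ?powR_ge0// addr_ge0// invr_ge0 ltW.
have av : 0 <= alpha^-1 by rewrite invr_ge0 ltW.
have gg : 0 <= G2 by rewrite ltW// Gamma2B_gt0.
have LL := ltW L0; have sL0 : 0 <= sL by exact: sqrtr_ge0.
have nb : 0 <= `|b| by []; have na : 0 <= `|a| by []; have nC : 0 <= `|C0| by [].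
by rewrite /nodal_const; nonneg.
Qed.

(** The added [Mu] pays for the space error in the triangle inequality. *)
Lemma total_error_bound (n : nat) : (0 < n <= 2 * K * N)%N ->
  L2norm L (err n) <= gronwall_const alpha T (nodal_const + Mu) `|C0| `|b| *
    (h ^+ 2 + r + r * t n `^ (alpha - 1)).
Proof.
have KT : (2 * K * N)%:R * r <= T by rewrite -(tm_final tau K N0).
have h20 : 0 <= h ^+ 2 by rewrite exprn_ge0.
have CM : 0 <= nodal_const + Mu by rewrite addr_ge0// nodal_const_ge0.
have N20 : (0 < 2 * N)%N by rewrite muln_gt0.
have hist k : - (2 * N)%:Z <= k <= 0 -> L2norm L (err k) <= `|C0| * h ^+ 2 by exact: initial_error.
apply: (@delay_gronwall R alpha T r (h ^+ 2) (nodal_const + Mu) `|C0| `|b| (2 * N)%N (2 * K * N)%N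
  (fun k => L2norm L (err k)) alpha01 r0 h20 CM _ _ KT N20 _ hist) => //.
  by move=> k; exact: L2norm_ge0.
move=> k hk; have /andP[k0 kK] := hk; have kt := nat_in_time kK.
have -> : L2norm L (err k) = L2norm L (fun x => eta k x + theta k x).
  by apply: eq_L2norm => x _; rewrite /nodal_error /total_error /space_error; ring.
have h1 := space_error_bound kt; have h2 := nodal_error_bound hk.
have Le : L2 L (eta k) by apply: space_error_L2; [exact: tau0|exact: hu|exact: N0|exact: hmesh|exact: kt].
have Lt : L2 L (theta k) by apply: nodal_error_L2; [exact: hmesh|exact: huh|exact: kt].
apply: (le_trans (L2norm_D Le Lt)).
apply: (le_trans (lerD h1 h2)).
rewrite addrA; apply: lerD; last by [].
rewrite [leLHS]addrC [leRHS]mulrDl; apply: lerD; first by [].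
rewrite [leLHS]mulrC ler_wpM2l// -addrA lerDl.
by rewrite addr_ge0 ?mulr_ge0 ?powR_ge0// ltW.
Qed.

End Final.

Theorem theorem3p2 (R : realType) (alpha tau p a b L : R) (K : nat)
    (f phi u : R -> R -> R) (Creg C0 kappa : R)
    (halpha : 0 < alpha < 1) (htau : 0 < tau) (hK : (0 < K)%N) (hp : 0 < p)
    (ha : a <= 0) (hb : b != 0) (hL : 0 < L)
    (hf : continuous_on_rectangle `]0, L[ `[0, K%:R * tau] f)
    (hphi : continuous_on_rectangle `]0, L[ `[- tau, 0] phi)
    (hu : delay_solution alpha tau K p a b L f phi u)
    (hreg : time_regular alpha tau K L Creg u)
    (huH2 : Linfty_H2 L (- tau) (K%:R * tau) u)
    (hdtuH2 : dt_L1_H2 L (- tau) (K%:R * tau) u) :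
  exists C : R, 0 < C /\
    forall (N M : nat) (xs : nat -> R) (uh : int -> R -> R),
      (2 <= N)%N ->
      mesh L M xs ->
      quasi_uniform kappa M xs ->
      (forall n : int, - (2 * N)%:Z <= n <= 0 ->
         L2norm L (fun x => uh n x - phi x (tm tau N n))
         <= C0 * mesh_size M xs ^+ 2) ->
      fem_solution alpha tau K p a b L f N M xs uh ->
      forall n : nat,
        ((1 <= n <= 2 * N)%N ->
           L2norm L (fun x => u x (tm tau N n%:Z) - uh n%:Z x)
           <= C * (mesh_size M xs ^+ 2
                   + step tau N * tm tau N n%:Z `^ (alpha - 1))) /\
        ((2 * N + 1 <= n <= 2 * K * N)%N ->
           L2norm L (fun x => u x (tm tau N n%:Z) - uh n%:Z x)
           <= C * (mesh_size M xs ^+ 2 + step tau N)).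
Proof.
have KT : 0 < K%:R * tau by rewrite mulr_gt0// ltr0n.
have tT : - tau < K%:R * tau by rewrite (lt_trans _ KT)// oppr_lt0.
have [cu _ ubd _ _] := hu.
have u0 s : - tau <= s <= K%:R * tau -> u 0 s = 0.
  by move=> sT; have [] := ubd s; rewrite ?inE/= ?in_itv.
(* [m], [Mu] and then [C1] are fixed before any mesh is introduced, so the final constant is
   independent of [N], [M] and [xs]. *)
have [m [im m1 inc]] := time_increment_H2_path hL cu u0 hdtuH2.
have [Mu [Mu0 uH2]] := H2_path_bound hL tT cu u0 huH2 hdtuH2.
pose C1 := gronwall_const alpha (K%:R * tau)
  (nodal_const alpha tau a b L K Creg C0 m Mu + Mu) `|C0| `|b|.
have al0 : 0 < alpha by case/andP: halpha.
have al1 : alpha - 1 <= 0 by rewrite subr_le0; case/andP: halpha => _ /ltW.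
have nc : 0 <= nodal_const alpha tau a b L K Creg C0 m Mu.
  exact: (@nodal_const_ge0 R alpha tau p a b L K f phi u Creg C0).
have C10 : 0 <= C1.
  by apply: gronwall_const_ge0 => //; [exact: addr_ge0|exact: ltW].
(* [tau^(1 - alpha)] absorbs the step into [step t_n^(alpha - 1)] when [t_n <= tau],
   [tau^(alpha - 1)] does the converse when [t_n >= tau], and the last 1 makes the constant
   positive. *)
exists (C1 * (1 + tau `^ (1 - alpha) + tau `^ (alpha - 1)) + 1); split.
  by rewrite ltr_wpDl// mulr_ge0// !addr_ge0 ?powR_ge0.
move=> N M xs uh N2 hmesh _ hinit huh n.
have N0 : (0 < N)%N by exact: ltn_trans N2.
have r0 := step_gt0 htau N0.
have bound : (0 < n <= 2 * K * N)%N ->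
    L2norm L (fun x => u x (tm tau N n%:Z) - uh n%:Z x) <=
    C1 * (mesh_size M xs ^+ 2 + step tau N + step tau N * tm tau N n `^ (alpha - 1)).
  exact: (total_error_bound halpha htau hK hL hp ha hf hu hreg im m1 inc Mu0 uH2 N0 hmesh huh hinit).
set r := step tau N in r0 bound *; set h2 := mesh_size M xs ^+ 2 in bound *.
set q := tm tau N n `^ (alpha - 1) in bound *.
set E := L2norm L _ in bound *.
set c1 := tau `^ (1 - alpha); set c2 := tau `^ (alpha - 1).
have h20 : 0 <= h2 by rewrite sqr_ge0.
have c10 : 0 <= c1 by exact: powR_ge0.
have c20 : 0 <= c2 by exact: powR_ge0.
have q0 : 0 <= q by exact: powR_ge0.
have rr := ltW r0.
have tau2 : tm tau N (2 * N)%N = tau by exact: (mul_step tau N0).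
split.
  move=> /andP[n1 nN]; apply: (le_trans (bound _)).
    by rewrite n1 (leq_trans nN)// mulnAC leq_pmulr.
  have tn0 : 0 < tm tau N n by rewrite mulr_gt0// ltr0z ltz_nat.
  have tn : tm tau N n <= tau by rewrite -[leRHS]tau2 tm_le// lez_nat.
  have cq : 1 <= c1 * q.
    rewrite /q -opprB powRN ler_pdivlMr ?powR_gt0// mul1r.
    by apply: ler_powRP; rewrite ?(ltW tn0)// subr_ge0 -subr_le0.
  have rq : 0 <= c1 * (r * q) - r by rewrite subr_ge0 mulrCA ler_peMr.
  rewrite -subr_ge0.
  have -> : (C1 * (1 + c1 + c2) + 1) * (h2 + r * q) - C1 * (h2 + r + r * q) =
    C1 * (c1 * (r * q) - r) + C1 * c1 * h2 + C1 * c2 * (h2 + r * q) + (h2 + r * q) by ring.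
  by move: rq; set d := _ - r => rq; nonneg.
move=> /andP[nN nK]; have n0 : (0 < n)%N by apply: leq_trans nN; rewrite addn1.
apply: (le_trans (bound _)); first by rewrite n0.
have tn : tau <= tm tau N n.
  by rewrite -[leLHS]tau2 tm_le// lez_nat (leq_trans _ nN)// leq_addr.
have rq : 0 <= c2 * r - r * q.
  rewrite subr_ge0 mulrC ler_wpM2r// /q /c2; apply: ler_powRN => //.
rewrite -subr_ge0.
have -> : (C1 * (1 + c1 + c2) + 1) * (h2 + r) - C1 * (h2 + r + r * q) =
  C1 * (c2 * r - r * q) + C1 * c2 * h2 + C1 * c1 * (h2 + r) + (h2 + r) by ring.
by move: rq; set d := _ - r * q => rq; nonneg.
Qed.
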